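(* Let $\mathcal G$ be a Beurling system satisfying Axiom A with parameters $\kappa,A,\theta$, and assume $\theta_0=1$. Let $\varepsilon>0$. Then there is $x_0(\mathcal G,\varepsilon)$ such that for every $x>x_0$ the following holds: if $\rho_1=\beta_1+i\gamma_1$ is a zero of $\zeta_{\mathcal G}$ (with $\beta_1>\theta$) satisfying $\omega(\rho_1;x)=\omega(x)$, then there exists $\xi\in[x^{1-\varepsilon},x]$ with $$|\Delta(\xi)|\ge \frac{\xi^{\beta_1}}{|\rho_1|^{1+\varepsilon}}.$$
   Context: Beurling system: commutative unitary semigroup $\mathcal G$ freely generated by countably many primes, with multiplicative norm $|\cdot|$ such that $\mathcal N(x)=\#\{g:|g|\le x\}$ is finite. Axiom A ($\kappa,A>0$, $0<\theta<1$): $|\mathcal N(x)-\kappa(x-1)|\le Ax^\theta$ for $x\ge1$. $\zeta_{\mathcal G}(s)=\sum_g|g|^{-s}$ extends meromorphically to $\Re s>\theta$ with only a simple pole at $1$; zeroes are taken with real part $>\theta$. $\Delta(x)=\psi(x)-x$, $\psi(x)=\sum_{|g|\le x}\Lambda(g)$, $\Lambda(p^k)=\log|p|$ for primes $p$, $k\ge1$, and $\Lambda=0$ otherwise. $\theta_0:=\max(\theta,\sup\{\beta:\zeta_{\mathcal G}(\beta+i\gamma)=0,\theta<\beta<1\})$. For a zero $\rho=\beta+i\gamma$, $\omega(\rho;x):=(1-\beta)\log x+\log|\rho|$, and $\omega(x):=\inf_\rho\omega(\rho;x)$ over all zeroes with $\Re\rho>\theta$. *)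

(* Defs.v *)
From HB Require Import structures.
From mathcomp Require Import all_boot all_order all_algebra finmap.
From mathcomp Require Import complex.
From mathcomp Require Import all_classical all_reals all_analysis.
(* the notations of monalg clash with those of MathComp-Analysis *)
From mathcomp Require Import -(notations) monalg.
From mathcomp.analysis.showcase Require summability.

Set Implicit Arguments.
Unset Strict Implicit.
Unset Printing Implicit Defensive.

Import Order.TTheory GRing.Theory Num.Theory.
Import numFieldNormedType.Exports.

Local Open Scope classical_set_scope.
Local Open Scope ring_scope.

(* The regular algebra R[i]^o is the type on which MathComp-Analysis puts the
   normed C-vector space structure of the complex numbers. *)
Local Notation C R := (R[i])^o.

(* The free commutative monoid on the primes is {cmonom bprime}: monomials are
   finitely supported exponent functions, and [ucm p] is the generator p.
   The finiteness of the counting function forces |p| > 1 for every prime. *)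
Record beurling (R : realType) := Beurling {
  bprime : countType;
  bnorm : cmonom bprime -> R;
  bnorm_gt0 : forall g, 0 < bnorm g;
  bnorm1 : bnorm mone = 1;
  bnormM : forall g h, bnorm (mmul g h) = bnorm g * bnorm h;
  bnorm_finite : forall x : R, finite_set [set g | bnorm g <= x]
}.
Arguments bnorm {R} b g.

Section Beurling.
Variables (R : realType) (G : beurling R).

Definition bcount (x : R) : R := #|` fset_set [set g | bnorm G g <= x] |%:R.

Definition axiomA (kappa A theta : R) : Prop :=
  [/\ 0 < kappa, 0 < A, 0 < theta < 1
    & forall x, 1 <= x -> `|bcount x - kappa * (x - 1)| <= A * x `^ theta].

(* log |p| if g = p^k with p prime and k >= 1, and 0 if there are no such p, k;
   the exponent k >= 1 and p are determined by g. *)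
Definition bLambda (g : cmonom (bprime G)) : R :=
  xget 0 [set l | exists (p : bprime G) (k : nat),
    [/\ (0 < k)%N, g = expcmn (ucm p) k & l = ln (bnorm G (ucm p))]].

Definition bpsi (x : R) : R :=
  \sum_(g \in [set g | bnorm G g <= x]) bLambda g.

Definition bDelta (x : R) : R := bpsi x - x.

(* a^s = a^(Re s) (cos (Im s log a) + i sin (Im s log a)), used for a > 0 *)
Definition cpow (a : R) (s : C R) : C R :=
  Complex (a `^ complex.Re s * cos (complex.Im s * ln a))
          (a `^ complex.Re s * sin (complex.Im s * ln a)).

(* F is the meromorphic continuation to Re s > theta of the unconditionally
   convergent series sum_g |g|^(-s), Re s > 1, with a simple pole at 1 and no
   other pole. [derivable F s 1] is complex differentiability, the increments
   being complex scalars. F 1 is unconstrained. *)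
Definition is_zeta (theta : R) (F : C R -> C R) : Prop :=
  [/\ forall s : C R, 1 < complex.Re s ->
        summability.partial_sum (fun g => cpow (bnorm G g) (- s))
          @ summability.totally --> F s,
      forall s : C R, theta < complex.Re s -> s != 1 -> derivable F s 1
    & exists2 c : C R, c != 0 & (s - 1) * F s @[s --> (1 : C R)^'] --> c].

(* [is_zeta] determines the values on Re s > theta, s != 1; the other values
   are irrelevant. *)
Definition bzeta (theta : R) : C R -> C R :=
  xget (fun=> 0) [set F | is_zeta theta F].

Definition zeta_zero (theta : R) (rho : C R) : Prop :=
  [/\ theta < complex.Re rho, rho != 1 & bzeta theta rho = 0].

(* With value in \bar R, so that the supremum of the empty set is -oo. *)
Definition theta0 (theta : R) : \bar R :=
  maxe theta%:E
    (ereal_sup [set beta%:E | beta in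
      [set beta : R | theta < beta < 1 /\
        exists gamma : R, bzeta theta (Complex beta gamma) = 0]]).

Definition omega (rho : C R) (x : R) : R :=
  (1 - complex.Re rho) * ln x + ln (ComplexField.Normc.normc rho).

Definition omega_inf (theta x : R) : \bar R :=
  ereal_inf [set (omega rho x)%:E | rho in zeta_zero theta].

End Beurling.

(* Main.v *)
(* Let L = log x, T = |rho1|, s0 = 1 + delta + i gamma1 with a small constant
   delta, and d = s0 - rho1. Since theta0 = 1, the minimality of rho1 forces
   beta1 -> 1 and log T = o(L); a compactness argument based on zeta <> 0 on
   Re s = 1 gives T -> oo. Suppose that |Delta(xi)| < xi^beta1 / T^(1+eps) on
   [x^(1-eps), x]. Abel summation then shows that the k-th Taylor coefficient at
   s0 of the logarithmic derivative of zeta is O(T^-eps d^(-k-1)) for all k in a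
   range proportional to L, because the weight |g|^(-1-delta) log^k |g| / k! is
   concentrated on this interval. Up to sign and small errors this coefficient
   is the power sum of exponent k + 1 of the inverses of s0 - rho over the zeros
   rho near s0, and by Landau's (Jensen's) inequality and axiomA there are at
   most c log T such zeros, with c -> 0 as delta -> 0. Turan's second main
   theorem bounds one of these power sums from below by T^(-eps/2) d^(-k-1),
   a contradiction. No analytic continuation is used beyond a small rectangle:
   the zeros are those of a Taylor polynomial of zeta at s0. *)

Require Import Defs.
From mathcomp Require Import all_boot all_order all_algebra finmap.
From mathcomp Require Import complex ring lra.
From mathcomp Require Import all_classical all_reals all_analysis.
From mathcomp Require Import -(notations) monalg.
From mathcomp Require cyclic separable cyclotomic.

Set Implicit Arguments.
Unset Strict Implicit.
Unset Printing Implicit Defensive.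
Import Order.TTheory GRing.Theory Num.Theory.
Import numFieldNormedType.Exports.
Local Open Scope classical_set_scope.
Local Open Scope ring_scope.

(** The exponent [1 + eps] has two uses: one factor [T] pays for [|s0|], which partial summation
    introduces, and [T^-eps] remains. Turan's theorem loses a factor [2^m] for power sums with
    exponents beyond [m], while the usable [k] grow with [L], so a direct application would lose a
    power of [x]. It is therefore applied to the [q]-th powers of the inverse zeros, with [q] of
    order [L / n], where [n] is the number of zeros in question: then [m = O(n)], and since [n] is a
    small multiple of [log T], the whole loss is a small power of [T]. The minimality of [rho1] is
    used only against one fixed zero close to the line [Re s = 1], so nothing is known about the
    position of the other zeros near [s0]; their number alone has to suffice. A further obstacle is
    that the distance [d] exceeds [delta]: the Dirichlet series, hence the direct proof that the
    Taylor series represents zeta, stops just short of [rho1]. *)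

Local Notation nc := ComplexField.Normc.normc.

(** * Complex absolute value *)

Section ComplexNorm.
Variable R : rcfType.
Implicit Types (x y z : R[i]) (a : R).

Lemma nc_ge0 z : 0 <= nc z.
Proof. by case: z => a b; apply: sqrtr_ge0. Qed.

Lemma ncM x y : nc (x * y) = nc x * nc y.
Proof. exact: ComplexField.Normc.normcM. Qed.

Lemma ncV x : nc x^-1 = (nc x)^-1.
Proof. exact: ComplexField.Normc.normcV. Qed.

Lemma nc0 : nc 0 = 0 :> R.
Proof. exact: ComplexField.Normc.normc0. Qed.

Lemma nc1 : nc 1 = 1 :> R.
Proof. exact: ComplexField.Normc.normc1. Qed.

Lemma ncD x y : nc (x + y) <= nc x + nc y.
Proof. exact: (@le_normcD R). Qed.

Lemma ncN x : nc (- x) = nc x.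
Proof. exact: (@normcN R). Qed.

Lemma ncBC x y : nc (x - y) = nc (y - x).
Proof. by rewrite -ncN opprB. Qed.

Lemma ncB x y : nc (x - y) <= nc x + nc y.
Proof. by rewrite -[nc y]ncN ncD. Qed.

Lemma ncB_ge x y : nc x - nc y <= nc (x - y).
Proof. by rewrite lerBlDr -{1}[x](subrK y) ncD. Qed.

Lemma ncD_ge x y : nc x - nc y <= nc (x + y).
Proof. by rewrite -[y in leRHS]opprK -[nc y]ncN ncB_ge. Qed.

Lemma ncX x n : nc (x ^+ n) = nc x ^+ n.
Proof. by elim: n => [|n IHn]; rewrite ?expr0 ?nc1// !exprS ncM IHn. Qed.

Lemma nc_eq0 x : (nc x == 0) = (x == 0).
Proof.
by apply/eqP/eqP => [/ComplexField.Normc.eq0_normc//|->]; rewrite nc0.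
Qed.

Lemma nc_gt0 x : (0 < nc x) = (x != 0).
Proof. by rewrite lt_def nc_ge0 andbT nc_eq0. Qed.

Lemma nc_sum (I : Type) (r : seq I) (P : pred I) (F : I -> R[i]) :
  nc (\sum_(i <- r | P i) F i) <= \sum_(i <- r | P i) nc (F i).
Proof.
elim/big_ind2 : _ => [|x a y b xa yb|i _]; rewrite ?nc0//.
by rewrite (le_trans (ncD _ _))// lerD.
Qed.

Lemma nc_prod (I : Type) (r : seq I) (P : pred I) (F : I -> R[i]) :
  nc (\prod_(i <- r | P i) F i) = \prod_(i <- r | P i) nc (F i).
Proof. by elim/big_ind2 : _ => [|x a y b <- <-|]; rewrite ?nc1 ?ncM. Qed.

Lemma ncR a : nc a%:C%C = `|a|.
Proof. by rewrite /nc/= expr0n/= addr0 sqrtr_sqr. Qed.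

Lemma nc_nat n : nc n%:R = n%:R :> R.
Proof. by rewrite -(rmorph_nat (real_complex R)) ncR ger0_norm. Qed.

Lemma nc_Re z : `|complex.Re z| <= nc z.
Proof.
by case: z => a b /=; rewrite -sqrtr_sqr ler_wsqrtr// lerDl sqr_ge0.
Qed.

Lemma nc_Im z : `|complex.Im z| <= nc z.
Proof.
by case: z => a b /=; rewrite -sqrtr_sqr ler_wsqrtr// lerDr sqr_ge0.
Qed.

Lemma Re_le_nc z : complex.Re z <= nc z.
Proof. exact: le_trans (ler_norm _) (nc_Re z). Qed.

Lemma nc_sqr z : nc z ^+ 2 = complex.Re z ^+ 2 + complex.Im z ^+ 2.
Proof. by case: z => a b /=; rewrite sqr_sqrtr// addr_ge0 ?sqr_ge0. Qed.

Lemma nc_ReIm z : nc z <= `|complex.Re z| + `|complex.Im z|.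
Proof.
rewrite -(@ler_pXn2r _ 2) ?nnegrE ?nc_ge0 ?addr_ge0// nc_sqr sqrrD.
rewrite !real_normK ?num_real// lerD2r lerDl mulrn_wge0// mulr_ge0.
Qed.

Lemma cReD x y : complex.Re (x + y) = complex.Re x + complex.Re y.
Proof. by case: x y => [a b] [c d]. Qed.
Lemma cImD x y : complex.Im (x + y) = complex.Im x + complex.Im y.
Proof. by case: x y => [a b] [c d]. Qed.
Lemma cReN x : complex.Re (- x) = - complex.Re x.
Proof. by case: x. Qed.
Lemma cImN x : complex.Im (- x) = - complex.Im x.
Proof. by case: x. Qed.
Lemma cReM x y : complex.Re (x * y) =
  complex.Re x * complex.Re y - complex.Im x * complex.Im y.
Proof. by case: x y => [a b] [c d]. Qed.
Lemma cImM x y : complex.Im (x * y) =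
  complex.Re x * complex.Im y + complex.Im x * complex.Re y.
Proof. by case: x y => [a b] [c d]. Qed.

Lemma cRe_sum (I : Type) (r : seq I) (P : pred I) (F : I -> R[i]) :
  complex.Re (\sum_(i <- r | P i) F i) = \sum_(i <- r | P i) complex.Re (F i).
Proof.
by elim/big_ind2 : _ => [|x a y b <- <-|]//; rewrite cReD.
Qed.
Lemma cIm_sum (I : Type) (r : seq I) (P : pred I) (F : I -> R[i]) :
  complex.Im (\sum_(i <- r | P i) F i) = \sum_(i <- r | P i) complex.Im (F i).
Proof.
by elim/big_ind2 : _ => [|x a y b <- <-|]//; rewrite cImD.
Qed.

End ComplexNorm.

(** * A monic polynomial is not small at all points of a grid *)

Section Spread.
Variable R : realType.

Lemma expR_ge_coeff (x : R) n : 0 <= x -> x ^+ n / n`!%:R <= expR x.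
Proof.
move=> x0; have: series (exp_coeff x) n.+1 <= expR x.
  apply: nondecreasing_cvgn_le; last exact: is_cvg_series_exp_coeff.
  by apply/nondecreasing_seqP => k; rewrite seriesSr lerDl exp_coeff_ge0.
apply: le_trans; rewrite seriesSr /= lerDr.
by rewrite /series/= sumr_ge0// => i _; exact: exp_coeff_ge0.
Qed.

Lemma expR1_le4 : expR 1 <= 4 :> R.
Proof.
have h : expR (2^-1 : R) <= 2.
  rewrite -[_^-1]opprK expRN -[leRHS]invrK lef_pV2 ?posrE ?expR_gt0 ?invr_gt0//.
  by apply: le_trans (expR_ge1Dx _); lra.
have -> : (1 : R) = 2^-1 + 2^-1 by lra.
rewrite expRD (@le_trans _ _ (2 * 2)) ?ler_pM ?expR_ge0//; lra.
Qed.

Lemma expn_le_fact n : n%:R ^+ n <= 4 ^+ n * n`!%:R :> R.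
Proof.
rewrite -ler_pdivrMr ?ltr0n ?fact_gt0//.
apply: (le_trans (expR_ge_coeff _ _)) => //.
by rewrite -[n%:R]mulr1 expRM_natl lerXn2r ?nnegrE ?expR_ge0// expR1_le4.
Qed.

Definition fdiff (h : R) (f : R -> R) (x : R) := f (x + h) - f x.

Lemma fdiff_Leibniz h r g k x :
  iter k (fdiff h) (fun x => (x - r) * g x) x =
  (x - r) * iter k (fdiff h) g x + k%:R * h * iter k.-1 (fdiff h) g (x + h).
Proof.
elim: k x => [|k IHk] x; first by rewrite /=; ring.
rewrite iterS {1}/fdiff !IHk; case: k {IHk} => [|k] /=.
  by rewrite /fdiff; ring.
set G := iter k _ g; rewrite /fdiff -[k.+2%:R]natr1 -[k.+1%:R]natr1; ring.
Qed.

(** The vanishing of the higher differences is part of the induction: the Leibniz rule with a linear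
    factor involves differences of two consecutive orders. *)
Lemma fdiff_prod h (rs : seq R) x :
  iter (size rs) (fdiff h) (fun x => \prod_(r <- rs) (x - r)) x =
    (size rs)`!%:R * h ^+ size rs /\
  forall k, (size rs < k)%N ->
    iter k (fdiff h) (fun x => \prod_(r <- rs) (x - r)) x = 0.
Proof.
have E r s : (fun x => \prod_(r <- r :: s) (x - r)) =
    (fun x => (x - r) * \prod_(r <- s) (x - r)).
  by apply/funext => y; rewrite big_cons.
elim: rs x => [|r s IHs] x /=.
  split; first by rewrite big_nil fact0 mulr1.
  case=> // k _; elim: k x => [|k IHk] x.
    by rewrite /= /fdiff !big_nil subrr.
  by rewrite iterS /fdiff !IHk subrr.
rewrite E; split.
  rewrite -iterS fdiff_Leibniz (IHs _).2// (IHs _).1 factS natrM exprS /=.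
  by ring.
case=> // k; rewrite ltnS => sk; rewrite fdiff_Leibniz (IHs _).2; last first.
  by rewrite ltnW.
by rewrite (IHs _).2// !mulr0 addr0.
Qed.

Lemma fdiff_lt h f B k x : (forall i, (i <= k)%N -> `|f (x + i%:R * h)| < B) ->
  `|iter k (fdiff h) f x| < 2 ^+ k * B.
Proof.
elim: k x => [|k IHk] x fB.
  by rewrite /= expr0 mul1r; have := fB 0 (leqnn _); rewrite mul0r addr0.
rewrite iterS /fdiff (le_lt_trans (ler_normB _ _))// exprS -mulrA mulr2n mulrDl.
rewrite mul1r ltrD//; apply: IHk => i ik.
  by have := fB i.+1 ik; rewrite -natr1 mulrDl mul1r -addrA [h + _]addrC.
by apply: fB; rewrite (leq_trans ik).
Qed.

(** With [n = size rs], the [n]-th difference with step [1/n] of the monic polynomial with roots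
    [rs] is [n! / n^n >= 4^-n]. It combines values at the grid points with binomial weights of total
    size [2^n], so one of these values is at least [8^-n]. *)
Lemma spread (rs : seq R) : (0 < size rs)%N -> exists2 i, (i <= size rs)%N &
  (8^-1) ^+ size rs <= \prod_(r <- rs) `|i%:R / (size rs)%:R - r|.
Proof.
move=> n0; apply: contrapT => H.
have n0R : 0 < (size rs)%:R :> R by rewrite ltr0n.
have := @fdiff_lt (size rs)%:R^-1 (fun x => \prod_(r <- rs) (x - r))
  ((8^-1) ^+ size rs) (size rs) 0.
rewrite (fdiff_prod _ rs 0).1 => /(_ _)/wrap[].
  move=> i iln; rewrite ltNge add0r normr_prod; apply/negP => h.
  by apply: H; exists i.
rewrite ger0_norm ?mulr_ge0 ?exprn_ge0 ?invr_ge0 ?(ltW n0R)// -exprMn.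
apply/negP; rewrite -leNgt exprVn ler_pdivlMr ?exprn_gt0//.
have -> : 2 * 8^-1 = 4^-1 :> R by lra.
by rewrite exprVn mulrC ler_pdivrMr ?exprn_gt0// mulrC expn_le_fact.
Qed.

End Spread.

(** * Turan's second main theorem *)

Section RootsOfUnity.
Variable R : rcfType.

Lemma complex_prim_root n : (0 < n)%N -> exists z : R[i], n.-primitive_root z.
Proof.
pose p : {poly R[i]} := 'X^n - 1; have [r Dp] := closed_field_poly_normal p.
move=> n_gt0; rewrite (monicP _) ?monicXnsubC// scale1r in Dp.
have rn1 : all n.-unity_root r by apply/allP => z; rewrite -root_prod_XsubC -Dp.
have sz_r : (n < (size r).+1)%N.
  by rewrite -(size_prod_XsubC r id) -Dp size_XnsubC.
have [|z] := hasP (cyclic.has_prim_root n_gt0 rn1 _ sz_r); last by exists z.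
by rewrite -separable.separable_prod_XsubC -Dp cyclotomic.separable_Xn_sub_1// pnatr_eq0 -lt0n.
Qed.

Lemma prim_root_norm n (z : R[i]) : n.-primitive_root z -> nc z = 1.
Proof.
move=> zn; have n0 := prim_order_gt0 zn.
apply/eqP; rewrite -(@pexpr_eq1 _ _ n) ?nc_ge0//.
by rewrite -ncX (prim_expr_order zn) nc1.
Qed.

Variables (M : nat) (z : R[i]).
Hypothesis zM : M.-primitive_root z.

Lemma sum_prim_root l : (0 < l < M)%N -> \sum_(i < M) (z ^+ i) ^+ l = 0.
Proof.
move=> /andP[l0 lM].
have zl : z ^+ l - 1 != 0.
  rewrite subr_eq0 -(prim_order_dvd zM); apply/negP => /dvdn_leq.
  by rewrite l0 leqNgt lM => /(_ isT).
apply: (mulfI zl); rewrite mulr0.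
under eq_bigr do rewrite exprAC.
by rewrite -subrX1 exprAC (prim_expr_order zM) expr1n subrr.
Qed.

(** Since [(b z^i)^M = b^M], each term is a geometric sum of length [M] divided by [1 - b^M];
    summation over [i] leaves only the exponent 0. *)
Lemma sum_geo_prim_root b : b ^+ M != 1 ->
  \sum_(i < M) (1 - b * z ^+ i)^-1 = M%:R / (1 - b ^+ M).
Proof.
move=> bM; have b1 : 1 - b ^+ M != 0 by rewrite subr_eq0 eq_sym.
have E (i : 'I_M) : (1 - b * z ^+ i)^-1 =
    (\sum_(l < M) (b * z ^+ i) ^+ l) / (1 - b ^+ M).
  have h : (b * z ^+ i) ^+ M = b ^+ M.
    by rewrite exprMn exprAC (prim_expr_order zM) expr1n mulr1.
  have nz : 1 - b * z ^+ i != 0.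
    rewrite subr_eq0; apply: contra bM => /eqP e.
    by rewrite -h -e expr1n.
  apply: (mulfI nz); rewrite divff// mulrA -[1 - b * _]opprB mulNr -subrX1 h.
  by rewrite opprB divff.
under eq_bigr do rewrite E.
rewrite -mulr_suml exchange_big/=; congr (_ / _).
have M0 := prim_order_gt0 zM.
rewrite (bigD1 (Ordinal M0))//= [X in _ + X]big1 ?addr0.
  by rewrite sumr_const card_ord.
move=> l l0; under eq_bigr do rewrite exprMn.
rewrite -mulr_sumr sum_prim_root ?mulr0// ltn_ord andbT lt0n.
by apply: contra l0 => /eqP h; apply/eqP/val_inj.
Qed.

(** A polynomial in [t z^i] without constant term and of degree below [M] has mean 0. In Turan's
    theorem this removes the power sums of exponents at most [m]. *)
Lemma sum_circle_poly (t : R[i]) k : (k.+1 < M)%N ->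
  \sum_(i < M) (t * z ^+ i) * (1 + t * z ^+ i) ^+ k = 0.
Proof.
move=> kM; under eq_bigr do rewrite exprDn mulr_sumr.
rewrite exchange_big/= big1// => j _.
transitivity ((t ^+ j.+1 *+ 'C(k, j)) * \sum_(i < M) (z ^+ i) ^+ j.+1).
  rewrite mulr_sumr; apply: eq_bigr => i _.
  by rewrite expr1n mul1r !mulrnAr mulrnAl -exprS exprMn.
by rewrite sum_prim_root ?mulr0// (leq_ltn_trans _ kM)// ltnS -ltnS.
Qed.

End RootsOfUnity.

Lemma sumr_const_seq (V : nmodType) (T : Type) (s : seq T) (c : V) :
  \sum_(i <- s) c = c *+ size s.
Proof. by rewrite big_const_seq count_predT iter_addr_0. Qed.

Section Turan.
Variable R : realType.
Implicit Types (vs : seq R[i]) (v : R[i]).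

Lemma prod_coef_sum vs N : (forall v, v \in vs -> nc v <= 1) ->
  \sum_(i < N) nc (\prod_(v <- vs) (1 - v *: 'X))`_i <= 2 ^+ size vs.
Proof.
elim: vs N => [|v vs IH] N vs1.
  rewrite big_nil /= expr0; case: N => [|N]; first by rewrite big_ord0.
  rewrite big_ord_recl coef1 nc1 big1 ?addr0// => i _.
  by rewrite coef1 nc0.
rewrite big_cons; set P := \prod_(j <- vs) _.
have le2 K : \sum_(i < K) nc P`_i <= 2 ^+ size vs.
  by apply: IH => u us; apply: vs1; rewrite inE us orbT.
have v1 : nc v <= 1 by apply: vs1; rewrite inE eqxx.
rewrite [size _]/= exprS mulr_natl mulr2n.
apply: (@le_trans _ _ (\sum_(i < N) nc P`_i + \sum_(i < N.-1) nc P`_i)).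
  case: N => [|N]; first by rewrite !big_ord0 addr0.
  rewrite !big_ord_recl /= -/P mulrDl mulNr mul1r coefB -scalerAl coefZ coefXM/=.
  rewrite mulr0.
  rewrite subr0 /lift -addrA lerD2l -big_split/= ler_sum// => i _.
  rewrite coefB coefZ coefXM/=; apply: (le_trans (ncB _ _)).
  by rewrite lerD2l ncM ler_piMl ?nc_ge0.
by rewrite lerD.
Qed.

Lemma prod_rem vs v : v \in vs ->
  \prod_(u <- vs) (1 - u *: 'X) =
    (1 - v *: 'X) * \prod_(u <- rem v vs) (1 - u *: 'X) :> {poly R[i]}.
Proof. by move=> vvs; rewrite (perm_big _ (perm_to_rem vvs)) big_cons. Qed.

Lemma size_prod_1subZX vs :
  (size (\prod_(u <- vs) (1 - u *: 'X) : {poly R[i]})%R <= (size vs).+1)%N.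
Proof.
elim: vs => [|v vs IH]; first by rewrite big_nil size_poly1.
rewrite big_cons (leq_trans (size_polyMleq _ _))//=.
have s2 : (size (1 - v *: 'X : {poly R[i]})%R <= 2)%N.
  rewrite (leq_trans (size_polyD _ _))// size_poly1 size_polyN geq_max/=.
  by rewrite (leq_trans (size_scale_leq _ _))// size_polyX.
by rewrite -subn1 leq_subLR (leq_trans (leq_add s2 IH)).
Qed.

(** The coefficients of the quotient by [1 - v X] are those of the product with the geometric series
    in [v X]. After summation over [v], the powers of [v] become power sums. *)
Lemma prod_rem_horner vs v z : v \in vs ->
  (\prod_(u <- rem v vs) (1 - u *: 'X)).[z] =
  \sum_(t < size vs) z ^+ t *
    \sum_(i < t.+1) (\prod_(u <- vs) (1 - u *: 'X))`_i * v ^+ (t - i).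
Proof.
move=> vvs; set P := \prod_(u <- rem v vs) _.
have sP : (size P <= size vs)%N.
  by rewrite (leq_trans (size_prod_1subZX _))// size_rem// prednK//; case: (vs) vvs.
rewrite (horner_coef_wide _ sP); apply: eq_bigr => t _.
rewrite mulrC; congr (_ * _).
elim: (t : nat) => [|k IHk].
  rewrite big_ord_recl big_ord0 (prod_rem vvs) mulrBl mul1r coefB -scalerAl.
  by rewrite coefZ coefXM/= mulr0 subr0 addr0 mulr1.
rewrite big_ord_recr/= subnn expr0 mulr1.
have -> : \sum_(i < k.+1) (\prod_(u <- vs) (1 - u *: 'X))`_i * v ^+ (k.+1 - i)
    = v * P`_k.
  rewrite IHk mulr_sumr; apply: eq_bigr => i _.
  by rewrite subSn -1?ltnS// exprS mulrCA.
rewrite (prod_rem vvs) mulrBl mul1r coefB -scalerAl coefZ coefXM/=.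
by rewrite addrC subrK.
Qed.

(** The expression tends to 0 if [|u| < 1] and to 1 if [|u| > 1]. In both cases its real part is
    asymptotically nonnegative; in Turan's theorem, the [v] other than 1 therefore cannot cancel the
    contribution of 1. *)
Lemma root_filter_limit (u : R[i]) (e : R) : 0 < e -> nc u != 1 ->
  exists M0, forall M, (M0 <= M)%N ->
    u ^+ M != 1 /\ - e <= complex.Re (1 - (1 - u ^+ M)^-1).
Proof.
move=> e0 u1.
suff [a a01 aP] : exists2 a : R, 0 <= a < 1 & forall M, (0 < M)%N ->
    a ^+ M < 1 -> u ^+ M != 1 /\
    - (a ^+ M / (1 - a ^+ M)) <= complex.Re (1 - (1 - u ^+ M)^-1).
  have /cvgrPdist_lt/(_ (e / (1 + e)))[] : a ^+ n @[n --> \oo] --> 0.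
    by apply: cvg_expr; rewrite ger0_norm; case/andP: a01.
    by rewrite divr_gt0// addr_gt0.
  move=> N _ NP; exists N.+1 => M NM.
  have := NP M (ltnW NM); rewrite /= sub0r normrN normrX ger0_norm; last first.
    by case/andP: a01.
  rewrite ltr_pdivlMr ?addr_gt0// => h.
  have aM0 : 0 <= a ^+ M by rewrite exprn_ge0//; case/andP: a01.
  have aM1 : a ^+ M < 1.
    rewrite exprn_ilt1//; case/andP: a01 => //.
    by rewrite -lt0n (leq_trans _ NM).
  have [||uM h2] := aP M => //; first by rewrite (leq_trans _ NM).
  split=> //; apply: le_trans h2; rewrite lerN2 ler_pdivrMr ?subr_gt0//.
  by nra.
have inv z : z != 1 -> 1 - (1 - z)^-1 = - (z / (1 - z)) :> R[i].
  move=> z1; have : 1 - z != 0 by rewrite subr_eq0 eq_sym.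
  by move=> z1'; field.
case: (ltgtP (nc u) 1) u1 => // [ul|ug] _.
  exists (nc u); first by rewrite nc_ge0.
  move=> M M0 aM; have uM : u ^+ M != 1.
    by apply/eqP => h; move: aM; rewrite -ncX h nc1 ltxx.
  split=> //; rewrite inv// cReN lerN2 (le_trans (Re_le_nc _))//.
  rewrite ncM ncV ncX ler_wpM2l ?exprn_ge0 ?nc_ge0// lef_pV2 ?posrE.
  - by rewrite -ncX -[X in X - _](@nc1 R) ncB_ge.
  - by rewrite nc_gt0 subr_eq0 eq_sym.
  - by rewrite subr_gt0.
exists (nc u)^-1; first by rewrite invr_ge0 nc_ge0 invf_lt1// (lt_trans _ ug).
move=> M M0; rewrite exprVn => aM.
have u0 : 0 < nc u by rewrite (lt_trans _ ug).
have ug1 : 1 < nc u ^+ M by move: aM; rewrite invf_lt1 ?exprn_gt0.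
have uM : u ^+ M != 1.
  by apply/eqP => h; move: ug1; rewrite -ncX h nc1 ltxx.
split=> //; have nz : u ^+ M - 1 != 0 by rewrite subr_eq0.
have -> : 1 - (1 - u ^+ M)^-1 = 1 + (u ^+ M - 1)^-1.
  by rewrite -[1 - u ^+ M]opprB invrN opprK.
have -> : (nc u ^+ M)^-1 / (1 - (nc u ^+ M)^-1) = (nc u ^+ M - 1)^-1.
  have nz2 : nc u ^+ M - 1 != 0 by rewrite subr_eq0 gt_eqF.
  have nz3 : nc u ^+ M != 0 by rewrite expf_neq0// gt_eqF.
  by field; rewrite nz2 nz3.
rewrite cReD /=; apply: (@le_trans _ _ (complex.Re ((u ^+ M - 1)^-1))); last first.
  by rewrite lerDr.
rewrite lerNl -cReN (le_trans (Re_le_nc _))// ncN ncV lef_pV2 ?posrE.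
- by rewrite -ncX -[X in _ - X](@nc1 R) ncB_ge.
- by rewrite nc_gt0.
- by rewrite subr_gt0.
Qed.

Lemma root_filter_limit_seq (us : seq R[i]) (e : R) : 0 < e ->
  (forall u, u \in us -> nc u != 1) ->
  exists M0, forall M, (M0 <= M)%N -> forall u, u \in us ->
    u ^+ M != 1 /\ - e <= complex.Re (1 - (1 - u ^+ M)^-1).
Proof.
move=> e0; elim: us => [|u us IH] us1; first by exists 0.
have [|N1 h1] := IH; first by move=> v vs; apply: us1; rewrite inE vs orbT.
have [|N2 h2] := @root_filter_limit u _ e0; first by apply: us1; rewrite inE eqxx.
exists (maxn N1 N2) => M; rewrite geq_max => /andP[M1 M2] v.
by rewrite inE => /predU1P[->|vs]; [exact: h2|exact: h1].
Qed.

(** [|1 - v| / |v|] is the distance from 1 to the pole [1 / v], so a radius away from all these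
    distances gives a circle about 1 on which the product of the [1 - v x] is not small. [spread]
    supplies it for the [v] with [|v| >= 1/4], whence [32 = 4 * 8]; for smaller [v] the factor is at
    least [1/2]. *)
Lemma circle_radius vs : 1 \in vs ->
  exists2 tau : R, 0 < tau <= 1 & (32^-1) ^+ size vs <=
    \prod_(v <- vs) `|nc (1 - v) - tau * nc v|.
Proof.
move=> vs1; pose rs := [seq nc (1 - v) / nc v | v <- vs & 4^-1 <= nc v].
have rs0 : 0 \in rs.
  apply/mapP; exists 1; last by rewrite subrr nc0 mul0r.
  by rewrite mem_filter vs1 andbT nc1; lra.
have szrs : (0 < size rs)%N by case: (rs) rs0.
have [i isz hi] := spread szrs; exists (i%:R / (size rs)%:R).
  apply/andP; split; last by rewrite ler_pdivrMr ?ltr0n// mul1r ler_nat.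
  (* The radius is nonzero because [v = 1] puts 0 among the distances, and the product would vanish
     there. *)
  rewrite lt_def divr_ge0// andbT; apply/eqP => i0.
  have := hi; rewrite i0 (big_rem _ rs0)/= subrr normr0 mul0r leNgt.
  by rewrite exprn_gt0.
set tau := _ / _ in hi *.
have tau0 : 0 <= tau by rewrite divr_ge0.
have tau1 : tau <= 1 by rewrite ler_pdivrMr ?ltr0n// mul1r ler_nat.
have szrs' : (size rs <= size vs)%N.
  by rewrite size_map size_filter count_size.
apply: (@le_trans _ _ ((4^-1) ^+ size vs * (8^-1) ^+ size rs)).
  rewrite [32^-1](_ : _ = 4^-1 * 8^-1); last by lra.
  rewrite exprMn ler_pM2l ?exprn_gt0//.
  by rewrite ler_wiXn2l//; lra.
apply: (@le_trans _ _ ((4^-1) ^+ size vs * \prod_(r <- rs) `|tau - r|)).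
  by rewrite ler_pM2l ?exprn_gt0.
rewrite /rs; elim: (vs) => [|v us IH] /=.
  by rewrite !big_nil mulr1.
rewrite big_cons exprS; case: ifPn => [v4|]; last rewrite -ltNge => v4.
  have v0 : 0 < nc v by apply: lt_le_trans v4.
  rewrite /= big_cons mulrACA ler_pM//.
  - by rewrite mulr_ge0 ?exprn_ge0 ?prodr_ge0.
  - have -> : nc (1 - v) - tau * nc v = - (nc v * (tau - nc (1 - v) / nc v)).
      by field; rewrite gt_eqF.
    by rewrite normrN normrM (gtr0_norm v0) ler_wpM2r.
rewrite -mulrA ler_pM//.
  by rewrite mulr_ge0 ?exprn_ge0 ?prodr_ge0.
apply: le_trans (ler_norm _).
have := ncB_ge 1 v; rewrite nc1; have := nc_ge0 v; nra.
Qed.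

(* With Y(x) = prod_v (1 - v x), the logarithmic derivative x Y'(x) / Y(x) is
   averaged over the points x = 1 + tau z, z^M = 1, in two ways: termwise, by
   summation over roots of unity, and through its expansion into the power sums
   of exponents at most m plus a remainder w / Y, where the polynomial w is
   small because the next power sums are. *)
Theorem Turan_second vs m (eta : R) : (forall v, v \in vs -> nc v <= 1) ->
  1 \in vs ->
  (forall i, (m < i <= m + size vs)%N -> nc (\sum_(v <- vs) v ^+ i) <= eta) ->
  1 <= 2 * (2 ^+ m * 128 ^+ size vs) * eta.
Proof.
move=> vle1 vs1 small.
have [tau /andP[tau0 tau1] htau] := circle_radius vs1.
set n := size vs in small htau *.
have n0 : (0 < n)%N by rewrite /n; case: (vs) vs1.
have n0R : 0 < n%:R :> R by rewrite ltr0n.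
have prod0 : forall v, v \in vs -> nc (1 - v) - tau * nc v != 0.
  move=> v vvs; apply/eqP => h; move: htau.
  by rewrite (big_rem _ vvs)/= h normr0 mul0r leNgt exprn_gt0.
(* Chosen so that [1 - u v * z^i = (1 - v * (1 + x i)) / (1 - v)]; [|u v| = 1] would mean that the
   pole [1 / v] lies on the circle. *)
pose u v := v * tau%:C%C / (1 - v).
have [|u' /mapP|M0 hM0] :=
  @root_filter_limit_seq [seq u v | v <- vs & v != 1] (2 * n%:R)^-1.
- by rewrite invr_gt0 mulr_gt0.
- move=> [v]; rewrite mem_filter => /andP[v1 vvs] ->.
  rewrite /u ncM ncV ncM ncR (gtr0_norm tau0).
  have v10 : nc (1 - v) != 0 by rewrite nc_eq0 subr_eq0 eq_sym.
  apply: contra (prod0 v vvs) => /eqP h; rewrite subr_eq0.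
  by rewrite -[nc (1 - v)]mul1r -h divfK// mulrC.
(* Large enough for the limits of [root_filter_limit_seq], and above [m + 1] so that the polynomial
   part averages to 0. *)
pose M := maxn M0 m.+2.
have M1 : (0 < M)%N by rewrite leq_max orbT.
have mM : (m.+1 < M)%N by rewrite leq_max leqnn orbT.
have [z zM] := @complex_prim_root R M M1.
pose x (i : nat) : R[i] := tau%:C%C * z ^+ i.
have ncx i : nc (x i) = tau.
  by rewrite ncM ncX (prim_root_norm zM) expr1n mulr1 ncR gtr0_norm.
have ncZ i : nc (1 + x i) <= 2.
  by rewrite (le_trans (ncD _ _))// nc1 ncx; lra.
have dge v i : `|nc (1 - v) - tau * nc v| <= nc (1 - v * (1 + x i)).
  have -> : 1 - v * (1 + x i) = (1 - v) - v * x i by ring.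
  rewrite [tau * _]mulrC -(ncx i) -ncM ler_norml.
  by apply/andP; split; [rewrite lerNl opprB [leRHS]ncBC|]; exact: ncB_ge.
have dn0 v i : v \in vs -> 1 - v * (1 + x i) != 0.
  move=> vvs; rewrite -nc_gt0 (lt_le_trans _ (dge _ _))// normr_gt0.
  exact: prod0.
pose A v := \sum_(i < M) x i * (v / (1 - v * (1 + x i))).
(* Up to sign, [v = 1], whose pole is the centre of the circle, contributes [M]. Each of the other
   [n - 1] takes away at most [M / (2 n)] from the real part, so that [M / 2] survives. *)
have A1 : A 1 = - M%:R.
  rewrite /A (eq_bigr (fun=> -1)); first by rewrite sumr_const card_ord mulNrn.
  move=> i _; have := @dn0 1 i vs1; rewrite !mul1r opprD addNKr.
  by move=> xn0; rewrite invrN mulrN divff// -[x i]opprK oppr_eq0.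
have Ane v : v \in vs -> v != 1 -> - (M%:R / (2 * n%:R)) <= complex.Re (- A v).
  move=> vvs v1.
  have [||uM hu] := hM0 M _ (u v) _.
  - exact: leq_maxl.
  - by apply/mapP; exists v => //; rewrite mem_filter v1.
  suff -> : - A v = M%:R * (1 - (1 - u v ^+ M)^-1).
    rewrite -(rmorph_nat (real_complex R)) cReM mul0r subr0 -mulrN.
    by rewrite ler_wpM2l.
  rewrite /A mulrBr mulr1 -(sum_geo_prim_root zM uM).
  have -> : M%:R = \sum_(i < M) 1 :> R[i] by rewrite sumr_const card_ord.
  rewrite -sumrB -sumrN; apply: eq_bigr => i _.
  have v10 : 1 - v != 0 by rewrite subr_eq0 eq_sym.
  have d0 := dn0 v i vvs.
  have E : 1 - u v * z ^+ i = (1 - v * (1 + x i)) / (1 - v).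
    by rewrite /u /x; field.
  by rewrite E invf_div; field.
pose s i := \sum_(v <- vs) v ^+ i.
pose W (Z : R[i]) := \sum_(v <- vs) v ^+ m.+1 / (1 - v * Z).
(* This is [v / (1 - v Z) = sum_(k < m) v^(k+1) Z^k + v^(m+1) Z^m / (1 - v Z)], summed over [v]; the
   first part averages to 0. *)
have TE : \sum_(v <- vs) A v = \sum_(i < M) x i * (1 + x i) ^+ m * W (1 + x i).
  rewrite /A exchange_big/=.
  transitivity (\sum_(i < M) (x i * (\sum_(k < m) s k.+1 * (1 + x i) ^+ k) +
      x i * (1 + x i) ^+ m * W (1 + x i))); last first.
    rewrite big_split/= [X in X + _](_ : _ = 0) ?add0r//.
    under eq_bigr do rewrite mulr_sumr.
    rewrite exchange_big/= big1// => k _.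
    transitivity (s k.+1 * \sum_(i < M) x i * (1 + x i) ^+ k).
      by rewrite mulr_sumr; apply: eq_bigr => i _; rewrite mulrCA.
    by rewrite (sum_circle_poly zM) ?mulr0// (leq_ltn_trans _ mM)// ltnW// ltnS ltn_ord.
  apply: eq_bigr => i _; rewrite -mulrA -mulrDr -mulr_sumr; congr (_ * _).
  under [X in _ = X + _]eq_bigr do rewrite mulr_suml.
  rewrite exchange_big/= mulr_sumr -big_split/=.
  rewrite [LHS]big_seq [RHS]big_seq; apply: eq_bigr => v vvs.
  have := dn0 v i vvs; set Z := 1 + x i => d0.
  apply: (mulIf d0); rewrite divfK// mulrDl mulrA divfK//.
  under eq_bigr do rewrite exprS -mulrA -exprMn.
  rewrite -mulr_sumr -mulrA [_ * (1 - _)]mulrC.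
  have := subrX1 (v * Z) m => h.
  have -> : (1 - v * Z) * (\sum_(i0 < m) (v * Z) ^+ i0) = 1 - (v * Z) ^+ m.
    by rewrite -opprB mulNr -h opprB.
  by rewrite exprMn exprS; ring.
(* [W Y] is a polynomial in [Z] of degree below [n] whose coefficients involve only power sums of
   exponents [m + 1] to [m + n]. It is at most [4^n eta], as [|Z| <= 2] and the coefficients of [Y]
   have total size at most [2^n]; the division by [Y] costs [32^n]. *)
have Wle i : nc (W (1 + x i)) <= 128 ^+ n * eta.
  set Z := 1 + x i.
  pose Y := \prod_(v <- vs) (1 - v *: 'X) : {poly R[i]}.
  have YE : Y.[Z] = \prod_(v <- vs) (1 - v * Z).
    rewrite /Y horner_prod; apply: eq_bigr => v _.
    by rewrite !hornerE.
  have Ylow : (32^-1) ^+ n <= nc Y.[Z].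
    rewrite YE nc_prod (le_trans htau)// ler_prod// => v _.
    by rewrite normr_ge0/= dge.
  have Y0 : 0 < nc Y.[Z] by rewrite (lt_le_trans _ Ylow)// exprn_gt0.
  have eta0 : 0 <= eta.
    apply: le_trans (nc_ge0 _) (small m.+1 _).
    by rewrite ltnSn -addn1 leq_add2l.
  have WY : W Z * Y.[Z] = \sum_(t < n) Z ^+ t * \sum_(k < t.+1) Y`_k * s (m.+1 + (t - k))%N.
    rewrite /W mulr_suml.
    transitivity (\sum_(v <- vs) v ^+ m.+1 * (\prod_(u <- rem v vs) (1 - u *: 'X)).[Z]).
      rewrite [LHS]big_seq [RHS]big_seq; apply: eq_bigr => v vvs.
      have hz : (1 - v *: 'X).[Z] = 1 - v * Z by rewrite !hornerE.
      by rewrite /Y (prod_rem vvs) hornerM hz mulrA divfK//; exact: dn0.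
    transitivity (\sum_(v <- vs) v ^+ m.+1 * \sum_(t < n) Z ^+ t *
        \sum_(k < t.+1) Y`_k * v ^+ (t - k)).
      rewrite [LHS]big_seq [RHS]big_seq; apply: eq_bigr => v vvs.
      by rewrite (prod_rem_horner _ vvs).
    under eq_bigr do rewrite mulr_sumr.
    rewrite exchange_big/=; apply: eq_bigr => t _.
    under eq_bigr do rewrite mulrCA.
    rewrite -mulr_sumr; congr (_ * _).
    under eq_bigr do rewrite mulr_sumr.
    rewrite exchange_big/=; apply: eq_bigr => k _.
    rewrite /s mulr_sumr; apply: eq_bigr => v _.
    by rewrite exprD mulrCA.
  have : nc (W Z * Y.[Z]) <= 4 ^+ n * eta.
    rewrite WY (le_trans (nc_sum _ _ _))//.
    apply: (@le_trans _ _ (\sum_(t < n) 2 ^+ t * (2 ^+ n * eta))).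
      apply: ler_sum => t _; rewrite ncM ncX ler_pM ?exprn_ge0 ?nc_ge0//.
        by rewrite lerXn2r ?nnegrE ?nc_ge0// ncZ.
      rewrite (le_trans (nc_sum _ _ _))//.
      apply: (@le_trans _ _ (\sum_(k < t.+1) nc Y`_k * eta)).
        apply: ler_sum => k _; rewrite ncM ler_wpM2l ?nc_ge0// small//.
        rewrite addSn ltnS leq_addr/= -addnS leq_add2l.
        by rewrite (leq_trans _ (ltn_ord t))// ltnS leq_subr.
      by rewrite -mulr_suml ler_wpM2r// prod_coef_sum.
    rewrite -mulr_suml mulrA ler_wpM2r//.
    have := subrX1 (2 : R) n; rewrite (_ : 2 - 1 = 1 :> R) ?mul1r; last by lra.
    move=> <-; rewrite (_ : 4 = 2 * 2 :> R) ?exprMn; last by lra.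
    by rewrite ler_wpM2r ?exprn_ge0// gerBl.
  rewrite ncM -ler_pdivlMr// => /le_trans; apply.
  rewrite ler_pdivrMr// (_ : 128 = 4 * 32 :> R); last by lra.
  rewrite exprMn -!mulrA ler_wpM2l ?exprn_ge0// mulrCA ler_peMr//.
  by rewrite -ler_pdivrMl ?exprn_gt0// mulr1 -exprVn.
have Tre : M%:R / 2 <= complex.Re (- \sum_(v <- vs) A v).
  rewrite (big_rem _ vs1)/= A1 opprD opprK cReD.
  have -> : complex.Re (M%:R : R[i]) = M%:R.
    by rewrite -(rmorph_nat (real_complex R)).
  rewrite -sumrN cRe_sum.
  have : - ((n.-1)%:R * (M%:R / (2 * n%:R))) <=
      \sum_(v <- rem 1 vs) complex.Re (- A v).
    rewrite mulrC -mulNr -(size_rem vs1) [leLHS]mulr_natr -sumr_const_seq.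
    rewrite [leLHS]big_seq [leRHS]big_seq ler_sum// => v /mem_rem vvs.
    have [->|] := eqVneq v 1; last exact: Ane.
    rewrite A1 opprK -(rmorph_nat (real_complex R))/=.
    by rewrite (@le_trans _ _ 0)// oppr_le0 divr_ge0// mulr_ge0.
  have -> : (n.-1)%:R = n%:R - 1 :> R by rewrite -subn1 natrB.
  have -> : (n%:R - 1) * (M%:R / (2 * n%:R)) = M%:R / 2 - M%:R / (2 * n%:R) :> R.
    by field; rewrite gt_eqF.
  have : 0 <= M%:R / (2 * n%:R) :> R by rewrite divr_ge0// mulr_ge0.
  by lra.
have : complex.Re (- \sum_(v <- vs) A v) <= M%:R * (2 ^+ m * (128 ^+ n * eta)).
  rewrite (le_trans (Re_le_nc _))// ncN TE (le_trans (nc_sum _ _ _))//.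
  rewrite -[M in leRHS]card_ord -sumr_const mulr_suml ler_sum// => i _.
  rewrite mul1r -mulrA ncM ncx ncM ncX -[leRHS]mul1r ler_pM//.
  - exact: ltW.
  - by rewrite mulr_ge0 ?exprn_ge0 ?nc_ge0.
  by rewrite ler_pM ?exprn_ge0 ?nc_ge0// lerXn2r ?nnegrE ?nc_ge0// ncZ.
move=> /(le_trans Tre); rewrite ler_pM2l ?ltr0n// => h.
by rewrite -!mulrA; lra.
Qed.

End Turan.

(** * Landau's inequality and power sums of inverse zeros *)

Section Landau.
Variable R : realType.
Implicit Types (ys : seq R[i]) (p h : {poly R[i]}).

Lemma coef_1subZX_mul (y : R[i]) h k :
  ((1 - y *: 'X) * h)`_k = h`_k - y * (if k == 0%N then 0 else h`_k.-1).
Proof. by rewrite mulrBl mul1r coefB -scalerAl coefZ coefXM. Qed.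

Lemma nc_reflect (a b y : R[i]) :
  nc (a - y * b) ^+ 2 - nc (y^*%C * a - b) ^+ 2 =
  (1 - nc y ^+ 2) * (nc a ^+ 2 - nc b ^+ 2).
Proof.
rewrite !nc_sqr !(cReD, cImD, cReN, cImN, cReM, cImM).
by case: a b y => [a1 a2] [b1 b2] [y1 y2] /=; ring.
Qed.

(* Replacing the factor 1 - y X by its reflection y^* - X preserves the l^2
   norm of the coefficients. *)
Lemma Landau_step h y N : (size h < N)%N ->
  \sum_(k < N) nc ((1 - y *: 'X) * h)`_k ^+ 2 =
  \sum_(k < N) nc (((y^*%C)%:P - 'X) * h)`_k ^+ 2.
Proof.
move=> hN; apply/eqP; rewrite -subr_eq0 -sumrB; apply/eqP.
pose g k := (1 - nc y ^+ 2) * (if k == 0%N then 0 else nc h`_k.-1 ^+ 2).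
rewrite (eq_bigr (fun k : 'I_N => g k.+1 - g k)); last first.
  move=> k _; rewrite coef_1subZX_mul mulrBl coefB coefCM coefXM nc_reflect.
  by rewrite /g/= -mulrBr; case: ifP => // _; rewrite nc0 expr0n.
rewrite -(big_mkord xpredT (fun k => g k.+1 - g k)) telescope_sumr// /g/= mulr0.
rewrite subr0; case: N hN => // N; rewrite ltnS => hN /=.
by rewrite nth_default// nc0 expr0n/= mulr0.
Qed.

Lemma Landau_prod h us N : (size h + size us < N)%N ->
  \sum_(k < N) nc (\prod_(y <- us) (1 - y *: 'X) * h)`_k ^+ 2 =
  \sum_(k < N) nc (\prod_(y <- us) ((y^*%C)%:P - 'X) * h)`_k ^+ 2.
Proof.
elim: us h N => [|y us IH] h N /=; first by rewrite !big_nil.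
move=> hN; rewrite !big_cons -mulrA Landau_step; last first.
  rewrite (leq_ltn_trans (size_polyMleq _ _))//.
  have := size_prod_1subZX us; move: (size _) => a ha.
  rewrite (leq_ltn_trans _ hN)// -subn1 leq_subLR addnCA addSn addnS addnC.
  by rewrite -addnS leq_add2l (leq_trans ha).
rewrite mulrCA IH; last first.
  rewrite (leq_ltn_trans _ hN)// addnS -addSn leq_add2r.
  rewrite (leq_trans (size_polyMleq _ _))//.
  rewrite -opprB size_polyN size_XsubC.
  by case: (size h).
by rewrite mulrCA mulrA.
Qed.

Lemma size_coef_sum p N : \sum_(k < N) nc p`_k ^+ 2 <=
  (\sum_(k < N) nc p`_k) ^+ 2.
Proof.
elim: N => [|N IH]; first by rewrite !big_ord0 expr0n.
rewrite !big_ord_recr/= sqrrD -addrA lerD// lerDr mulrn_wge0// mulr_ge0 ?nc_ge0//.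
by rewrite sumr_ge0// => i _; exact: nc_ge0.
Qed.

(** Reflecting the factors with [P y] keeps the l^2 norm of the coefficients and turns the constant
    coefficient into [c] times the product of the conjugates of these [y]. One coefficient is at
    most the l^2 norm, which is at most the l^1 norm. *)
Lemma Landau (c : R[i]) ys (P : pred R[i]) N : ((size ys).+1 < N)%N ->
  nc c * \prod_(y <- ys | P y) nc y <=
  \sum_(k < N) nc (c *: \prod_(y <- ys) (1 - y *: 'X))`_k.
Proof.
move=> szN; rewrite -(@ler_pXn2r _ 2) ?nnegrE//; last 2 first.
- by rewrite mulr_ge0 ?nc_ge0// prodr_ge0// => y _; exact: nc_ge0.
- by rewrite sumr_ge0// => k _; exact: nc_ge0.
apply: le_trans (size_coef_sum _ _).
pose us := [seq y <- ys | P y]; pose vs := [seq y <- ys | ~~ P y].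
pose h := c *: \prod_(y <- vs) (1 - y *: 'X).
have -> : c *: \prod_(y <- ys) (1 - y *: 'X) =
    \prod_(y <- us) (1 - y *: 'X) * h.
  by rewrite /h /us /vs !big_filter -scalerAr [in LHS](bigID P).
rewrite Landau_prod; last first.
  rewrite (leq_ltn_trans _ szN)// /h.
  rewrite (leq_trans (leq_add (size_scale_leq _ _) (leqnn _)))//.
  rewrite (leq_trans (leq_add (size_prod_1subZX _) (leqnn _)))//.
  by rewrite addSn ltnS addnC /us /vs !size_filter count_predC.
case: N szN => // N _; rewrite big_ord_recl/= -[leLHS]addr0 lerD//; last first.
  by rewrite sumr_ge0// => k _; rewrite sqr_ge0.
rewrite lerXn2r ?nnegrE ?nc_ge0//.
  by rewrite mulr_ge0 ?nc_ge0// prodr_ge0// => y _; exact: nc_ge0.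
rewrite -horner_coef0 hornerM !horner_prod hornerZ horner_prod.
rewrite [X in _ * (c * X)]big1 ?mulr1; last first.
  by move=> y _; rewrite !hornerE ?mulr0 ?subr0 ?oppr0 ?addr0.
rewrite ncM mulrC nc_prod /us big_filter; rewrite le_eqVlt; apply/orP; left.
apply/eqP; congr (_ * _); apply: eq_bigr => y _; rewrite !hornerE.
by rewrite subr0; case: (y) => a b /=; rewrite sqrrN.
Qed.

Lemma coef_prod_scale (a : R[i]) ys k :
  (\prod_(y <- ys) (1 - (a * y) *: 'X))`_k =
  a ^+ k * (\prod_(y <- ys) (1 - y *: 'X))`_k.
Proof.
elim: ys k => [|y ys IH] k.
  rewrite !big_nil coef1; case: k => [|k]; first by rewrite expr0 mulr1.
  by rewrite mulr0.
rewrite !big_cons !coef_1subZX_mul !IH; case: k => [|k] /=; first by ring.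
by rewrite exprS; ring.
Qed.

(** Jensen's bound for the zeros of modulus at most [r], by [Landau] after scaling by [rho]: such a
    zero, with inverse [y], contributes a factor [rho |y| >= rho / r]. *)
Lemma count_large_roots (c : R[i]) ys (r rho B : R) N :
  0 < r -> r <= rho -> ((size ys).+1 < N)%N ->
  \sum_(k < N) nc (c *: \prod_(y <- ys) (1 - y *: 'X))`_k * rho ^+ k <= B ->
  nc c * (rho / r) ^+ count (fun y => r^-1 <= nc y) ys <= B.
Proof.
move=> r0 rrho szN; apply: le_trans.
have rho0 : 0 < rho by apply: lt_le_trans rrho.
have := @Landau c [seq rho%:C%C * y | y <- ys] (fun y => rho / r <= nc y) N.
rewrite size_map => /(_ szN).
rewrite [X in _ <= X -> _](_ : _ =
   \sum_(k < N) nc (c *: \prod_(y <- ys) (1 - y *: 'X))`_k * rho ^+ k).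
  apply: le_trans; rewrite ler_wpM2l ?nc_ge0// big_map.
  elim: {szN} ys => [|y ys IH]; first by rewrite big_nil.
  rewrite big_cons /= exprD ncM ncR gtr0_norm// ler_pM2l//.
  case: ifPn => hy; last by rewrite expr0 mul1r.
  by rewrite expr1 ler_pM ?exprn_ge0 ?divr_ge0 ?(ltW r0) ?(ltW rho0)// ler_pM2l.
apply: eq_bigr => k _; rewrite big_map !coefZ coef_prod_scale mulrCA ncM.
by rewrite mulrC ncX ncR gtr0_norm.
Qed.

Lemma coef_geo (y : R[i]) h k :
  \sum_(i < k.+1) ((1 - y *: 'X) * h)`_i * y ^+ (k - i) = h`_k.
Proof.
elim: k => [|k IHk].
  by rewrite big_ord1 coef_1subZX_mul mulr0 subr0 mulr1.
rewrite big_ord_recr/= subnn expr0 mulr1 coef_1subZX_mul/=.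
rewrite (eq_bigr (fun i : 'I_k.+1 =>
    y * (((1 - y *: 'X) * h)`_i * y ^+ (k - i)))); last first.
  by move=> i _; rewrite subSn -1?ltnS// exprS mulrCA.
by rewrite -mulr_sumr IHk addrC subrK.
Qed.

(** Newton's identities: the logarithmic derivative of [p] is the generating series of the negated
    power sums. *)
Lemma Newton_coef ys k : let p := \prod_(y <- ys) (1 - y *: 'X) in
  p`_k.+1 *+ k.+1 =
  \sum_(i < k.+1) p`_i * - \sum_(y <- ys) y ^+ (k - i).+1.
Proof.
elim: ys k => [|y ys IH] k /=.
  rewrite big_nil coef1 mul0rn big1// => i _.
  by rewrite big_nil oppr0 mulr0.
rewrite big_cons; move: IH; set q := \prod_(j <- ys) _ => IH.
set p := (1 - y *: 'X) * q.
transitivity (\sum_(i < k.+1) (p`_i * - \sum_(y <- ys) y ^+ (k - i).+1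
    - y * (p`_i * y ^+ (k - i)))); last first.
  by apply: eq_bigr => i _; rewrite big_cons exprS; ring.
rewrite sumrB -mulr_sumr coef_geo.
transitivity (q`_k.+1 *+ k.+1 - y * (q`_k *+ k) - y * q`_k).
  by rewrite /p coef_1subZX_mul/= mulrnBl mulrnAr mulrS; ring.
congr (_ - _).
under eq_bigr do rewrite /p coef_1subZX_mul mulrBl -mulrA.
rewrite sumrB -mulr_sumr -IH; congr (_ - _ * _).
rewrite big_ord_recl/= mul0r add0r; case: k => [|k]; first by rewrite big_ord0.
by rewrite IH; apply: eq_bigr => i _; rewrite /= subSS.
Qed.

(** The recurrence can be solved for [B]. This identifies the first [N] Taylor coefficients of a
    logarithmic derivative with the negated power sums of the Taylor polynomial of degree [N], since
    both satisfy it. *)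
Lemma Newton_unique (C B B' : nat -> R[i]) N : C 0 != 0 ->
  (forall k, (k < N)%N -> C k.+1 *+ k.+1 = \sum_(i < k.+1) C i * B (k - i)%N) ->
  (forall k, (k < N)%N -> C k.+1 *+ k.+1 = \sum_(i < k.+1) C i * B' (k - i)%N) ->
  forall k, (k < N)%N -> B k = B' k.
Proof.
move=> C0 h h' k; elim/ltn_ind: k => k IH kN.
have := h _ kN; rewrite h'// !big_ord_recl/= subn0.
under [X in _ = _ + X -> _]eq_bigr => i _.
  rewrite IH; last 2 first.
  - by rewrite /bump/= add1n subnSK// leq_subr.
  - by rewrite (leq_ltn_trans _ kN)// leq_subr.
  over.
by move/addIr/(mulfI C0).
Qed.

(** The [ys] are the inverses of the roots, with multiplicity. *)
Lemma poly_factor p : p`_0 != 0 -> exists2 ys : seq R[i], (size ys < size p)%N &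
  p = p`_0 *: \prod_(y <- ys) (1 - y *: 'X).
Proof.
move=> p0; have [r rP] := closed_field_poly_normal p.
have pn0 : p != 0 by apply: contraNneq p0 => ->; rewrite coef0.
have r0 z : z \in r -> z != 0.
  move=> zr; apply: contraNneq p0 => z0; rewrite -horner_coef0 rP hornerZ.
  by rewrite horner_prod (big_rem _ zr)/= z0 hornerXsubC subrr mul0r mulr0.
have E : p = (lead_coef p * \prod_(z <- r) - z) *:
    \prod_(y <- [seq z^-1 | z <- r]) (1 - y *: 'X).
  rewrite {1}rP -scalerA; congr (_ *: _); rewrite big_map -scaler_prod.
  rewrite [LHS]big_seq [RHS]big_seq; apply: eq_bigr => z /r0 z0.
  by rewrite scalerBr scalerA mulNr divff// scaleN1r opprK addrC scaleNr alg_polyC.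
exists [seq z^-1 | z <- r].
  by rewrite size_map rP size_scale ?lead_coef_eq0// size_prod_XsubC.
have -> // : p`_0 = lead_coef p * \prod_(z <- r) - z.
move: E; set c := _ * _ => E.
rewrite E coefZ -horner_coef0 horner_prod big1 ?mulr1// => y _.
by rewrite !hornerE ?mulr0 ?subr0 ?oppr0 ?addr0.
Qed.

End Landau.

Section PowerSums.
Variable R : realType.

Lemma geo_half_sum (x : R) m n : 0 <= x <= 2^-1 ->
  \sum_(m <= k < n) x ^+ k <= 2 * x ^+ m.
Proof.
move=> /andP[x0 x2]; have [mn|nm] := leqP m n; last first.
  by rewrite big_geq ?(ltnW nm)// mulr_ge0 ?exprn_ge0.
rewrite -{1}[m]add0n big_addn big_mkord.
under eq_bigr do rewrite exprD.
rewrite -mulr_suml ler_wpM2r ?exprn_ge0//.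
have h : (1 - x) * \sum_(i < n - m) x ^+ i = 1 - x ^+ (n - m).
  by rewrite -[LHS]opprK -mulNr opprB -subrX1 opprB.
have h1 : (1 - x) * \sum_(i < n - m) x ^+ i <= 1 by rewrite h gerBl exprn_ge0.
have s0 : 0 <= \sum_(i < n - m) x ^+ i.
  by rewrite sumr_ge0// => i _; rewrite exprn_ge0.
nra.
Qed.

Lemma expn_1D_inv_le4 K k : (k <= K)%N -> (1 + K%:R^-1) ^+ k <= 4 :> R.
Proof.
move=> kK; have [->|K0] := posnP K.
  move: (kK); rewrite invr0 addr0 expr1n => _; lra.
apply: (@le_trans _ _ (expR 1)); last exact: expR1_le4.
apply: (@le_trans _ _ ((1 + K%:R^-1) ^+ K)).
  by rewrite ler_weXn2l// lerDl invr_ge0.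
apply: (@le_trans _ _ (expR (K%:R^-1) ^+ K)).
  by rewrite lerXn2r ?nnegrE ?expR_ge0 ?addr_ge0 ?invr_ge0// expR_ge1Dx.
by rewrite -expRM_natl mulfV// pnatr_eq0 -lt0n.
Qed.

Lemma seq_max_nc (ys : seq R[i]) y0 : y0 \in ys ->
  exists2 y1, y1 \in ys & forall y, y \in ys -> nc y <= nc y1.
Proof.
elim: ys y0 => // y ys IH y0 _; case: ys IH => [|z ys] IH.
  by exists y => [|u]; rewrite inE// => /eqP ->.
have [y1 y1in y1max] := IH z (mem_head _ _).
have [h|/ltW h] := leP (nc y) (nc y1).
  exists y1; first by rewrite inE y1in orbT.
  by move=> u; rewrite inE => /predU1P[->//|/y1max].
exists y; first exact: mem_head.
by move=> u; rewrite inE => /predU1P[->//|/y1max /le_trans]; apply.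
Qed.

(** [Turan_second] with [eta] the largest power sum in its range of exponents. *)
Lemma Turan_exists (vs : seq R[i]) m : (forall v, v \in vs -> nc v <= 1) ->
  1 \in vs -> exists2 i, (m < i <= m + size vs)%N &
    1 <= 2 * (2 ^+ m * 128 ^+ size vs) * nc (\sum_(v <- vs) v ^+ i).
Proof.
move=> vle1 vs1.
pose s := [seq \sum_(v <- vs) v ^+ i | i <- iota m.+1 (size vs)].
have [|y1 y1s ymax] := @seq_max_nc s (\sum_(v <- vs) v ^+ m.+1).
  apply/mapP; exists m.+1 => //; rewrite mem_iota leqnn addSn ltnS.
  by rewrite -{1}[m]addn0 ltn_add2l; case: (vs) vs1.
have [i + y1E] := elimT mapP y1s; rewrite mem_iota addSn ltnS => im.
rewrite {}y1E in ymax; exists i => //.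
apply: (Turan_second vle1 vs1) => j jm; apply: ymax.
by apply/mapP; exists j => //; rewrite mem_iota addSn ltnS.
Qed.

Variables (C B : nat -> R[i]) (M R1 d : R).
Hypotheses (M0 : 0 <= M) (d0 : 0 < d) (dR1 : 8 * d <= R1).
Hypothesis C0 : C 0 != 0.
Hypothesis CB : forall k, C k.+1 *+ k.+1 = \sum_(i < k.+1) C i * B (k - i)%N.
Hypothesis Cle : forall k, nc (C k) * R1 ^+ k <= M.
Hypothesis Cd : forall e : R, 0 < e -> exists N0, forall N, (N0 <= N)%N ->
  nc (\sum_(k < N) C k * d%:C%C ^+ k) < e.

Let R10 : 0 < R1. Proof. by apply: lt_le_trans dR1; rewrite mulr_gt0. Qed.

(** The full series vanishes at [d], so the partial sum is minus the tail, which is dominated by a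
    geometric series of ratio [d / R1 <= 1/8]. *)
Lemma Taylor_zero_le N :
  nc (\sum_(k < N) C k * d%:C%C ^+ k) <= 2 * M * (d / R1) ^+ N.
Proof.
apply/ler_addgt0Pr => e e0; have [N0 /(_ (maxn N0 N))] := Cd e0.
rewrite leq_maxl => /(_ isT) h.
have NN : (N <= maxn N0 N)%N by rewrite leq_maxr.
have E : \sum_(k < N) C k * d%:C%C ^+ k =
    \sum_(k < maxn N0 N) C k * d%:C%C ^+ k
    - \sum_(N <= k < maxn N0 N) C k * d%:C%C ^+ k.
  rewrite -!(big_mkord xpredT (fun k => C k * d%:C%C ^+ k)).
  by rewrite [in RHS](big_cat_nat _ NN)//= addrK.
rewrite E (le_trans (ncB _ _))// addrC lerD ?(ltW h)//.
rewrite (le_trans (nc_sum _ _ _))//.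
apply: (@le_trans _ _ (\sum_(N <= k < maxn N0 N) M * (d / R1) ^+ k)).
  apply: ler_sum => k _; rewrite ncM ncX ncR gtr0_norm// exprMn exprVn mulrCA.
  rewrite [leLHS]mulrC ler_wpM2l ?exprn_ge0 ?(ltW d0)//.
  by rewrite ler_pdivlMr ?exprn_gt0.
rewrite -mulr_sumr -mulrA mulrCA ler_wpM2l// geo_half_sum//.
rewrite divr_ge0 ?(ltW d0) ?(ltW R10)//= ler_pdivrMr//.
by move: dR1 d0; lra.
Qed.

(** If all zeros have modulus at least [d (1 + 1/K)], a factor is at least [1 / (K + 1)], and even
    [1/2] when [|y| < 1 / (2 d)]. The conflict with [Taylor_zero_le] will yield a zero of modulus
    not much larger than [d]. *)
Lemma prod_1B_ge (ys : seq R[i]) K :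
  (forall y, y \in ys -> nc y * d * (1 + K%:R^-1) <= 1) -> (0 < K)%N ->
  K.+1%:R^-1 ^+ count (fun y => (2 * d)^-1 <= nc y) ys * 2^-1 ^+ size ys <=
  nc (\prod_(y <- ys) (1 - y * d%:C%C)).
Proof.
move=> + K0; have K0R : 0 < K%:R :> R by rewrite ltr0n.
elim: ys => [|y ys IH] h /=; first by rewrite big_nil nc1 !expr0 mulr1.
rewrite big_cons ncM.
have {}IH := IH (fun u us => h u (mem_behead (s := y :: ys) us)).
have hy := h y (mem_head _ _).
have ge : 1 - nc y * d <= nc (1 - y * d%:C%C).
  by rewrite -[X in X - _](@nc1 R) -[d in leLHS]gtr0_norm// -ncR -ncM ncB_ge.
rewrite exprD exprS mulrACA ler_pM//.
apply: le_trans ge; case: (boolP ((2 * d)^-1 <= nc y)) => hh; last first.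
  rewrite -ltNge in hh; rewrite expr0 mul1r lerBrDr -lerBrDl.
  by move: hh; rewrite -div1r ltr_pdivlMr ?mulr_gt0// => hh; lra.
rewrite expr1 lerBrDr -lerBrDl.
have : nc y * d <= K%:R / K.+1%:R.
  move: hy; have -> : 1 + K%:R^-1 = K.+1%:R / K%:R :> R.
    by rewrite -natr1; field; rewrite gt_eqF.
  by rewrite mulrA ler_pdivrMr// mul1r ler_pdivlMr// ltr0n.
move=> /le_trans; apply.
have -> : K%:R / K.+1%:R = 1 - K.+1%:R^-1 :> R.
  by rewrite -[K.+1%:R]natr1; field; rewrite natr1 gt_eqF// ltr0n.
by rewrite lerB// ler_piMr ?invr_ge0//; lra.
Qed.

(* C k and B k are the Taylor coefficients of f and f' / f, and f d = 0. By
   Landau's inequality a Taylor polynomial of f has at most nm zeros of modulus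
   below 2 d, one of them of modulus about d; up to sign and small errors, B k is
   the power sum of exponent k + 1 of their inverses. *)
Theorem power_sum_lower_bound (K N nm : nat) : (0 < K)%N ->
  2 * M < nc (C 0) * (R1 / (4 * d)) ^+ nm.+1 ->
  2 * M * K.+1%:R ^+ nm < nc (C 0) * 4 ^+ N ->
  exists2 n, (0 < n <= nm)%N & forall q m, (0 < q)%N ->
    (q * (m + n) <= K)%N -> (q * (m + n) <= N)%N ->
    exists2 i, (m < i <= m + n)%N &
      1 <= 2 * (2 ^+ m * 128 ^+ n) *
        (4 * (nc (B (q * i).-1) * d ^+ (q * i) + N%:R * 2^-1 ^+ (q * i))).
Proof.
move=> K0 hnm hN.
pose p := \poly_(k < N.+1) C k.
have p0 : p`_0 = C 0 by rewrite coef_poly.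
have [|ys szys pE] := @poly_factor R p; first by rewrite p0.
have {}szys : (size ys <= N)%N by rewrite -ltnS (leq_trans szys)// size_poly.
rewrite p0 in pE.
pose near (y : R[i]) := (2 * d)^-1 <= nc y.
(* Jensen's bound with the radii [2 d] and [R1 / 2]; halving [R1] makes the coefficient sum
   geometric, at most [2 M]. *)
have near_le : (count near ys <= nm)%N.
  have : nc (C 0) * ((R1 / 2) / (2 * d)) ^+ count near ys <= 2 * M.
    apply: (@count_large_roots _ _ _ _ _ _ N.+2).
    - by rewrite mulr_gt0.
    - by move: dR1 d0; lra.
    - by rewrite ltnS.
    rewrite -pE; apply: (@le_trans _ _ (\sum_(0 <= k < N.+2) M * 2^-1 ^+ k)).
      rewrite big_mkord; apply: ler_sum => k _; rewrite coef_poly; case: ifP => _.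
        by rewrite exprMn mulrA ler_wpM2r ?exprn_ge0.
      by rewrite nc0 mul0r mulr_ge0 ?exprn_ge0.
    by rewrite -mulr_sumr mulrC ler_wpM2r// (le_trans (geo_half_sum _ _ _)) ?mulr1//; lra.
  move=> h; rewrite leqNgt; apply/negP => nmc.
  have : nc (C 0) * (R1 / (4 * d)) ^+ nm.+1 <= 2 * M.
    apply: le_trans h; rewrite ler_wpM2l ?nc_ge0//.
    have -> : R1 / 2 / (2 * d) = R1 / (4 * d) by field; rewrite gt_eqF.
    rewrite ler_weXn2l// ler_pdivlMr ?mulr_gt0//; move: dR1 d0; lra.
  by rewrite leNgt hnm.
(* The precision [1/K] in the modulus of the zero costs only a factor 4 in powers up to [K]. Without
   such a zero the polynomial would be at least [|C 0| (K + 1)^-nm 2^-N] at [d], which exceeds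
   [2 M 8^-N] by [hN]. *)
have [ystar ysin yslarge] : exists2 y, y \in ys & 1 < nc y * d * (1 + K%:R^-1).
  apply: contrapT => H.
  have := @prod_1B_ge ys K _ K0; move=> /(_ _)/wrap[y yin|].
    by rewrite leNgt; apply/negP => h; apply: H; exists y.
  move=> h; have := Taylor_zero_le N.+1; apply/negP; rewrite -ltNge.
  have -> : \sum_(k < N.+1) C k * d%:C%C ^+ k = p.[d%:C%C].
    by rewrite horner_poly.
  rewrite pE hornerZ horner_prod ncM.
  under eq_bigr do rewrite !hornerE.
  have cs : K.+1%:R^-1 ^+ nm * 2^-1 ^+ N <=
      K.+1%:R^-1 ^+ count near ys * 2^-1 ^+ size ys :> R.
    rewrite ler_pM ?exprn_ge0 ?invr_ge0//.
      by rewrite ler_wiXn2l ?invr_ge0// invf_le1 ?ltr0n// ler1n.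
    by rewrite ler_wiXn2l ?invr_ge0//; lra.
  apply: (@lt_le_trans _ _ (nc (C 0) * (K.+1%:R^-1 ^+ nm * 2^-1 ^+ N))); last first.
    by rewrite ler_wpM2l ?nc_ge0// (le_trans cs).
  apply: (@le_lt_trans _ _ (2 * M * 8^-1 ^+ N)).
    rewrite ler_wpM2l ?mulr_ge0//.
    have dR : 0 <= d / R1 <= 8^-1.
      by rewrite divr_ge0 ?(ltW d0) ?(ltW R10)//= ler_pdivrMr//; move: dR1; lra.
    rewrite exprS -[leRHS]mul1r; case/andP: dR => dR0 dR2.
    rewrite ler_pM ?exprn_ge0//; first by lra.
    by rewrite lerXn2r ?nnegrE.
  rewrite exprVn [K.+1%:R^-1 ^+ _]exprVn mulrA ltr_pdivrMr ?exprn_gt0//.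
  rewrite (_ : 8 = 4 * 2 :> R); last by lra.
  rewrite [in ltRHS]exprVn mulrAC ltr_pdivlMr ?exprn_gt0 ?ltr0n//.
  rewrite [in ltRHS]exprMn mulrA ltr_pM2r ?exprn_gt0// mulrAC.
  by rewrite ltr_pdivlMr ?exprn_gt0 ?ltr0n.
have [y1 y1in y1max] := seq_max_nc ysin.
have y1large : 1 < nc y1 * d * (1 + K%:R^-1).
  apply: lt_le_trans yslarge _; rewrite ler_wpM2r ?addr_ge0 ?invr_ge0//.
  by rewrite ler_wpM2r ?(ltW d0)// y1max.
have K1 : K%:R^-1 <= 1 :> R by rewrite invf_le1 ?ltr0n// ler1n.
have y1near : near y1.
  rewrite /near -div1r ler_pdivrMr ?mulr_gt0//.
  apply: le_trans (ltW y1large) _; rewrite -mulrA ler_wpM2l ?nc_ge0//.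
  by move: d0 K1; nra.
have y1pos : 0 < nc y1.
  by apply: lt_le_trans y1near; rewrite invr_gt0 mulr_gt0.
have y1n0 : y1 != 0 by rewrite -nc_gt0.
exists (count near ys).
  by rewrite near_le andbT -has_count; apply/hasP; exists y1.
move=> q m q0 qK qN; set n := count near ys in qK qN *.
(* Division by the largest inverse zero gives the normalisation of Turan's theorem, and the [q]-th
   powers turn its exponents [m < i <= m + n] into the multiples [q i]. *)
pose vs := [seq (y / y1) ^+ q | y <- ys & near y].
have szvs : size vs = n by rewrite size_map size_filter.
have [||i] := @Turan_exists vs m.
- move=> v /mapP[y]; rewrite mem_filter => /andP[_ yin] ->.
  rewrite ncX ncM ncV exprn_ile1 ?mulr_ge0 ?invr_ge0 ?nc_ge0//.
  by rewrite ler_pdivrMr// mul1r y1max.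
- apply/mapP; exists y1; first by rewrite mem_filter y1near.
  by rewrite divff// expr1n.
rewrite szvs => /andP[mi imn] h; exists i; first by rewrite mi.
apply: le_trans h _; rewrite ler_wpM2l ?mulr_ge0 ?exprn_ge0//.
have qi0 : (0 < q * i)%N by rewrite muln_gt0 q0 (leq_trans _ mi).
have qin : (q * i <= q * (m + n))%N by rewrite leq_mul2l imn orbT.
have -> : \sum_(v <- vs) v ^+ i =
    (\sum_(y <- ys | near y) y ^+ (q * i)) / y1 ^+ (q * i).
  rewrite /vs big_map big_filter mulr_suml; apply: eq_bigr => y _.
  by rewrite -exprM expr_div_n.
have BE : \sum_(y <- ys | near y) y ^+ (q * i) =
    - B (q * i).-1 - \sum_(y <- ys | ~~ near y) y ^+ (q * i).
  have -> : B (q * i).-1 = - \sum_(y <- ys) y ^+ (q * i).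
    have [k kE] : exists k, (q * i = k.+1)%N by exists (q * i).-1; rewrite prednK.
    rewrite kE/=.
    apply: (@Newton_unique _ C B (fun k => - \sum_(y <- ys) y ^+ k.+1) N) => //.
      move=> j jN; have := Newton_coef ys j => /=.
      have pc l : (l <= N)%N -> C l = C 0 * (\prod_(y <- ys) (1 - y *: 'X))`_l.
        by move=> lN; rewrite -coefZ -pE coef_poly ltnS lN.
      move=> E; rewrite pc// -mulrnAr E mulr_sumr; apply: eq_bigr => l _.
      by rewrite mulrA -pc// -ltnS (leq_trans (ltn_ord l))// ltnW.
    by rewrite -kE (leq_trans qin).
  by rewrite opprK [in RHS](bigID near)/= addrK.
rewrite BE ncM ncV ncX.
have yd : (nc y1 ^+ (q * i))^-1 <= 4 * d ^+ (q * i).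
  rewrite -exprVn.
  apply: (@le_trans _ _ ((d * (1 + K%:R^-1)) ^+ (q * i))).
    rewrite lerXn2r ?nnegrE ?invr_ge0 ?nc_ge0 ?mulr_ge0 ?addr_ge0 ?invr_ge0 ?(ltW d0)//.
    by rewrite -div1r ler_pdivrMr// mulrC mulrA ltW.
  rewrite exprMn mulrC ler_wpM2r ?exprn_ge0 ?(ltW d0)//.
  by rewrite expn_1D_inv_le4// (leq_trans qin).
apply: (le_trans (ler_wpM2l (nc_ge0 _) yd)).
rewrite mulrCA ler_wpM2l// mulrC.
apply: (@le_trans _ _ (d ^+ (q * i) * (nc (B (q * i).-1) +
    N%:R * ((2 * d) ^- (q * i))))).
  rewrite ler_wpM2l ?exprn_ge0 ?(ltW d0)//.
  rewrite (le_trans (ncB _ _))// ncN lerD2l (le_trans (nc_sum _ _ _))//.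
  apply: (@le_trans _ _ (\sum_(y <- ys | ~~ near y) (2 * d) ^- (q * i))).
    apply: ler_sum => y; rewrite /near -ltNge => hy.
    rewrite ncX -exprVn lerXn2r ?nnegrE ?nc_ge0 ?invr_ge0 ?mulr_ge0 ?(ltW d0)//.
    exact: ltW.
  rewrite -big_filter sumr_const_seq -[leLHS]mulr_natl.
  rewrite ler_wpM2r ?invr_ge0 ?exprn_ge0 ?mulr_ge0 ?(ltW d0)// ler_nat.
  by rewrite (leq_trans _ szys)// size_filter count_size.
rewrite mulrDr [_ * nc _]mulrC lerD2l mulrCA ler_wpM2l//.
rewrite -exprVn -exprMn [d * _](_ : _ = 2^-1)//.
by field; rewrite gt_eqF.
Qed.

End PowerSums.

(** * Cauchy's theorem and uniqueness from an edge *)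

Section RealCalculus.
Variable R : realType.

Lemma MVT_le (f df : R -> R) (a b : R) : a <= b ->
  (forall x, a <= x <= b -> is_derive x (1 : R) f (df x)) ->
  exists2 c, a <= c <= b & f b - f a = df c * (b - a).
Proof.
move=> ab fd; have fc : {within `[a, b], continuous f}.
  apply: derivable_within_continuous => x; rewrite in_itv/= => xab.
  by have [] := fd x xab.
have [x|c cab h] := @MVT_segment R f df a b ab _ fc.
  by rewrite in_itv/= => /andP[ax xb]; apply: fd; rewrite !ltW.
by exists c => //; rewrite in_itv/= in cab.
Qed.

Lemma MVT_norm_le (f df : R -> R) (a b M : R) : a <= b ->
  (forall x, a <= x <= b -> is_derive x (1 : R) f (df x)) ->
  (forall x, a <= x <= b -> `|df x| <= M) -> `|f b - f a| <= M * (b - a).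
Proof.
move=> ab fd dfM; have [c cab ->] := MVT_le ab fd.
by rewrite normrM (ger0_norm (_ : 0 <= b - a)) ?subr_ge0// ler_wpM2r ?subr_ge0// dfM.
Qed.

Lemma MVT_ge (f df : R -> R) (a b M : R) : a <= b ->
  (forall x, a <= x <= b -> is_derive x (1 : R) f (df x)) ->
  (forall x, a <= x <= b -> M <= df x) -> M * (b - a) <= f b - f a.
Proof.
move=> ab fd dfM; have [c cab ->] := MVT_le ab fd.
by rewrite ler_wpM2r ?subr_ge0// dfM.
Qed.

(** Composition with this 1-Lipschitz retraction extends a continuous function on [[a, b]]
    continuously to the whole line, so that the end points become ordinary points. *)
Definition clamp (a b x : R) := Num.max a (Num.min x b).

Lemma clamp_itv (a b x : R) : a <= b -> a <= clamp a b x <= b.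
Proof. by move=> ab; rewrite /clamp le_max lexx/= ge_max ab/= ge_min lexx orbT. Qed.

Lemma clamp_id (a b x : R) : a <= x <= b -> clamp a b x = x.
Proof. by move=> /andP[ax xb]; rewrite /clamp min_l// max_r. Qed.

Lemma clamp_lip (a b x y : R) : a <= b -> `|clamp a b x - clamp a b y| <= `|x - y|.
Proof.
move=> ab; rewrite /clamp /Num.max /Num.min.
have := ler_norm (x - y); have := ler_norm (y - x); rewrite (distrC y x).
case: (ltP x b) => xb; case: (ltP y b) => yb; case: ltP => h1; case: ltP => h2;
  by rewrite ler_norml; lra.
Qed.

Definition cont_on (a b : R) (f : R -> R) := forall x, a <= x <= b ->
  forall e, 0 < e -> exists2 r, 0 < r & forall y, a <= y <= b ->
    `|y - x| < r -> `|f y - f x| <= e.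

Lemma clamp_continuous (a b : R) f : a <= b -> cont_on a b f ->
  continuous (f \o clamp a b).
Proof.
move=> ab fc x; apply/cvgrPdist_le => e e0.
have [r r0 hr] := fc _ (clamp_itv x ab) e e0.
near=> y; rewrite distrC; apply: hr; first exact: clamp_itv.
by rewrite (le_lt_trans (clamp_lip _ _ ab))// distrC; near: y; apply: cvgr_dist_lt.
Unshelve. all: by end_near. Qed.

Lemma primitive_exists (a b : R) f : a <= b -> cont_on a b f ->
  exists F : R -> R, forall x, a <= x <= b -> is_derive x (1 : R) F (f x).
Proof.
move=> ab fc; have gc := clamp_continuous ab fc; set g := f \o clamp a b in gc.
(* The extended function is integrated from [a - 1], which makes [a] an interior point. *)
exists (fun x => (\int[lebesgue_measure]_(t in `[a - 1, x]) g t)%R) => x.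
move=> /andP[ax xb].
have [||//|//|dF F'] := @continuous_FTC1_closed R g (a - 1) x (b + 1).
- by lra.
- apply: continuous_compact_integrable; first exact: segment_compact.
  exact: continuous_subspaceT.
- by lra.
- exact: gc.
apply: DeriveDef => //.
by rewrite -derive1E F' /g/= clamp_id// ax.
Qed.

Lemma cont_on_bounded (a b : R) f : a <= b -> cont_on a b f ->
  exists M, forall x, a <= x <= b -> `|f x| <= M.
Proof.
move=> ab fc; have gc := clamp_continuous ab fc.
have gc' : continuous (Num.norm \o (f \o clamp a b)).
  by move=> x; apply: continuous_comp; [exact: gc|exact: norm_continuous].
have [c _ hc] := EVT_max ab (continuous_subspaceT gc').
exists (`|f (clamp a b c)|) => x xab.
by have := hc x; rewrite in_itv/= xab => /(_ isT); rewrite clamp_id.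
Qed.

Lemma nested_dyadic (a : nat -> R) (w : R) : 0 <= w ->
  (forall n, a n.+1 = a n \/ a n.+1 = a n + w / 2 ^+ n.+1) ->
  exists x, forall n, a n <= x <= a n + w / 2 ^+ n.
Proof.
move=> w0 h.
have w2 n : 0 <= w / 2 ^+ n by rewrite divr_ge0 ?exprn_ge0.
have up n m : a n <= a (n + m)%N.
  elim: m => [|m IH]; rewrite ?addn0// addnS (le_trans IH)//.
  by case: (h (n + m)%N) => ->; rewrite ?lerDl.
have half n : w / 2 ^+ n = w / 2 ^+ n.+1 + w / 2 ^+ n.+1.
  by rewrite exprS; field; rewrite expf_neq0.
have dn n m : a (n + m)%N + w / 2 ^+ (n + m) <= a n + w / 2 ^+ n.
  elim: m => [|m IH]; rewrite ?addn0// addnS (le_trans _ IH)//.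
  rewrite (half (n + m)%N); have := w2 (n + m).+1.
  by case: (h (n + m)%N) => ->; lra.
have bd n m : a m <= a n + w / 2 ^+ n.
  have [nm|mn] := leqP n m.
    by rewrite -(subnKC nm) (le_trans _ (dn n (m - n)%N))// lerDl.
  by have := up m (n - m)%N; rewrite subnKC ?(ltnW mn)//; have := w2 n; lra.
exists (sup (range a)) => n.
have supA : has_sup (range a).
  split; first by exists (a 0); exists 0%N.
  by exists (a 0 + w / 2 ^+ 0) => _ [m _ <-].
apply/andP; split; first by apply: ub_le_sup; [case: supA|exists n].
by apply: ge_sup; [exists (a 0); exists 0%N|move=> _ [m _ <-]].
Qed.

End RealCalculus.

Section Goursat.
Variable R : realType.
Implicit Types (f g : R[i] -> R[i]) (z D : R[i]).

Definition cdiff f z := exists D, forall e : R, 0 < e -> exists2 r : R, 0 < r &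
  forall h, nc h < r -> nc (f (z + h) - f z - D * h) <= e * nc h.

Definition in_rect (a b c d : R) z :=
  a <= complex.Re z <= b /\ c <= complex.Im z <= d.

Lemma cdiff_cst c z : cdiff (fun=> c) z.
Proof.
exists 0 => e e0; exists 1 => // h _; rewrite subrr mul0r subr0 nc0.
by rewrite mulr_ge0 ?nc_ge0 ?ltW.
Qed.

Lemma cdiff_id z : cdiff id z.
Proof.
exists 1 => e e0; exists 1 => // h _; have -> : z + h - z - 1 * h = 0 by ring.
rewrite nc0.
by rewrite mulr_ge0 ?nc_ge0 ?ltW.
Qed.

Lemma cdiff_lipschitz f z : cdiff f z -> exists L : R, exists2 r : R, 0 < r &
  0 <= L /\ forall h, nc h < r -> nc (f (z + h) - f z) <= L * nc h.
Proof.
move=> [D hD]; have [r r0 hr] := hD 1 ltr01; exists (1 + nc D); exists r => //.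
split=> [|h /hr h1]; first by rewrite addr_ge0 ?nc_ge0.
rewrite -(subrK (D * h) (f (z + h) - f z)) (le_trans (ncD _ _))//.
by rewrite mulrDl lerD// ncM.
Qed.

Lemma cdiffD f g z : cdiff f z -> cdiff g z -> cdiff (fun w => f w + g w) z.
Proof.
move=> [D1 h1] [D2 h2]; exists (D1 + D2) => e e0.
have e2 : 0 < e / 2 by rewrite divr_gt0.
have [r1 r10 k1] := h1 _ e2; have [r2 r20 k2] := h2 _ e2.
exists (Num.min r1 r2); first by rewrite lt_min r10.
move=> h; rewrite lt_min => /andP[hr1 hr2].
have -> : f (z + h) + g (z + h) - (f z + g z) - (D1 + D2) * h =
  (f (z + h) - f z - D1 * h) + (g (z + h) - g z - D2 * h) by ring.
rewrite (le_trans (ncD _ _))//.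
by have := k1 h hr1; have := k2 h hr2; lra.
Qed.

Lemma cdiffM f g z : cdiff f z -> cdiff g z -> cdiff (fun w => f w * g w) z.
Proof.
move=> cf cg; have [L1 [r1 r10 [L10 k1]]] := cdiff_lipschitz cf.
have [L2 [r2 r20 [L20 k2]]] := cdiff_lipschitz cg.
move: cf cg => [D1 h1] [D2 h2]; exists (D1 * g z + f z * D2) => e e0.
pose K := nc (g z) + nc (f z) + 1.
have K0 : 0 < K by rewrite /K ltr_wpDl ?addr_ge0 ?nc_ge0.
have e3 : 0 < e / (3 * K) by rewrite divr_gt0 ?mulr_gt0.
have [r3 r30 k3] := h1 _ e3; have [r4 r40 k4] := h2 _ e3.
have LL : 0 < L1 * L2 + 1 by rewrite ltr_wpDl ?mulr_ge0.
pose r5 := e / (3 * (L1 * L2 + 1)).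
have r50 : 0 < r5 by rewrite divr_gt0 ?mulr_gt0.
exists (Num.min (Num.min r1 r2) (Num.min (Num.min r3 r4) r5)).
  by rewrite !lt_min r10 r20 r30 r40 r50.
move=> h; rewrite !lt_min => /andP[/andP[hr1 hr2] /andP[/andP[hr3 hr4] hr5]].
have -> : f (z + h) * g (z + h) - f z * g z - (D1 * g z + f z * D2) * h =
  (f (z + h) - f z - D1 * h) * g z + f z * (g (z + h) - g z - D2 * h)
  + (f (z + h) - f z) * (g (z + h) - g z) by ring.
have nh := nc_ge0 h; have ng := nc_ge0 (g z); have nf := nc_ge0 (f z).
have E1 : nc ((f (z + h) - f z - D1 * h) * g z) <= e / 3 * nc h.
  rewrite ncM; apply: (le_trans (ler_wpM2r ng (k3 h hr3))).
  have -> : e / (3 * K) * nc h * nc (g z) = e / 3 * nc h * (nc (g z) / K).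
    by field; rewrite gt_eqF.
  rewrite ler_piMr ?mulr_ge0 ?divr_ge0 ?(ltW e0)// ler_pdivrMr// mul1r /K; lra.
have E2 : nc (f z * (g (z + h) - g z - D2 * h)) <= e / 3 * nc h.
  rewrite ncM; apply: (le_trans (ler_wpM2l nf (k4 h hr4))).
  have -> : nc (f z) * (e / (3 * K) * nc h) = e / 3 * nc h * (nc (f z) / K).
    by field; rewrite gt_eqF.
  rewrite ler_piMr ?mulr_ge0 ?divr_ge0 ?(ltW e0)// ler_pdivrMr// mul1r /K; lra.
have E3 : nc ((f (z + h) - f z) * (g (z + h) - g z)) <= e / 3 * nc h.
  rewrite ncM; apply: (@le_trans _ _ ((L1 * nc h) * (L2 * nc h))).
    by rewrite ler_pM ?nc_ge0// ?k1 ?k2.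
  rewrite mulrACA mulrA ler_wpM2r//.
  apply: (@le_trans _ _ ((L1 * L2 + 1) * r5)).
    by rewrite ler_pM ?mulr_ge0// ?(ltW hr5)// lerDl.
  by rewrite /r5 le_eqVlt; apply/orP; left; apply/eqP; field; rewrite gt_eqF.
rewrite (le_trans (ncD _ _))// (le_trans (lerD (ncD _ _) (lexx _)))//; lra.
Qed.

Lemma cdiffX f z n : cdiff f z -> cdiff (fun w => f w ^+ n) z.
Proof.
move=> cf; elim: n => [|n IH]; first exact: cdiff_cst.
rewrite (_ : (fun w => _) = (fun w => f w * f w ^+ n)); first exact: cdiffM.
by apply/funext => w; rewrite exprS.
Qed.

Lemma cdiff_sum n (F : nat -> R[i] -> R[i]) z : (forall k, cdiff (F k) z) ->
  cdiff (fun w => \sum_(k < n) F k w) z.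
Proof.
move=> h; elim: n => [|n IH].
  rewrite (_ : (fun w => _) = (fun=> 0)); first exact: cdiff_cst.
  by apply/funext => w; rewrite big_ord0.
rewrite (_ : (fun w => _) = (fun w => \sum_(k < n) F k w + F n w)).
  exact: cdiffD.
by apply/funext => w; rewrite big_ord_recr.
Qed.

(* Re of the integral over the boundary of [a, b] x [c, d], in terms of
   primitives X of Re f along horizontal and Y of Im f along vertical lines *)
Definition bdry (X Y : R -> R -> R) (a b c d : R) : R :=
  (X b c - X a c) - (X b d - X a d)
  - ((Y b d - Y b c) - (Y a d - Y a c)).

Definition prims f (a b c d : R) (X Y : R -> R -> R) :=
  (forall x y, a <= x <= b -> c <= y <= d ->
    is_derive x (1 : R) (X^~ y) (complex.Re (f (Complex x y)))) /\
  (forall x y, a <= x <= b -> c <= y <= d ->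
    is_derive y (1 : R) (Y x) (complex.Im (f (Complex x y)))).

Definition rcont f (a b c d : R) := forall z, in_rect a b c d z ->
  forall e : R, 0 < e -> exists2 r : R, 0 < r &
  forall w, in_rect a b c d w -> nc (w - z) < r -> nc (f w - f z) <= e.

Lemma cdiff_rcont f a b c d : (forall z, in_rect a b c d z -> cdiff f z) ->
  rcont f a b c d.
Proof.
move=> cf z zr e e0; have [L [r r0 [L0 hL]]] := cdiff_lipschitz (cf z zr).
have L1 : 0 < L + 1 by rewrite ltr_wpDl.
exists (Num.min r (e / (L + 1))); first by rewrite lt_min r0 divr_gt0.
move=> w _; rewrite lt_min => /andP[hr he].
have := hL (w - z) hr; rewrite [z + _]addrC subrK => /le_trans; apply.
move: he; rewrite ltr_pdivlMr// mulrDr mulr1 => he.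
by have := nc_ge0 (w - z); lra.
Qed.

Lemma prims_exist f a b c d : a <= b -> c <= d -> rcont f a b c d ->
  exists X Y, prims f a b c d X Y.
Proof.
move=> ab cd cf.
have nre (u v : R[i]) : `|complex.Re u - complex.Re v| <= nc (u - v).
  by rewrite -cReN -cReD nc_Re.
have nim (u v : R[i]) : `|complex.Im u - complex.Im v| <= nc (u - v).
  by rewrite -cImN -cImD nc_Im.
have ncx (x x' y : R) : nc (Complex x' y - Complex x y) = `|x' - x|.
  by rewrite -ncR; congr nc; apply/eqP; rewrite eq_complex/= subrr !eqxx.
have ncy (x y y' : R) : nc (Complex x y' - Complex x y) = `|y' - y|.
  have -> : Complex x y' - Complex x y = Complex 0 (y' - y).
    by apply/eqP; rewrite eq_complex/= subrr !eqxx.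
  by rewrite /= expr0n/= add0r sqrtr_sqr.
have hX y : exists F : R -> R, c <= y <= d -> forall x, a <= x <= b ->
    is_derive x (1 : R) F (complex.Re (f (Complex x y))).
  have [ycd|ncd] := boolP (c <= y <= d); last by exists id.
  have [|F hF] := @primitive_exists R a b (fun x => complex.Re (f (Complex x y))) ab.
    move=> x xab e e0; have [|r r0 hr] := cf (Complex x y) _ e e0; first by split.
    exists r => // x' x'ab h; apply: le_trans (nre _ _) _; apply: hr.
      by split.
    by rewrite ncx.
  by exists F.
have hY x : exists F : R -> R, a <= x <= b -> forall y, c <= y <= d ->
    is_derive y (1 : R) F (complex.Im (f (Complex x y))).
  have [xab|nab] := boolP (a <= x <= b); last by exists id.
  have [|F hF] := @primitive_exists R c d (fun y => complex.Im (f (Complex x y))) cd.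
    move=> y ycd e e0; have [|r r0 hr] := cf (Complex x y) _ e e0; first by split.
    exists r => // y' y'cd h; apply: le_trans (nim _ _) _; apply: hr.
      by split.
    by rewrite ncy.
  by exists F.
have [X hX'] := choice hX; have [Y hY'] := choice hY.
exists (fun x y => X y x), Y; split=> x y xab ycd; [exact: hX'|exact: hY'].
Qed.

End Goursat.

Section GoursatTheorem.
Variable R : realType.
Implicit Types (f g : R[i] -> R[i]) (z D : R[i]).

Lemma bdry_MVT f a b c d X Y : a <= b -> c <= d -> prims f a b c d X Y ->
  exists x y : R, [/\ a <= x <= b, c <= y <= d &
  bdry X Y a b c d =
    (complex.Re (f (Complex x c) - f (Complex x d))) * (b - a)
    - (complex.Im (f (Complex b y) - f (Complex a y))) * (d - c)].
Proof.
move=> ab cd [hX hY].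
have aab : a <= a <= b by rewrite lexx.
have bab : a <= b <= b by rewrite lexx ab.
have ccd : c <= c <= d by rewrite lexx.
have dcd : c <= d <= d by rewrite lexx cd.
have [|x xab hx] := @MVT_le R (fun t => X t c - X t d)
  (fun t => complex.Re (f (Complex t c)) - complex.Re (f (Complex t d))) a b ab.
  by move=> t tab; apply: is_deriveB; exact: hX.
have [|y ycd hy] := @MVT_le R (fun t => Y b t - Y a t)
  (fun t => complex.Im (f (Complex b t)) - complex.Im (f (Complex a t))) c d cd.
  by move=> t tab; apply: is_deriveB; exact: hY.
exists x, y; split=> //; rewrite !(cReD, cImD, cReN, cImN) -hx -hy /bdry.
by ring.
Qed.

Lemma nc_Complex_le (x y l : R) : `|x| <= l -> `|y| <= l ->
  nc (Complex x y) <= 2 * l.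
Proof.
move=> xl yl; apply: le_trans (nc_ReIm _) _ => /=.
by rewrite mulr_natl mulr2n lerD.
Qed.

(** By [bdry_MVT] only differences of [f] between opposite edges occur. The affine part of [f] at
    [z] cancels between the two pairs of edges, and the remainder is at most [e] times the distance
    to [z]. *)
Lemma bdry_local f a b c d X Y z D (e r l : R) : a <= b -> c <= d ->
  prims f a b c d X Y -> in_rect a b c d z -> 0 < e ->
  (forall h, nc h < r -> nc (f (z + h) - f z - D * h) <= e * nc h) ->
  b - a <= l -> d - c <= l -> 2 * l < r ->
  `|bdry X Y a b c d| <= 8 * e * l ^+ 2.
Proof.
move=> ab cd hXY [zx zy] e0 hD bal dcl lr.
have l0 : 0 <= l by apply: le_trans bal; rewrite subr_ge0.
have [x [y [xab ycd ->]]] := bdry_MVT ab cd hXY.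
have est x' y' : a <= x' <= b -> c <= y' <= d ->
    nc (f (Complex x' y') - f z - D * (Complex x' y' - z)) <= 2 * e * l.
  move=> /andP[ax xb] /andP[cy yd].
  have [/andP[zx1 zx2] /andP[zy1 zy2]] := (zx, zy).
  have nl : nc (Complex x' y' - z) <= 2 * l.
    case: (z) zx1 zx2 zy1 zy2 => zr zi /= *; apply: nc_Complex_le;
      by rewrite ler_norml; lra.
  have := hD (Complex x' y' - z); rewrite [z + _]addrC subrK => /(_ _)/wrap[].
    exact: le_lt_trans lr.
  by move=> /le_trans; apply; rewrite -mulrA mulrCA ler_wpM2l// ltW.
have cm x1 y1 x2 y2 : a <= x1 <= b -> c <= y1 <= d -> a <= x2 <= b ->
  c <= y2 <= d -> nc (f (Complex x1 y1) - f (Complex x2 y2)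
    - D * (Complex (x1 - x2) (y1 - y2))) <= 4 * e * l.
  move=> h1 h2 h3 h4.
  have -> : Complex (x1 - x2) (y1 - y2) = Complex x1 y1 - Complex x2 y2 by [].
  have := ncB (f (Complex x1 y1) - f z - D * (Complex x1 y1 - z))
    (f (Complex x2 y2) - f z - D * (Complex x2 y2 - z)).
  have := est _ _ h1 h2; have := est _ _ h3 h4.
  set u := nc _; set v := nc _; set t := nc _; set s := nc _ => *.
  have -> : s = t by congr nc; ring.
  lra.
have aab : a <= a <= b by rewrite lexx.
have bab : a <= b <= b by rewrite lexx ab.
have ccd : c <= c <= d by rewrite lexx.
have dcd : c <= d <= d by rewrite lexx cd.
have E1 := le_trans (nc_Re _) (cm _ _ _ _ xab ccd xab dcd).
have E2 := le_trans (nc_Im _) (cm _ _ _ _ bab ycd aab ycd).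
move: E1 E2; rewrite !(cReD _ (- _)) !(cImD _ (- _)) (cReN (D * _)) (cImN (D * _)).
rewrite !cReM !cImM /= !subrr !mulr0 sub0r add0r.
set A := complex.Re _ + complex.Re _; set B := complex.Im _ + complex.Im _.
set Di := complex.Im D; rewrite opprK => E1 E2.
have -> : A * (b - a) - B * (d - c) =
    (A + Di * (c - d)) * (b - a) - (B - Di * (b - a)) * (d - c) by ring.
rewrite (le_trans (ler_normB _ _))// !normrM.
rewrite (ger0_norm (_ : 0 <= b - a)) ?subr_ge0// (ger0_norm (_ : 0 <= d - c)) ?subr_ge0//.
have q1 : `|A + Di * (c - d)| * (b - a) <= 4 * e * l * l.
  by rewrite ler_pM// subr_ge0.
have q2 : `|B - Di * (b - a)| * (d - c) <= 4 * e * l * l.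
  by rewrite ler_pM// subr_ge0.
by rewrite expr2; lra.
Qed.

Lemma prims_sub f a b c d X Y a' b' c' d' : a <= a' -> b' <= b -> c <= c' ->
  d' <= d -> prims f a b c d X Y -> prims f a' b' c' d' X Y.
Proof.
move=> aa bb cc dd [hX hY]; split=> x y /andP[x1 x2] /andP[y1 y2];
  [apply: hX|apply: hY]; apply/andP; split;
  by [apply: le_trans x1|apply: le_trans bb|apply: le_trans y1|apply: le_trans dd].
Qed.

(** Bisection: some quarter always carries at least a fourth of the boundary value, while around the
    limit point this value is [o(l^2)] by [bdry_local], which beats the factor [4^n]. *)
Theorem Goursat f a b c d X Y : a <= b -> c <= d -> prims f a b c d X Y ->
  (forall z, in_rect a b c d z -> cdiff f z) -> bdry X Y a b c d = 0.
Proof.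
move=> ab cd hXY cf.
pose w := b - a; pose h := d - c.
have w0 : 0 <= w by rewrite subr_ge0.
have h0 : 0 <= h by rewrite subr_ge0.
pose Bn n (p : R * R) := bdry X Y p.1 (p.1 + w / 2 ^+ n) p.2 (p.2 + h / 2 ^+ n).
pose nxt n (p q : R * R) := [/\ q.1 = p.1 \/ q.1 = p.1 + w / 2 ^+ n.+1,
  q.2 = p.2 \/ q.2 = p.2 + h / 2 ^+ n.+1 & `|Bn n p| <= 4 * `|Bn n.+1 q|].
have nxtP n p : exists q, nxt n p q.
  apply: contrapT => H.
  have big q : q.1 = p.1 \/ q.1 = p.1 + w / 2 ^+ n.+1 ->
     q.2 = p.2 \/ q.2 = p.2 + h / 2 ^+ n.+1 -> 4 * `|Bn n.+1 q| < `|Bn n p|.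
    by move=> q1 q2; rewrite ltNge; apply/negP => q3; apply: H; exists q.
  pose p1 := p.1 + w / 2 ^+ n.+1; pose p2 := p.2 + h / 2 ^+ n.+1.
  have := big (p.1, p.2); have := big (p1, p.2); have := big (p.1, p2).
  have := big (p1, p2) => /=.
  move=> /(_ (or_intror erefl) (or_intror erefl)) k1.
  move=> /(_ (or_introl erefl) (or_intror erefl)) k2.
  move=> /(_ (or_intror erefl) (or_introl erefl)) k3.
  move=> /(_ (or_introl erefl) (or_introl erefl)) k4.
  have half (v : R) : v / 2 ^+ n = v / 2 ^+ n.+1 + v / 2 ^+ n.+1.
    by rewrite exprS; field; rewrite expf_neq0.
  have E : Bn n p = Bn n.+1 (p.1, p.2) + Bn n.+1 (p1, p.2) +
      Bn n.+1 (p.1, p2) + Bn n.+1 (p1, p2).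
    by rewrite /Bn /= !half /p1 /p2 !addrA /bdry; ring.
  have := ler_normD (Bn n.+1 (p.1, p.2) + Bn n.+1 (p1, p.2) + Bn n.+1 (p.1, p2)) (Bn n.+1 (p1, p2)).
  have := ler_normD (Bn n.+1 (p.1, p.2) + Bn n.+1 (p1, p.2)) (Bn n.+1 (p.1, p2)).
  have := ler_normD (Bn n.+1 (p.1, p.2)) (Bn n.+1 (p1, p.2)).
  by rewrite -E; lra.
have [N hN] := choice (fun np : nat * (R * R) => nxtP np.1 np.2).
pose s := fix s n := if n is m.+1 then N (m, s m) else (a, c).
have sN n : nxt n (s n) (s n.+1) by exact: (hN (n, s n)).
have [x hx] := @nested_dyadic R (fun n => (s n).1) w w0
  (fun n => let: And3 u _ _ := sN n in u).
have [y hy] := @nested_dyadic R (fun n => (s n).2) h h0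
  (fun n => let: And3 _ u _ := sN n in u).
have growth n : `|Bn 0 (a, c)| <= 4 ^+ n * `|Bn n (s n)|.
  elim: n => [|n IH]; first by rewrite expr0 mul1r.
  apply: (le_trans IH); rewrite exprSr -mulrA ler_wpM2l ?exprn_ge0//.
  by have [] := sN n.
have B0E : Bn 0 (a, c) = bdry X Y a b c d.
  by rewrite /Bn/= expr0 !divr1 /w /h ![_ + (_ - _)]addrC !subrK.
have inr (v : R) (u : nat -> R) (t u0 : R) : u 0%N = u0 -> 0 <= v ->
    (forall n, u n.+1 = u n \/ u n.+1 = u n + v / 2 ^+ n.+1) ->
    forall n, u0 <= u n /\ u n + v / 2 ^+ n <= u0 + v.
  move=> uu0 v0 hu; elim=> [|n [IH1 IH2]].
    by rewrite uu0 expr0 divr1 !lexx.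
  have half : v / 2 ^+ n = v / 2 ^+ n.+1 + v / 2 ^+ n.+1.
    by rewrite exprS; field; rewrite expf_neq0.
  have : 0 <= v / 2 ^+ n.+1 by rewrite divr_ge0 ?exprn_ge0.
  by move: IH1 IH2; rewrite half; case: (hu n) => ->; split; lra.
have inx := inr w (fun n => (s n).1) x a erefl w0
  (fun n => let: And3 u _ _ := sN n in u).
have iny := inr h (fun n => (s n).2) y c erefl h0
  (fun n => let: And3 _ u _ := sN n in u).
rewrite (_ : a + w = b) in inx; last by rewrite /w addrC subrK.
rewrite (_ : c + h = d) in iny; last by rewrite /h addrC subrK.
have zr : in_rect a b c d (Complex x y).
  have := hx 0%N; have := hy 0%N; rewrite /= expr0 !divr1 /w /h.
  by rewrite ![_ + (_ - _)]addrC !subrK.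
have [D hD] := cf _ zr.
apply/eqP; rewrite -B0E -normr_eq0 eq_le normr_ge0 andbT.
apply/ler_addgt0Pr => e e0; rewrite add0r.
pose l := w + h.
have l0 : 0 <= l by rewrite addr_ge0.
pose e' := e / (8 * (l ^+ 2 + 1)).
have e'0 : 0 < e' by rewrite divr_gt0// mulr_gt0// ltr_wpDl ?sqr_ge0.
have [r r0 hr] := hD _ e'0.
have [n hn] : exists n, 2 * (l / 2 ^+ n) < r.
  have [n _ /(_ n (leqnn _))] :
      \forall n \near \oo, 2 * (l * 2^-1 ^+ n) < r.
    have : 2 * (l * 2^-1 ^+ n) @[n --> \oo] --> 2 * (l * 0).
      apply: cvgMr; apply: cvgMr; apply: cvg_expr.
      by rewrite ger0_norm; lra.
    by rewrite !mulr0 => /cvgr_lt; exact.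
  by move=> h1; exists n; rewrite -exprVn.
apply: (le_trans (growth n)).
have wl : w / 2 ^+ n <= l / 2 ^+ n by rewrite ler_wpM2r ?invr_ge0 ?exprn_ge0// lerDl.
have hl : h / 2 ^+ n <= l / 2 ^+ n by rewrite ler_wpM2r ?invr_ge0 ?exprn_ge0// lerDr.
have w2 : 0 <= w / 2 ^+ n by rewrite divr_ge0 ?exprn_ge0.
have h2 : 0 <= h / 2 ^+ n by rewrite divr_ge0 ?exprn_ge0.
have := @bdry_local f (s n).1 ((s n).1 + w / 2 ^+ n) (s n).2
  ((s n).2 + h / 2 ^+ n) X Y (Complex x y) D e' r (l / 2 ^+ n).
rewrite !lerDl w2 h2 => /(_ isT isT) /(_ _)/wrap[].
  apply: prims_sub hXY; by [case: (inx n)|case: (iny n)].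
move=> /(_ _)/wrap[]; first by split; [exact: hx|exact: hy].
rewrite ![_ + _ / _ - _]addrAC !subrr !add0r => /(_ e'0 hr wl hl hn) hB.
apply: (le_trans (ler_wpM2l (exprn_ge0 _ _) hB)) => //.
have -> : 4 ^+ n * (8 * e' * (l / 2 ^+ n) ^+ 2) = 8 * e' * l ^+ 2.
  rewrite expr_div_n -exprM mulnC exprM (_ : 2 ^+ 2 = 4) ?expr2; last by lra.
  by field; rewrite expf_neq0.
have -> : 8 * e' * l ^+ 2 = e * (l ^+ 2 / (l ^+ 2 + 1)).
  by rewrite /e'; field; rewrite gt_eqF// ltr_wpDl ?sqr_ge0.
rewrite ler_piMr ?(ltW e0)// ler_pdivrMr ?mul1r ?lerDl//.
by rewrite ltr_wpDl ?sqr_ge0.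
Qed.

End GoursatTheorem.

Section EdgeUniqueness.
Variable R : realType.
Implicit Types (f g : R[i] -> R[i]) (z D : R[i]).

(** Cauchy's theorem is stable under uniform limits; in this form it applies to the sum of a power
    series through its partial sums. *)
Definition cdiff_approx f (a b c d : R) := forall e : R, 0 < e -> exists2 g,
  (forall z, in_rect a b c d z -> cdiff g z) &
  (forall z, in_rect a b c d z -> nc (f z - g z) <= e).

Lemma cdiff_approx_rcont f a b c d : cdiff_approx f a b c d -> rcont f a b c d.
Proof.
move=> fa z zr e e0; have e3 : 0 < e / 3 by rewrite divr_gt0.
have [g gc gf] := fa _ e3.
have [r r0 hr] := cdiff_rcont gc zr e3; exists r => // w wr wz.
have -> : f w - f z = (f w - g w) + (g w - g z) - (f z - g z) by ring.
rewrite (le_trans (ncB _ _))// (le_trans (lerD (ncD _ _) (lexx _)))//.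
by have := gf w wr; have := gf z zr; have := hr w wr wz; lra.
Qed.

Lemma cdiff_approxM f k a b c d (B : R) : cdiff_approx f a b c d ->
  (forall z, in_rect a b c d z -> cdiff k z) ->
  (forall z, in_rect a b c d z -> nc (k z) <= B) ->
  cdiff_approx (fun z => k z * f z) a b c d.
Proof.
move=> fa kc kB e e0.
have B0 : 0 < `|B| + 1 by rewrite ltr_wpDl.
have [|g gc gf] := fa (e / (`|B| + 1)); first by rewrite divr_gt0.
exists (fun z => k z * g z) => z zr; first by apply: cdiffM; [exact: kc|exact: gc].
rewrite -mulrBr ncM; apply: (@le_trans _ _ ((`|B| + 1) * (e / (`|B| + 1)))).
  rewrite ler_pM ?nc_ge0// ?gf//.
  by apply: (le_trans (kB z zr)); rewrite (le_trans (ler_norm _))// lerDl.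
by rewrite mulrC divfK// gt_eqF.
Qed.

Lemma Cauchy_approx f a b c d X Y : a <= b -> c <= d -> prims f a b c d X Y ->
  cdiff_approx f a b c d -> bdry X Y a b c d = 0.
Proof.
move=> ab cd [hX hY] fa.
apply/eqP; rewrite -normr_eq0 eq_le normr_ge0 andbT.
apply/ler_addgt0Pr => e e0; rewrite add0r.
pose l := (b - a) + (d - c) + 1.
have wb : 0 <= b - a by rewrite subr_ge0.
have wd : 0 <= d - c by rewrite subr_ge0.
have l0 : 0 < l by rewrite /l; lra.
have e'0 : 0 < e / (2 * l) by rewrite divr_gt0// mulr_gt0.
have [g gc gf] := fa _ e'0.
have [X' [Y' [hX' hY']]] := prims_exist ab cd (cdiff_rcont gc).
have G := Goursat ab cd (conj hX' hY') gc.
have P : prims (fun z => f z - g z) a b c d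
    (fun x y => X x y - X' x y) (fun x y => Y x y - Y' x y).
  split=> x y xab ycd; rewrite !(cReD, cImD, cReN, cImN).
    by apply: is_deriveB; [exact: hX|exact: hX'].
  by apply: is_deriveB; [exact: hY|exact: hY'].
have [x [y [xab ycd]]] := bdry_MVT ab cd P.
have -> : bdry (fun x y => X x y - X' x y) (fun x y => Y x y - Y' x y) a b c d
    = bdry X Y a b c d - bdry X' Y' a b c d by rewrite /bdry; ring.
rewrite G subr0 => ->.
have rr x' y' : a <= x' <= b -> c <= y' <= d ->
    nc (f (Complex x' y') - g (Complex x' y')) <= e / (2 * l).
  by move=> h1 h2; apply: gf; split.
have aab : a <= a <= b by rewrite lexx.
have bab : a <= b <= b by rewrite lexx ab.
have ccd : c <= c <= d by rewrite lexx.
have dcd : c <= d <= d by rewrite lexx cd.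
have E1 := le_trans (nc_Re _) (le_trans (ncB _ _)
  (lerD (rr _ _ xab ccd) (rr _ _ xab dcd))).
have E2 := le_trans (nc_Im _) (le_trans (ncB _ _)
  (lerD (rr _ _ bab ycd) (rr _ _ aab ycd))).
rewrite (le_trans (ler_normB _ _))// !normrM.
rewrite (ger0_norm wb) (ger0_norm wd).
apply: (le_trans (lerD (ler_wpM2r wb E1) (ler_wpM2r wd E2))).
have -> : (e / (2 * l) + e / (2 * l)) * (b - a) +
  (e / (2 * l) + e / (2 * l)) * (d - c) = e * ((l - 1) / l).
  by rewrite /l; field; rewrite gt_eqF.
by rewrite ler_piMr ?(ltW e0)// ler_pdivrMr// mul1r; lra.
Qed.

(* For p = b and small k, |1 + k (z - p)^2| is close to 1 near p on the edge
   Re z = b, smaller on the rest of this edge and on the horizontal edges.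
   Cauchy's theorem for i conj(H p) (1 + k (z - p)^2)^J H, J -> oo, then
   forces H p = 0. *)
Theorem edge_uniqueness (H : R[i] -> R[i]) (a b : R) : a < b ->
  let h := 3 * (b - a) in
  cdiff_approx H a b (- h) h ->
  (forall y, - h <= y <= h -> H (Complex a y) = 0) ->
  H (Complex b 0) = 0.
Proof.
move=> ab h Ha Hedge; apply: contrapT => /eqP Hp0.
have {}ab' := ltW ab; pose w := b - a.
have w0 : 0 < w by rewrite subr_gt0.
have h0 : 0 < h by rewrite mulr_gt0.
have hh : - h <= h by lra.
pose p := Complex b 0 : R[i]; pose c := (H p)^*%C.
(* With [k w^2 = 1/20] and half-height [3 w], the modulus of [K] is at most [7/10] on the horizontal
   edges, while [K = 1 - k y^2] stays positive on the edge [Re z = b]. *)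
pose k : R := (20 * w ^+ 2)^-1.
have k0 : 0 < k by rewrite invr_gt0 mulr_gt0// exprn_gt0.
have kw : k * w ^+ 2 = 20^-1 by rewrite /k; field; rewrite gt_eqF.
pose K z := 1 + k%:C%C * (z - p) ^+ 2.
have Kcd z : cdiff K z.
  apply: cdiffD; first exact: cdiff_cst.
  apply: cdiffM; first exact: cdiff_cst.
  by apply: cdiffX; apply: cdiffD; [exact: cdiff_id|exact: cdiff_cst].
have KE (x y : R) : nc (K (Complex x y)) ^+ 2 =
    1 + 2 * k * ((x - b) ^+ 2 - y ^+ 2) + k ^+ 2 * ((x - b) ^+ 2 + y ^+ 2) ^+ 2.
  rewrite nc_sqr /K /p expr2 !(cReD, cImD, cReM, cImM) /=; ring.
have Kb (y : R) : K (Complex b y) = (1 - k * y ^+ 2)%:C%C.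
  rewrite /K /p expr2; apply/eqP; rewrite eq_complex.
  by rewrite !(cReD, cImD, cReM, cImM) /=; apply/andP; split; apply/eqP; ring.
have sqw (u : R) : - w <= u <= 0 -> 0 <= u ^+ 2 <= w ^+ 2.
  by move=> /andP[u1 u2]; rewrite sqr_ge0 -[u ^+ 2]sqrrN lerXn2r ?nnegrE//; lra.
have Kle x y : a <= x <= b -> - h <= y <= h -> nc (K (Complex x y)) <= 2.
  move=> /andP[x1 x2] /andP[y1 y2].
  rewrite -(@ler_pXn2r _ 2) ?nnegrE ?nc_ge0// KE.
  have /sqw/andP[u0 uw] : - w <= x - b <= 0 by rewrite /w; lra.
  have y0 : 0 <= y ^+ 2 by exact: sqr_ge0.
  have yh : y ^+ 2 <= 9 * w ^+ 2.
    rewrite -[y ^+ 2]real_normK ?num_real// (_ : 9 * w ^+ 2 = h ^+ 2); last first.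
      by rewrite /h -/w; ring.
    by rewrite lerXn2r ?nnegrE ?(ltW h0)// ler_norml y1.
  move: u0 uw y0 yh; set U := (x - b) ^+ 2; set V := y ^+ 2; set W := w ^+ 2 => *.
  have kU : k * U <= 20^-1 by rewrite -kw ler_pM2l.
  have kV : k * V <= 9 / 20 by rewrite -kw [9 * _]mulrCA ler_pM2l.
  have kU0 : 0 <= k * U by rewrite mulr_ge0// ltW.
  have kV0 : 0 <= k * V by rewrite mulr_ge0// ltW.
  have -> : 1 + 2 * k * (U - V) + k ^+ 2 * (U + V) ^+ 2 =
     1 + 2 * (k * U - k * V) + (k * U + k * V) ^+ 2 by ring.
  by nra.
have Khor x y : a <= x <= b -> y ^+ 2 = h ^+ 2 -> nc (K (Complex x y)) <= 7 / 10.
  move=> /andP[x1 x2] yh.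
  rewrite -(@ler_pXn2r _ 2) ?nnegrE ?nc_ge0//.
  rewrite KE yh.
  have /sqw/andP[u0 uw] : - w <= x - b <= 0 by rewrite /w; lra.
  have -> : h ^+ 2 = 9 * w ^+ 2 by rewrite /h -/w; ring.
  move: u0 uw; set U := (x - b) ^+ 2; set W := w ^+ 2 in kw * => u0 uw.
  have kU : k * U <= 20^-1 by rewrite -kw ler_pM2l.
  have kU0 : 0 <= k * U by rewrite mulr_ge0// ltW.
  have -> : 1 + 2 * k * (U - 9 * W) + k ^+ 2 * (U + 9 * W) ^+ 2 =
     1 + 2 * (k * U - 9 * (k * W)) + (k * U + 9 * (k * W)) ^+ 2 by ring.
  by rewrite kw; nra.
have rc := cdiff_approx_rcont Ha.
have cH0 : 0 < nc c by rewrite nc_gt0 conjc_eq0.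
pose m := nc (H p) ^+ 2 / 2.
have m0 : 0 < m by rewrite divr_gt0// exprn_gt0// nc_gt0.
have pr : in_rect a b (- h) h p.
  by split=> /=; [rewrite lexx ab'|rewrite oppr_le0 ltW].
have ncc : nc c = nc (H p) by rewrite /c; case: (H p) => ? ?; rewrite /= sqrrN.
pose phi y := complex.Re (c * H (Complex b y)).
have phi0 : phi 0 = 2 * m.
  rewrite /phi -/p /m cReM /c [2 * _]mulrC divfK// nc_sqr.
  by case: (H p) => u v /=; ring.
have [r0 r00 hr0] := rc p pr (m / nc c) (divr_gt0 m0 cH0).
pose r := Num.min (r0 / 2) w.
have r_gt0 : 0 < r by rewrite lt_min w0 divr_gt0.
have rw : r <= w by rewrite ge_min lexx orbT.
have rr0 : r < r0.
  by rewrite (@le_lt_trans _ _ (r0 / 2))// ?ge_min ?lexx// ltr_pdivrMr//; lra.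
have rh : r <= h by rewrite /h -/w; lra.
have phige y : - r <= y <= r -> m <= phi y.
  move=> /andP[y1 y2].
  have hy : `|phi y - phi 0| <= m.
    rewrite /phi -cReN -cReD -mulrBr (le_trans (nc_Re _))// ncM mulrC.
    rewrite -ler_pdivlMr//; apply: hr0.
      by split=> /=; [rewrite lexx ab'|lra].
    have -> : Complex b y - p = Complex 0 y :> R[i].
      by apply/eqP; rewrite eq_complex/= subrr subr0 !eqxx.
    rewrite /= expr0n/= add0r sqrtr_sqr (le_lt_trans _ rr0)//.
    by rewrite ler_norml y1.
  by move: hy; rewrite ler_norml phi0; lra.
have bdd (f : R -> R[i]) (u v : R) : u <= v -> (forall t, u <= t <= v ->
    forall e, 0 < e -> exists2 s : R, 0 < s & forall t', u <= t' <= v ->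
    `|t' - t| < s -> nc (f t' - f t) <= e) ->
    exists M, forall t, u <= t <= v -> nc (f t) <= M.
  move=> uv fc; have [|M hM] := @cont_on_bounded R u v (fun t => nc (f t)) uv.
    move=> t tuv e e0; have [s s0 hs] := fc t tuv e e0; exists s => // t' t'uv st.
    apply: le_trans (hs t' t'uv st); rewrite ler_norml.
    apply/andP; split; last exact: ncB_ge.
    by rewrite lerNl opprB ncBC ncB_ge.
  by exists M => t tuv; rewrite (le_trans (ler_norm _))// hM.
have [M1 hM1] : exists M, forall y, - h <= y <= h -> nc (c * H (Complex b y)) <= M.
  have [|M hM] := bdd (fun y => H (Complex b y)) (- h) h hh.
    move=> t th e e0; have [|s s0 hs] := rc (Complex b t) _ e e0.
      by split=> //=; rewrite lexx ab'.
    exists s => // t' t'h ts; apply: hs; first by split=> //=; rewrite lexx ab'.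
    have -> : Complex b t' - Complex b t = Complex 0 (t' - t) :> R[i].
      by apply/eqP; rewrite eq_complex/= subrr !eqxx.
    by rewrite /= expr0n/= add0r sqrtr_sqr.
  by exists (nc c * M) => y yh; rewrite ncM ler_wpM2l ?nc_ge0// hM.
have [M2 hM2] : exists M, forall x y, a <= x <= b -> y = h \/ y = - h ->
    nc (c * H (Complex x y)) <= M.
  have B y : - h <= y <= h -> exists M, forall x, a <= x <= b ->
      nc (H (Complex x y)) <= M.
    move=> yh; apply: (bdd (fun x => H (Complex x y)) a b ab').
    move=> t tab e e0; have [|s s0 hs] := rc (Complex t y) _ e e0.
      by split.
    exists s => // t' t'h ts; apply: hs; first by split.
    have -> : Complex t' y - Complex t y = (t' - t)%:C%C :> R[i].
      by apply/eqP; rewrite eq_complex/= subrr !eqxx.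
    by rewrite ncR.
  have [|N1 hN1] := B h; first by rewrite lexx hh.
  have [|N2 hN2] := B (- h); first by rewrite lexx hh.
  exists (nc c * Num.max N1 N2) => x y xab yh; rewrite ncM ler_wpM2l ?nc_ge0//.
  by case: yh => ->; rewrite le_max ?hN1 ?hN2 ?orbT.
pose Mx := Num.max M1 M2.
have Mx0 : 0 <= Mx.
  by rewrite le_max (le_trans (nc_ge0 _) (hM1 0 _))//; rewrite oppr_le0 ltW.
(* These are the values of [K] on the right edge at heights [r / 2] and [r]. The part [|y| <= r / 2]
   contributes at least [r m q1^J], the part up to [r] is nonnegative, and the rest, including the
   horizontal edges because [q2 >= 7/10], is [O(q2^J)]. *)
pose q1 := 1 - k * (r / 2) ^+ 2; pose q2 := 1 - k * r ^+ 2.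
have kr : 0 < k * r ^+ 2 <= 20^-1.
  rewrite mulr_gt0 ?exprn_gt0//= -kw ler_pM2l// lerXn2r ?nnegrE// ltW//.
have q20 : 7 / 10 <= q2 by rewrite /q2; lra.
have q12 : q2 < q1.
  by rewrite /q1 /q2 expr_div_n; move: kr => /andP[kr0 _]; rewrite mulrA; lra.
have q1_gt0 : 0 < q1 by lra.
have A0 : 0 <= 8 * h * Mx by rewrite !mulr_ge0// ltW.
suff main J : r * m * q1 ^+ J <= 8 * h * Mx * q2 ^+ J.
  have /cvgrPdist_lt/(_ (r * m / (8 * h * Mx + 1)))[] : (q2 / q1) ^+ n @[n --> \oo] --> 0.
    apply: cvg_expr; rewrite ger0_norm ?divr_ge0 ?(ltW q1_gt0)//; last lra.
    by rewrite ltr_pdivrMr// mul1r.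
    by apply: divr_gt0; [exact: mulr_gt0|exact: ltr_wpDl].
  move=> J _ /(_ J (leqnn _)); rewrite /= sub0r normrN ger0_norm; last first.
    by rewrite exprn_ge0// divr_ge0 ?(ltW q1_gt0)//; lra.
  rewrite expr_div_n ltr_pdivlMr; last by rewrite ltr_wpDl.
  rewrite mulrAC ltr_pdivrMr ?exprn_gt0// => hJ.
  have := main J; rewrite leNgt => /negP; apply; apply: le_lt_trans hJ.
  rewrite [leLHS]mulrC ler_wpM2l ?lerDl// exprn_ge0//; lra.
pose f z := (Complex 0 1 * c * K z ^+ J) * H z.
have fa : cdiff_approx f a b (- h) h.
  apply: (@cdiff_approxM _ _ _ _ _ _ (nc c * 2 ^+ J)) => //.
    move=> z _; apply: cdiffM; first exact: cdiff_cst.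
    exact: cdiffX.
  move=> [x y] [xab yh]; rewrite !ncM ncX.
  rewrite (_ : nc (Complex 0 1 : R[i]) = 1) ?mul1r; last first.
    by rewrite /= expr0n/= add0r expr1n sqrtr1.
  rewrite ler_wpM2l ?nc_ge0// lerXn2r ?nnegrE ?nc_ge0//.
  exact: Kle.
have [X [Y hXY]] := prims_exist ab' hh (cdiff_approx_rcont fa).
have B0 := Cauchy_approx ab' hh hXY fa.
have [hX hY] := hXY.
have fb y : complex.Im (f (Complex b y)) = phi y * (1 - k * y ^+ 2) ^+ J.
  rewrite /f Kb -(rmorphXn (real_complex R)) mulrAC.
  by rewrite /phi !(cImM, cReM) /=; ring.
have ncf x y : nc (f (Complex x y)) =
    nc (c * H (Complex x y)) * nc (K (Complex x y)) ^+ J.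
  rewrite /f !ncM ncX (_ : nc (Complex 0 1 : R[i]) = 1) ?mul1r; last first.
    by rewrite /= expr0n/= add0r expr1n sqrtr1.
  by rewrite mulrAC.
have bab : a <= b <= b by rewrite lexx ab'.
have aab : a <= a <= b by rewrite lexx ab'.
have Ya : Y a h - Y a (- h) = 0.
  apply/eqP; rewrite -normr_eq0 eq_le normr_ge0 andbT.
  have := @MVT_norm_le R (Y a) (fun y => complex.Im (f (Complex a y))) (- h) h 0 hh.
  rewrite mul0r; apply=> [y yh|y yh]; first exact: hY.
  by rewrite /f Hedge// mulr0 normr0.
have hor y : y = h \/ y = - h -> `|X b y - X a y| <= Mx * q2 ^+ J * w.
  move=> yh; have yhh : - h <= y <= h by case: yh => ->; rewrite lexx hh.
  apply: (@MVT_norm_le R (X^~ y) (fun x => complex.Re (f (Complex x y)))) => // x xab.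
    exact: hX.
  rewrite (le_trans (nc_Re _))// ncf ler_pM ?exprn_ge0 ?nc_ge0//.
    by rewrite le_max hM2 ?orbT.
  rewrite lerXn2r ?nnegrE ?nc_ge0//; first by clear -q20; lra.
  by apply: le_trans q20; apply: Khor => //; case: yh => ->; rewrite ?sqrrN.
have kpos y : - h <= y <= h -> 0 <= 1 - k * y ^+ 2.
  move=> /andP[y1 y2]; have yh : y ^+ 2 <= 9 * w ^+ 2.
    rewrite -[y ^+ 2]real_normK ?num_real// (_ : 9 * w ^+ 2 = h ^+ 2); last first.
      by rewrite /h -/w; ring.
    by rewrite lerXn2r ?nnegrE ?(ltW h0)// ler_norml y1.
  have : k * y ^+ 2 <= 9 / 20 by rewrite -kw [9 * _]mulrCA ler_pM2l.
  by clear; lra.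
have outer u v : u <= v -> - h <= u -> v <= h ->
    (forall y, u <= y <= v -> r ^+ 2 <= y ^+ 2) ->
    - (Mx * q2 ^+ J) * (v - u) <= Y b v - Y b u.
  move=> uv uh vh sq.
  apply: (@MVT_ge R (Y b) (fun y => complex.Im (f (Complex b y)))) => // y /andP[y1 y2].
    by apply: hY => //; rewrite (le_trans uh)//= (le_trans y2).
  have yh : - h <= y <= h by rewrite (le_trans uh)//= (le_trans y2).
  rewrite lerNl (le_trans (ler_norm _))// normrN fb normrM ler_pM//.
    by rewrite le_max (le_trans (nc_Re _))// hM1.
  rewrite normrX ger0_norm ?kpos// lerXn2r ?nnegrE ?kpos//; first by clear -r_gt0 rh h0; lra.
  by rewrite lerB// ler_pM2l// sq// y1.
have inner u v q : u <= v -> - r <= u -> v <= r -> 0 <= q ->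
    (forall y, u <= y <= v -> q <= 1 - k * y ^+ 2) ->
    m * q ^+ J * (v - u) <= Y b v - Y b u.
  move=> uv uh vh q0 sq.
  apply: (@MVT_ge R (Y b) (fun y => complex.Im (f (Complex b y)))) => // y /andP[y1 y2].
    by apply: hY => //; apply/andP; clear -uh vh rh y1 y2; split; lra.
  have yr : - r <= y <= r by rewrite (le_trans uh)//= (le_trans y2).
  rewrite fb ler_pM ?exprn_ge0 ?(ltW m0)//; first exact: phige.
  by rewrite lerXn2r ?nnegrE// ?kpos ?sq ?y1//; clear -yr rh; lra.
have O1 : - (Mx * q2 ^+ J) * (h - r) <= Y b h - Y b r.
  apply: outer => //; first by clear -rh h0 r_gt0; lra.
  by move=> y /andP[y1 y2]; rewrite lerXn2r ?nnegrE//; clear -r_gt0 y1; lra.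
have O2 : - (Mx * q2 ^+ J) * (- r - - h) <= Y b (- r) - Y b (- h).
  apply: outer; [clear -rh h0 r_gt0; lra|clear -rh; lra|clear -r_gt0 h0; lra|].
  by move=> y /andP[y1 y2]; rewrite -[y ^+ 2]sqrrN lerXn2r ?nnegrE//; clear -r_gt0 y1 y2; lra.
have sqle (u y : R) : 0 <= u -> - u <= y <= u -> y ^+ 2 <= u ^+ 2.
  move=> u0 yu; rewrite -[y ^+ 2]real_normK ?num_real//.
  by rewrite lerXn2r ?nnegrE// ler_norml.
have I1 : m * q2 ^+ J * (r - r / 2) <= Y b r - Y b (r / 2).
  apply: inner => //; [clear -r_gt0; lra|clear -r_gt0; lra|clear -q20 r_gt0; lra|].
  by move=> y /andP[y1 y2]; rewrite /q2 lerB// ler_pM2l// sqle ?(ltW r_gt0)//; apply/andP; clear -r_gt0 y1 y2; split; lra.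
have I2 : m * q2 ^+ J * (- (r / 2) - - r) <= Y b (- (r / 2)) - Y b (- r).
  apply: inner => //; [clear -r_gt0; lra|clear -r_gt0; lra|clear -q20 r_gt0; lra|].
  by move=> y /andP[y1 y2]; rewrite /q2 lerB// ler_pM2l// sqle ?(ltW r_gt0)//; apply/andP; clear -r_gt0 y1 y2; split; lra.
have I3 : m * q1 ^+ J * (r / 2 - - (r / 2)) <= Y b (r / 2) - Y b (- (r / 2)).
  apply: inner => //; [clear -r_gt0; lra|clear -r_gt0; lra|clear -r_gt0; lra|exact: ltW|].
  by move=> y /andP[y1 y2]; rewrite /q1 lerB// ler_pM2l// sqle//; [clear -r_gt0; lra|apply/andP; clear -r_gt0 y1 y2; split; lra].
have q2J : 0 <= q2 ^+ J by rewrite exprn_ge0//; clear -q20; lra.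
have mq2 : 0 <= m * q2 ^+ J by rewrite mulr_ge0// ltW.
have Mq : 0 <= Mx * q2 ^+ J by rewrite mulr_ge0.
have H1 := hor h (or_introl erefl); have H2 := hor (- h) (or_intror erefl).
move: B0; rewrite /bdry Ya => B0.
move: H1 H2; rewrite !ler_norml => /andP[H1 H1'] /andP[H2 H2'].
have hw : h = 3 * w by [].
have J1 : 0 <= m * q2 ^+ J * (r - r / 2) by rewrite mulr_ge0//; clear -r_gt0; lra.
have J2 : 0 <= m * q2 ^+ J * (- (r / 2) - - r) by rewrite mulr_ge0//; clear -r_gt0; lra.
have -> : r * m * q1 ^+ J = m * q1 ^+ J * (r / 2 - - (r / 2)) by field.
apply: le_trans I3 _.
have -> : 8 * h * Mx * q2 ^+ J = 8 * (Mx * q2 ^+ J * h) by ring.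
have e1 : Mx * q2 ^+ J * w <= Mx * q2 ^+ J * h by rewrite ler_wpM2l// hw; clear -w0; lra.
have e2 : 0 <= Mx * q2 ^+ J * r by rewrite mulr_ge0// ltW.
have e3 : 0 <= Mx * q2 ^+ J * h by rewrite mulr_ge0// ltW.
move: O1 O2; rewrite !mulNr !mulrBr !mulrN => O1 O2.
clear -B0 H1 H1' H2 H2' O1 O2 I1 I2 J1 J2 e1 e2 e3 Mq mq2 hw; lra.
Qed.

End EdgeUniqueness.

(** * Abel summation against u^k / k! e^(- w u) *)

Section ComplexExponential.
Variable R : realType.

Lemma is_deriveM1 (f g : R -> R) (x df dg : R) :
  is_derive x (1 : R) f df -> is_derive x (1 : R) g dg ->
  is_derive x (1 : R) (fun t => f t * g t) (df * g x + f x * dg).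
Proof.
move=> h1 h2; apply: (is_derive_eq (@is_deriveM _ _ f g x 1 df dg h1 h2)).
by rewrite /GRing.scale/=; ring.
Qed.

Lemma is_deriveN1 (f : R -> R) (x df : R) :
  is_derive x (1 : R) f df -> is_derive x (1 : R) (fun t => - f t) (- df).
Proof. by move=> h; exact: is_deriveN. Qed.

Lemma is_deriveX1 k (x : R) :
  is_derive x (1 : R) (fun t => t ^+ k) (k%:R * x ^+ k.-1).
Proof.
elim: k => [|k IH].
  by apply: (is_derive_eq (is_derive_cst (1 : R) x (1 : R))); rewrite mul0r.
have := is_deriveM1 (is_derive_id x (1 : R)) IH.
rewrite (_ : (fun t => _) = (fun t => t ^+ k.+1)); last first.
  by apply/funext => t; rewrite exprS.
move=> h; apply: (is_derive_eq h) => /=; rewrite mul1r mulrCA.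
case: k {IH h} => [|k] /=; first by rewrite mul0r addr0 mul1r.
by rewrite -exprS -[k.+2%:R]natr1; ring.
Qed.

Lemma is_derive_comp_lin (f : R -> R) (c x df : R) :
  is_derive (c * x) (1 : R) f df ->
  is_derive x (1 : R) (fun t => f (c * t)) (df * c).
Proof.
move=> h; have hc : is_derive x (1 : R) (fun t => c * t) c.
  apply: (is_derive_eq (@is_deriveZ _ _ _ id c x 1 1 (is_derive_id _ _))).
  by rewrite /GRing.scale/= mulr1.
exact: (@is_derive1_comp _ f (fun t => c * t) x df c h hc).
Qed.

Implicit Types (w : R[i]) (u : R).

(* e^(- w u) *)
Definition cE w u : R[i] :=
  Complex (expR (- complex.Re w * u) * cos (complex.Im w * u))
          (- (expR (- complex.Re w * u) * sin (complex.Im w * u))).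

Lemma nc_cE w u : nc (cE w u) = expR (- complex.Re w * u).
Proof.
rewrite /= sqrrN !exprMn -mulrDr addrC sin2cos2 subrK mulr1 sqrtr_sqr.
by rewrite ger0_norm ?expR_ge0.
Qed.

Lemma cE_D w1 w2 u : cE (w1 + w2) u = cE w1 u * cE w2 u.
Proof.
apply/eqP; rewrite eq_complex cReM cImM /= cReD cImD opprD !mulrDl expRD cosD sinD.
by apply/andP; split; apply/eqP; ring.
Qed.

Lemma cE0 w : cE w 0 = 1.
Proof.
by rewrite /cE !mulr0 expR0 cos0 sin0 mulr0 mulr1 oppr0.
Qed.

Lemma cE_Dr w u v : cE w (u + v) = cE w u * cE w v.
Proof.
apply/eqP; rewrite eq_complex cReM cImM /= !mulrDr expRD cosD sinD.
by apply/andP; split; apply/eqP; ring.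
Qed.

Definition cder (f : R -> R[i]) u (D : R[i]) :=
  is_derive u (1 : R) (fun t => complex.Re (f t)) (complex.Re D) /\
  is_derive u (1 : R) (fun t => complex.Im (f t)) (complex.Im D).

Lemma cder_eq f u D D' : cder f u D -> D = D' -> cder f u D'.
Proof. by move=> h <-. Qed.

Lemma cder_cE w u : cder (cE w) u (- w * cE w u).
Proof.
have h1 : is_derive u (1 : R) (fun t => expR (- complex.Re w * t))
    (expR (- complex.Re w * u) * - complex.Re w).
  by apply: is_derive_comp_lin; exact: is_derive_expR.
have h2 : is_derive u (1 : R) (fun t => cos (complex.Im w * t))
    (- sin (complex.Im w * u) * complex.Im w).
  by apply: is_derive_comp_lin; exact: is_derive_cos.
have h3 : is_derive u (1 : R) (fun t => sin (complex.Im w * t))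
    (cos (complex.Im w * u) * complex.Im w).
  by apply: is_derive_comp_lin; exact: is_derive_sin.
split; rewrite /cE /= !(cReM, cImM, cReN, cImN) /=.
  by apply: (is_derive_eq (is_deriveM1 h1 h2)); ring.
by apply: (is_derive_eq (is_deriveN1 (is_deriveM1 h1 h3))); ring.
Qed.

Lemma cderB f g u D D' : cder f u D -> cder g u D' ->
  cder (fun t => f t - g t) u (D - D').
Proof.
move=> [f1 f2] [g1 g2]; split.
  rewrite (_ : (fun t => _) = (fun t => complex.Re (f t) - complex.Re (g t))).
    by rewrite cReD cReN; exact: is_deriveB.
  by apply/funext => t; rewrite cReD cReN.
rewrite (_ : (fun t => _) = (fun t => complex.Im (f t) - complex.Im (g t))).
  by rewrite cImD cImN; exact: is_deriveB.
by apply/funext => t; rewrite cImD cImN.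
Qed.

Lemma cderMl (c : R[i]) f u D : cder f u D -> cder (fun t => c * f t) u (c * D).
Proof.
move=> [f1 f2]; split.
  rewrite (_ : (fun t => _) = (fun t => complex.Re c * complex.Re (f t)
    - complex.Im c * complex.Im (f t))); last first.
    by apply/funext => t; rewrite cReM.
  by rewrite cReM; apply: is_deriveB; exact: is_deriveZ.
rewrite (_ : (fun t => _) = (fun t => complex.Re c * complex.Im (f t)
    + complex.Im c * complex.Re (f t))); last first.
  by apply/funext => t; rewrite cImM.
by rewrite cImM; apply: is_deriveD; exact: is_deriveZ.
Qed.

Lemma cderRM (g : R -> R) f u (dg : R) D : is_derive u (1 : R) g dg -> cder f u D ->
  cder (fun t => (g t)%:C%C * f t) u (dg%:C%C * f u + (g u)%:C%C * D).
Proof.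
move=> hg [f1 f2]; split.
  rewrite (_ : (fun t => _) = (fun t => g t * complex.Re (f t))); last first.
    by apply/funext => t; rewrite cReM/= mul0r subr0.
  by apply: (is_derive_eq (is_deriveM1 hg f1)); rewrite cReD !cReM /=; ring.
rewrite (_ : (fun t => _) = (fun t => g t * complex.Im (f t))); last first.
  by apply/funext => t; rewrite cImM/= mul0r addr0.
by apply: (is_derive_eq (is_deriveM1 hg f2)); rewrite cImD !cImM /=; ring.
Qed.

(** For [u = log |g|] this is the coefficient of [z^k] in [|g|^(z - w)]. *)
Definition ph k w u : R[i] := (u ^+ k / k`!%:R)%:C%C * cE w u.

Lemma nc_ph k w u : 0 <= u ->
  nc (ph k w u) = u ^+ k / k`!%:R * expR (- complex.Re w * u).
Proof.
by move=> u0; rewrite ncM ncR nc_cE ger0_norm// divr_ge0 ?exprn_ge0.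
Qed.

Lemma is_derive_coeff k u : is_derive u (1 : R) (fun t => t ^+ k / k`!%:R)
  (if k is j.+1 then u ^+ j / j`!%:R else 0).
Proof.
case: k => [|k].
  rewrite (_ : (fun t => _) = cst 1); first exact: is_derive_cst.
  by apply/funext => t; rewrite expr0 fact0 divr1.
rewrite (_ : (fun t => _) = (fun t => (k.+1`!%:R^-1) * t ^+ k.+1)); last first.
  by apply/funext => t; rewrite mulrC.
apply: (is_derive_eq (is_deriveM1
  (is_derive_cst (k.+1`!%:R^-1 : R) u (1 : R)) (is_deriveX1 k.+1 u))).
rewrite /= mul0r add0r factS natrM.
by field; rewrite ?nat1r !pnatr_eq0 -!lt0n ?fact_gt0.
Qed.

Definition ph' k w u : R[i] := (if k is j.+1 then ph j w u else 0) - w * ph k w u.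

Lemma cder_ph k w u : cder (ph k w) u (ph' k w u).
Proof.
apply: cder_eq; first by apply: cderRM; [exact: is_derive_coeff|exact: cder_cE].
by rewrite /ph' /ph; case: k => [|k]; rewrite ?mul0r; ring.
Qed.

(** The primitive of [ph k w] given by repeated integration by parts; for [Re w > 0] it is the one
    that vanishes at infinity. *)
Fixpoint iph k w u : R[i] :=
  if k is j.+1 then w^-1 * (iph j w u - ph k w u) else w^-1 * - ph 0 w u.

Lemma cder_iph k w u : w != 0 -> cder (iph k w) u (ph k w u).
Proof.
move=> w0; elim: k => [|k IH].
  apply: cder_eq.
    apply: (@cderMl w^-1 (fun t => - ph 0 w t)).
    rewrite (_ : (fun t => _) = (fun t => -1 * ph 0 w t)).
      by apply: cderMl; exact: cder_ph.
    by apply/funext => t; rewrite mulN1r.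
  by rewrite /ph' sub0r mulN1r opprK mulKf.
apply: cder_eq.
  by apply: (@cderMl w^-1); apply: cderB; [exact: IH|exact: cder_ph].
by rewrite /ph' opprB addrC subrK mulKf.
Qed.

Lemma iph_0 k w : w != 0 -> iph k w 0 = - w ^- k.+1.
Proof.
move=> w0; elim: k => [|k IH] /=; rewrite /ph cE0 mulr1.
  by rewrite expr0 fact0 divr1 expr1 mulrN mulr1.
by rewrite IH expr0n/= mul0r subr0 mulrN -invfM -exprS.
Qed.

(** For [u >= 2 k / |w|], each term produced by the recursion has at least twice the modulus of the
    preceding one, so their sum is at most twice the last. *)
Lemma nc_iph_le k w u : w != 0 -> 0 < u -> 2 * k%:R <= nc w * u ->
  nc (iph k w u) <= 2 / nc w * nc (ph k w u).
Proof.
rewrite -nc_gt0 => w0 u0; elim: k => [|k IH] kw.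
  rewrite [iph _ _ _]/(w^-1 * - ph 0 w u) ncM ncN ncV ler_wpM2r ?nc_ge0// ler_peMl ?invr_ge0 ?nc_ge0//; lra.
rewrite [iph _ _ _]/(w^-1 * (iph k w u - ph k.+1 w u)) ncM ncV -mulrA mulrCA ler_wpM2l ?invr_ge0 ?nc_ge0//.
apply: (le_trans (ncB _ _)); rewrite mulr_natl mulr2n lerD2r.
apply: le_trans (IH _) _; first by apply: le_trans kw; rewrite ler_pM2l// ler_nat.
rewrite mulrAC ler_pdivrMr//.
have -> : nc (ph k w u) = nc (ph k.+1 w u) * (k.+1%:R / u).
  rewrite !nc_ph ?ltW// factS natrM exprS; field.
  by rewrite ?nat1r (gt_eqF u0)/= !pnatr_eq0 -!lt0n fact_gt0.
rewrite mulrCA ler_wpM2l ?nc_ge0//.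
by rewrite mulrA ler_pdivrMr.
Qed.

End ComplexExponential.

Section RealGamma.
Variable R : realType.

Definition phR k (a u : R) : R := u ^+ k / k`!%:R * expR (- a * u).

Lemma phR_ge0 k a u : 0 <= u -> 0 <= phR k a u.
Proof. by move=> u0; rewrite !mulr_ge0 ?exprn_ge0 ?invr_ge0 ?expR_ge0. Qed.

Lemma nc_phE k (w : R[i]) u : 0 <= u -> nc (ph k w u) = phR k (complex.Re w) u.
Proof. exact: nc_ph. Qed.

Lemma is_derive_phR k a u : is_derive u (1 : R) (phR k a)
  ((if k is j.+1 then phR j a u else 0) - a * phR k a u).
Proof.
have h : is_derive u (1 : R) (fun t => expR (- a * t)) (expR (- a * u) * - a).
  by apply: is_derive_comp_lin; exact: is_derive_expR.
apply: (is_derive_eq (is_deriveM1 (is_derive_coeff k u) h)).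
by rewrite /phR; case: k => [|k]; rewrite ?mul0r; ring.
Qed.

Fixpoint iphR k (a u : R) : R :=
  if k is j.+1 then a^-1 * (iphR j a u - phR k a u) else a^-1 * - phR 0 a u.

Lemma is_derive_iphR k a u : a != 0 -> is_derive u (1 : R) (iphR k a) (phR k a u).
Proof.
move=> a0; elim: k => [|k IH].
  apply: (is_derive_eq (is_deriveM1 (is_derive_cst (a^-1 : R) u (1 : R))
    (is_deriveN1 (is_derive_phR 0 a u)))).
  by rewrite mul0r add0r sub0r opprK /= mulKf.
apply: (is_derive_eq (is_deriveM1 (is_derive_cst (a^-1 : R) u (1 : R))
    (is_deriveB IH (is_derive_phR k.+1 a u)))).
by rewrite mul0r add0r opprB addrC subrK /= mulKf.
Qed.

Lemma iphR_0 k a : a != 0 -> iphR k a 0 = - a ^- k.+1.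
Proof.
move=> a0; elim: k => [|k IH] /=; rewrite /phR mulr0 expR0 mulr1.
  by rewrite expr0 fact0 divr1 expr1 mulrN mulr1.
by rewrite IH expr0n/= mul0r subr0 mulrN -invfM -exprS.
Qed.

Lemma iphR_le0 k a u : 0 < a -> 0 <= u -> iphR k a u <= 0.
Proof.
move=> a0 u0; elim: k => [|k IH] /=.
  by rewrite mulrN oppr_le0 mulr_ge0 ?invr_ge0 ?phR_ge0 ?(ltW a0).
by rewrite pmulr_rle0 ?invr_gt0// subr_le0 (le_trans IH)// phR_ge0.
Qed.

Lemma iphR_sub_le k a u v : 0 < a -> 0 <= u -> u <= v ->
  iphR k a v - iphR k a u <= a ^- k.+1.
Proof.
move=> a0 u0 uv; have an0 : a != 0 by rewrite gt_eqF.
have := @MVT_ge R (iphR k a) (phR k a) 0 u 0 u0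
  (fun x _ => is_derive_iphR k x an0).
rewrite iphR_0// opprK mul0r => /(_ _)/wrap[x /andP[x0 _]|h].
  exact: phR_ge0.
have := iphR_le0 k a0 (le_trans u0 uv); lra.
Qed.

(** This is [(a u)^k / k! <= e^(a u)]. Applied to a part [a] of the decay rate of a weight, it is
    the source of Rankin's trick. *)
Lemma phR_le k a u : 0 < a -> 0 <= u -> phR k a u <= a ^- k.
Proof.
move=> a0 u0; rewrite /phR mulNr expRN ler_pdivrMr ?expR_gt0//.
rewrite -ler_pdivrMl ?invr_gt0 ?exprn_gt0// invrK mulrA -exprMn.
by apply: expR_ge_coeff; rewrite mulr_ge0// ltW.
Qed.

End RealGamma.

Section Abel.
Variables (R : realType) (I : eqType) (r : seq I) (lam al : I -> R).

Let S u := \sum_(i <- r | lam i <= u) al i.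

Lemma count_lt (P Q : pred I) i : (forall j, P j -> Q j) -> i \in r -> Q i ->
  ~~ P i -> (count P r < count Q r)%N.
Proof.
move=> PQ ir Qi Pi; rewrite -(size_filter Q) -(count_predC P) !count_filter.
rewrite -addn1 leq_add//; first by apply: sub_count => j Pj /=; rewrite Pj PQ.
by rewrite -has_count; apply/hasP; exists i; rewrite //= Pi.
Qed.

Variables (phi phi' M M' U V V' : R -> R) (A B : R).
Hypothesis phiD : forall u, A <= u <= B -> is_derive u (1 : R) phi (phi' u).
Hypothesis MD : forall u, A <= u <= B -> is_derive u (1 : R) M (M' u).
Hypothesis UD : forall u, A <= u <= B -> is_derive u (1 : R) U (M' u * phi u).
Hypothesis VD : forall u, A <= u <= B -> is_derive u (1 : R) V (V' u).
Hypothesis SM : forall u, A <= u <= B -> `|S u - M u| * `|phi' u| <= V' u.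

(** A primitive of [(M - S) phi'] between the jumps of [S], and continuous across them because a new
    term of the sum enters with the value 0. *)
Let W u := \sum_(i <- r | lam i <= u) al i * (phi (lam i) - phi u)
  - U u + M u * phi u.

Lemma Abel_nojump a b : A <= a -> a < b -> b <= B ->
  count (fun i => a < lam i < b) r = 0%N -> `|W b - W a| <= V b - V a.
Proof.
move=> Aa ab bB nj.
have nj' i : i \in r -> lam i <= a \/ b <= lam i.
  move=> ir; have := nj; apply: contraPP => /not_orP[/negP h1 /negP h2].
  apply/eqP; rewrite -lt0n -has_count; apply/hasP; exists i => //.
  by rewrite !ltNge h1 h2.
pose S0 := S a; pose T0 := \sum_(i <- r | lam i <= a) al i * phi (lam i).
(* [W] with the range of summation frozen at [a]; it agrees with [W] at [b] because terms with
   [lam i = b] vanish there. *)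
pose W1 u := T0 - S0 * phi u - U u + M u * phi u.
have sE u : \sum_(i <- r | lam i <= a) al i * (phi (lam i) - phi u) =
    T0 - S0 * phi u.
  by rewrite /T0 /S0 /S mulr_suml -sumrB; apply: eq_bigr => i _; rewrite mulrBr.
have Wa : W a = W1 a by rewrite /W /W1 sE.
have Wb : W b = W1 b.
  rewrite /W /W1 -sE; congr (_ - _ + _).
  rewrite [LHS]big_mkcond [RHS]big_mkcond.
  apply: eq_big_seq => i /nj'[h|h].
    by rewrite h (le_trans h)// ltW.
  rewrite [in RHS]leNgt (lt_le_trans ab h)/=; case: ifP => // h2.
  by rewrite (le_anti (_ : b <= lam i <= b)) ?h ?h2// subrr mulr0.
have inAB u : a <= u <= b -> A <= u <= B.
  by move=> /andP[h1 h2]; rewrite (le_trans Aa)//= (le_trans h2).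
have W1D u : a <= u <= b ->
    is_derive u (1 : R) W1 ((M u - S0) * phi' u).
  move=> /inAB h; rewrite /W1.
  apply: (is_derive_eq (is_deriveD (is_deriveB (is_deriveB
    (is_derive_cst T0 u (1 : R))
    (is_deriveM1 (is_derive_cst S0 u (1 : R)) (phiD h))) (UD h))
    (is_deriveM1 (MD h) (phiD h)))).
  by rewrite /=; ring.
have SS0 u : a < u < b -> S u = S0.
  move=> /andP[h1 h2]; rewrite /S0 /S.
  rewrite [LHS]big_mkcond [RHS]big_mkcond.
  apply: eq_big_seq => i /nj'[h|h]; first by rewrite h (le_trans h)// ltW.
  by rewrite !leNgt (lt_le_trans ab h) (lt_le_trans h2 h).
have mvt (f df : R -> R) : (forall u, a <= u <= b -> is_derive u (1 : R) f (df u)) ->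
    (forall u, a < u < b -> 0 <= df u) -> f a <= f b.
  move=> fD df0; have fc : {within `[a, b], continuous f}.
    apply: derivable_within_continuous => x; rewrite in_itv/= => xab.
    by have [] := fD x xab.
  have [x|c] := @MVT R f df a b ab _ fc.
    by rewrite in_itv/= => /andP[ax xb]; apply: fD; rewrite !ltW.
  rewrite in_itv/= => cab h; rewrite -subr_ge0 h mulr_ge0 ?df0//.
  by rewrite subr_ge0 ltW.
have dle u : a < u < b -> `|(M u - S0) * phi' u| <= V' u.
  move=> h; rewrite normrM distrC -(SS0 _ h) SM//.
  by apply: inAB; case/andP: h => h1 h2; rewrite !ltW.
rewrite Wa Wb ler_norml; apply/andP; split.
  have h : W1 a + V a <= W1 b + V b.
    apply: (@mvt (fun u => W1 u + V u) (fun u => (M u - S0) * phi' u + V' u)).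
      by move=> u h; apply: is_deriveD; [exact: W1D|apply: VD; exact: inAB].
    by move=> u /dle; rewrite ler_norml; lra.
  lra.
have h : V a - W1 a <= V b - W1 b.
  apply: (@mvt (fun u => V u - W1 u) (fun u => V' u - (M u - S0) * phi' u)).
    by move=> u h; apply: is_deriveB; [apply: VD; exact: inAB|exact: W1D].
  by move=> u /dle; rewrite ler_norml; lra.
lra.
Qed.

(** Induction on the number of jumps inside the interval, which is split at one of them. *)
Lemma Abel_W a b : A <= a -> a <= b -> b <= B -> `|W b - W a| <= V b - V a.
Proof.
have [n] := ubnP (count (fun i => a < lam i < b) r); elim: n a b => // n IH a b.
rewrite ltnS => cn Aa; rewrite le_eqVlt => /predU1P[->|ab] bB.
  by rewrite !subrr normr0.
have [c0|] := posnP (count (fun i => a < lam i < b) r); first exact: Abel_nojump.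
rewrite -has_count => /hasP[i ir /andP[ai ib]].
have -> : W b - W a = (W b - W (lam i)) + (W (lam i) - W a) by ring.
have -> : V b - V a = (V b - V (lam i)) + (V (lam i) - V a) by ring.
rewrite (le_trans (ler_normD _ _))// lerD// IH//; try exact: ltW.
- apply: leq_trans cn; apply: (@count_lt _ _ i) => //; rewrite ?ai ?ib ?ltxx//.
  by move=> j /andP[h ->]; rewrite (lt_trans ai).
- by rewrite (le_trans Aa)// ltW.
- apply: leq_trans cn; apply: (@count_lt _ _ i) => //; rewrite ?ai ?ib ?ltxx ?andbF//.
  by move=> j /andP[-> h]; rewrite (lt_trans h).
- by rewrite (le_trans _ bB)// ltW.
Qed.

Theorem Abel_summation : A <= B ->
  `|\sum_(i <- r | A < lam i <= B) al i * phi (lam i) - (U B - U A)| <=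
  `|S B - M B| * `|phi B| + `|S A - M A| * `|phi A| + (V B - V A).
Proof.
move=> AB; have := Abel_W (lexx A) AB (lexx B).
have E : \sum_(i <- r | A < lam i <= B) al i * phi (lam i) - (U B - U A) =
    (W B - W A) + (S B - M B) * phi B - (S A - M A) * phi A.
  have WE u : W u = \sum_(i <- r | lam i <= u) al i * phi (lam i)
      - S u * phi u - U u + M u * phi u.
    rewrite /W; congr (_ - _ + _); rewrite /S mulr_suml -sumrB.
    by apply: eq_bigr => i _; rewrite mulrBr.
  rewrite !WE.
  have -> : \sum_(i <- r | lam i <= B) al i * phi (lam i) =
      \sum_(i <- r | A < lam i <= B) al i * phi (lam i) +
      \sum_(i <- r | lam i <= A) al i * phi (lam i).
    rewrite (bigID (fun i => A < lam i))/=; congr (_ + _).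
      by apply: eq_bigl => i; rewrite andbC.
    apply: eq_bigl => i; rewrite -leNgt andb_idl// => h.
    exact: le_trans AB.
  by ring.
rewrite E => h; rewrite (le_trans (ler_normB _ _))// !normrM.
by have := ler_normD (W B - W A) ((S B - M B) * phi B); rewrite normrM; lra.
Qed.

End Abel.

(** * Beurling integers *)

Section BeurlingArithmetic.
Variables (R : realType) (G : beurling R).
Local Notation T := (cmonom (bprime G)).
Implicit Types (g h m : T) (p : bprime G).

Definition lg g : R := ln (bnorm G g).

Definition gs (x : R) : {fset T} := fset_set [set g | bnorm G g <= x].

Lemma mem_gs x g : (g \in gs x) = (bnorm G g <= x).
Proof.
rewrite in_fset_set; last exact: bnorm_finite.
by apply/idP/idP; rewrite inE.
Qed.

Lemma expcmnE g k p : expcmn g k p = (k * g p)%N.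
Proof.
rewrite /expcmn; case: k => [|k]; first by rewrite /= onecmE.
rewrite iteropS; elim: k => [|k IH]; first by rewrite mul1n.
by rewrite iterS mulcmE IH.
Qed.

Lemma expcmnS g k : expcmn g k.+1 = mmul g (expcmn g k).
Proof. by apply/eqP/cmP => p; rewrite cmM !expcmnE mulSn. Qed.

Lemma bnorm_exp g k : bnorm G (expcmn g k) = bnorm G g ^+ k.
Proof.
by elim: k => [|k IH]; [rewrite expr0 -(bnorm1 G)|rewrite expcmnS bnormM IH exprS].
Qed.

Lemma neq1_supp g : g != mone -> exists p, (0 < g p)%N.
Proof.
move=> g1; apply: contrapT => H; move/negP: g1; apply; apply/cmP => p.
rewrite cm1; apply/eqP; rewrite -leqn0 leqNgt; apply/negP => h.
by apply: H; exists p.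
Qed.

(** Otherwise the powers of [g], which are distinct, would be infinitely many elements of norm at
    most 1. *)
Lemma bnorm_gt1 g : g != mone -> 1 < bnorm G g.
Proof.
move=> g1; rewrite ltNge; apply/negP => gle.
have [p p0] := neq1_supp g1.
have := @infinite_nat; apply.
rewrite (_ : [set: nat] = expcmn g @^-1` [set h | bnorm G h <= 1]).
  apply: finite_preimage; last exact: bnorm_finite.
  move=> i j _ _ /(congr1 (fun h : T => h p)) /eqP.
  by rewrite !expcmnE eqn_pmul2r// => /eqP.
apply/seteqP; split=> // k _ /=.
by rewrite bnorm_exp exprn_ile1// ltW// bnorm_gt0.
Qed.

Lemma bnorm_ge1 g : 1 <= bnorm G g.
Proof. by have [->|/bnorm_gt1/ltW//] := eqVneq g mone; rewrite bnorm1. Qed.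

Lemma lg_ge0 g : 0 <= lg g. Proof. by rewrite ln_ge0// bnorm_ge1. Qed.

Lemma lg1 : lg mone = 0. Proof. by rewrite /lg bnorm1 ln1. Qed.

Lemma lgM g h : lg (mmul g h) = lg g + lg h.
Proof. by rewrite /lg bnormM lnM// posrE bnorm_gt0. Qed.

Lemma expR_lg g : expR (lg g) = bnorm G g.
Proof. by rewrite lnK// posrE bnorm_gt0. Qed.

Lemma lg_decomp g :
  lg g = \sum_(p <- finsupp g) (g p)%:R * lg (ucm p).
Proof.
have [n] := ubnP (mdeg g); elim: n g => // n IH g; rewrite ltnS => gn.
have [->|g1] := eqVneq g mone; first by rewrite mdom1 big_nil lg1.
have [p p0] := neq1_supp g1.
pose h := divcm g (ucm p).
have gE : g = mmul (ucm p) h.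
  apply/eqP/cmP => q; rewrite cmM divcmE ucmE.
  by case: eqVneq => [<-|_]; rewrite ?subn0// subnKC.
have hn : (mdeg h < n)%N.
  by apply: leq_trans gn; rewrite [in leqRHS]gE mdegM mdegU add1n.
have wide (m : T) (S : {fset bprime G}) : (finsupp m `<=` S)%fset ->
    \sum_(p <- finsupp m) (m p)%:R * lg (ucm p) = \sum_(p <- S) (m p)%:R * lg (ucm p).
  move=> mS; rewrite (big_fset_incl _ mS)// => q _.
  by rewrite -cmE_neq0 negbK => /eqP ->; rewrite mul0r.
rewrite [in LHS]gE lgM [lg h]IH//.
have -> : lg (ucm p) = \sum_(q <- finsupp (ucm p : T)) ((ucm p : T) q)%:R * lg (ucm q).
  by rewrite mdomU big_seq_fset1 cmUU mul1r.
rewrite (wide (ucm p) (finsupp g)); last by rewrite [in X in (_ `<=` X)%fset]gE mdomD fsubsetUl.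
rewrite (wide h (finsupp g)); last by rewrite [in X in (_ `<=` X)%fset]gE mdomD fsubsetUr.
rewrite -big_split/=; apply: eq_bigr => q _.
by rewrite [in RHS]gE cmM natrD mulrDl.
Qed.

Lemma bLambda_pow p k : (0 < k)%N -> bLambda (expcmn (ucm p) k) = lg (ucm p).
Proof.
move=> k0; apply: xget_unique; first by exists p, k.
move=> _ [q [j [j0 E ->]]].
have /(congr1 (fun h : T => h p)) := E; rewrite !expcmnE cmUU muln1 ucmE.
by case: eqVneq => [->//|_]; rewrite muln0 => k00; rewrite k00 in k0.
Qed.

Lemma bLambda_neq0 g : bLambda g != 0 ->
  exists p k, (0 < k)%N /\ g = expcmn (ucm p) k.
Proof.
rewrite /bLambda; case: xgetP => [l _ [p [k [k0 -> _]]] _|_].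
  by exists p, k.
by rewrite eqxx.
Qed.

Lemma bLambda_ge0 g : 0 <= bLambda g.
Proof.
rewrite /bLambda; case: xgetP => [l _ [p [k [k0 _ ->]]]|//].
exact: lg_ge0.
Qed.

Lemma bLambda_le g : bLambda g <= lg g.
Proof.
have [->|/bLambda_neq0[p [k [k0 ->]]]] := eqVneq (bLambda g) 0; first exact: lg_ge0.
rewrite bLambda_pow// /lg bnorm_exp lnXn ?bnorm_gt0//.
rewrite -mulr_natl ler_peMl ?ler1n//; exact: (lg_ge0 (ucm p)).
Qed.

(** [divcm] subtracts exponents with truncation at 0, so the equation holds exactly when [h] divides
    [g]. *)
Definition dvdm h g := mmul h (divcm g h) == g.

Lemma dvdm_le h g : dvdm h g -> bnorm G h <= bnorm G g.
Proof.
by move=> /eqP <-; rewrite bnormM ler_peMr ?bnorm_ge1// ltW// bnorm_gt0.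
Qed.

Lemma divcm_le h g : dvdm h g -> bnorm G (divcm g h) <= bnorm G g.
Proof.
by move=> /eqP E; rewrite -[in leRHS]E bnormM ler_peMl ?bnorm_ge1// ltW// bnorm_gt0.
Qed.

Lemma dvdmP h m g : mmul h m = g <-> dvdm h g /\ m = divcm g h.
Proof.
split=> [<-|[/eqP {2}<- ->//]].
have E : m = divcm (mmul h m) h.
  by apply/eqP/cmP => p; rewrite divcmE cmM addKn.
by split=> //; rewrite /dvdm -E.
Qed.

(** The nonzero terms belong to the prime powers [p^j] with [1 <= j <= g p], listed without
    repetition in [L]; each [p] thus yields [g p] times [log |p|]. *)
Lemma sum_Lambda x g : bnorm G g <= x ->
  \sum_(h <- gs x | dvdm h g) bLambda h = lg g.
Proof.
move=> gx.
pose L := [seq expcmn (ucm p : T) j.+1 | p <- finsupp g, j <- iota 0 (g p)].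
have inL h : h \in L -> exists p j, [/\ (0 < j)%N, (j <= g p)%N & h = expcmn (ucm p) j].
  move=> /allpairsPdep[p [j [_ + ->]]]; rewrite mem_iota add0n => /andP[_ jp].
  by exists p, j.+1.
have dL h : h \in L -> dvdm h g.
  move=> /inL[p [j [j0 jp ->]]]; apply/cmP => q; rewrite cmM divcmE expcmnE ucmE.
  by case: eqVneq => [<-|_]; rewrite ?muln1 ?muln0 ?subn0// subnKC.
have Lin h : dvdm h g -> bLambda h != 0 -> h \in L.
  move=> hg /bLambda_neq0[p [k [k0 hE]]].
  have kp : (k <= g p)%N.
    by move/eqP: hg => <-; rewrite cmM hE expcmnE cmUU muln1 leq_addr.
  apply/allpairsPdep; exists p, k.-1; split; last by rewrite prednK.
    by rewrite -cmE_neq0 -lt0n (leq_trans k0).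
  by rewrite mem_iota add0n/= prednK.
have uL : uniq L.
  apply: allpairs_uniq_dep; first exact: fset_uniq.
    by move=> p _; exact: iota_uniq.
  move=> [p j] [q k] _ _ E; have := congr1 (fun h : T => h p)
    (E : expcmn (ucm p) j.+1 = expcmn (ucm q) k.+1).
  rewrite !expcmnE cmUU muln1 ucmE; case: eqVneq => [<-|_]; last by rewrite muln0.
  by rewrite muln1 => -[->].
rewrite (bigID (fun h => h \in L))/= [X in _ + X]big1 ?addr0; last first.
  by move=> h /andP[hg hL]; apply/eqP; apply: contraNT hL; exact: Lin.
rewrite -big_filter (perm_big L); last first.
  apply: uniq_perm => //; first by rewrite filter_uniq// fset_uniq.
  move=> h; rewrite mem_filter mem_gs; have [hL|] := boolP (h \in L).
    by rewrite (dL h hL) (le_trans (dvdm_le (dL h hL))).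
  by rewrite andbF.
rewrite /L big_allpairs_dep lg_decomp; apply: eq_bigr => p _.
under eq_bigr do rewrite bLambda_pow//.
by rewrite sumr_const_seq size_iota mulr_natl.
Qed.

Lemma sum_divisors (V : nmodType) x (P : pred T) (f : T -> T -> V) :
  (forall g, P g -> bnorm G g <= x) ->
  \sum_(g <- gs x | P g) \sum_(h <- gs x | dvdm h g) f h g =
  \sum_(h <- gs x) \sum_(m <- gs x | P (mmul h m)) f h (mmul h m).
Proof.
move=> Px.
rewrite (exchange_big_dep xpredT)//=; apply: eq_bigr => h _.
rewrite -big_filter -[RHS]big_filter.
rewrite -(big_map (mmul h) xpredT (f h)).
apply: perm_big; apply: uniq_perm.
- by rewrite filter_uniq// fset_uniq.
- rewrite map_inj_uniq ?filter_uniq ?fset_uniq// => m1 m2 E.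
  have [_ ->] := (dvdmP h m1 _).1 E; have [_ {2}->] := (dvdmP h m2 _).1 erefl.
  by [].
move=> g; rewrite mem_filter; apply/idP/mapP.
  move=> /andP[/andP[Pg hg] gx]; have E := eqP hg.
  exists (divcm g h) => //; rewrite mem_filter E Pg/= mem_gs.
  by rewrite (le_trans (divcm_le hg))// Px.
move=> [m]; rewrite mem_filter mem_gs => /andP[Pm mx] gE.
have [hg _] := (dvdmP h m g).1 (esym gE).
by rewrite hg gE Pm/= mem_gs Px.
Qed.

End BeurlingArithmetic.

(** * Dirichlet series *)

Section DirichletSums.
Variables (R : realType) (G : beurling R).
Local Notation T := (cmonom (bprime G)).
Implicit Types (g h m : T) (a b : T -> R[i]).

Definition npow (sg : R) g : R := expR (- sg * lg g).

Lemma npow_ge0 sg g : 0 <= npow sg g. Proof. exact: expR_ge0. Qed.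

(** Summation in the order of the norm, which is the order suited to partial summation; [zeta_dlim]
    passes to it from the unconditional convergence in [is_zeta]. *)
Definition dlim a (l : R[i]) := forall e : R, 0 < e -> exists x0, forall x,
  x0 <= x -> nc (\sum_(g <- gs G x) a g - l) <= e.

Definition rdlim (b : T -> R) (l : R) := forall e : R, 0 < e -> exists x0, forall x,
  x0 <= x -> `|\sum_(g <- gs G x) b g - l| <= e.

Lemma sum_gs_split (V : nmodType) (f : T -> V) x y : x <= y ->
  \sum_(g <- gs G y) f g =
  \sum_(g <- gs G x) f g + \sum_(g <- gs G y | x < bnorm G g) f g.
Proof.
move=> xy; rewrite (bigID (fun g => bnorm G g <= x))/=; congr (_ + _); last first.
  by apply: eq_bigl => g; rewrite ltNge.
rewrite -big_filter; apply: perm_big; apply: uniq_perm.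
- by rewrite filter_uniq// fset_uniq.
- exact: fset_uniq.
move=> g; rewrite mem_filter !mem_gs andb_idr// => /le_trans; exact.
Qed.

Lemma rdlim_exists (b : T -> R) (B : R) : (forall g, 0 <= b g) ->
  (forall x, \sum_(g <- gs G x) b g <= B) -> exists l, rdlim b l.
Proof.
move=> b0 bB; pose A := range (fun x => \sum_(g <- gs G x) b g).
have sA : has_sup A.
  by split; [exists (\sum_(g <- gs G 0) b g); exists 0|exists B => _ [x _ <-]].
exists (sup A) => e e0; have [_ [x0 _ <-] hx0] := sup_adherent e0 sA.
exists x0 => x xx0.
have h1 : \sum_(g <- gs G x0) b g <= \sum_(g <- gs G x) b g.
  by rewrite (sum_gs_split _ xx0) lerDl sumr_ge0.
have h2 : \sum_(g <- gs G x) b g <= sup A.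
  by apply: ub_le_sup; [case: sA|exists x].
by rewrite ler_norml; lra.
Qed.

Lemma dlim_ext a b l : a =1 b -> dlim a l -> dlim b l.
Proof. by move=> /funext ->. Qed.

Lemma dlim_unique a l l' : dlim a l -> dlim a l' -> l = l'.
Proof.
move=> h h'; apply/eqP; rewrite -subr_eq0 -nc_eq0 eq_le nc_ge0 andbT.
apply/ler_addgt0Pr => e e0; rewrite add0r.
have e2 : 0 < e / 2 by rewrite divr_gt0.
have [x hx] := h _ e2; have [x' hx'] := h' _ e2.
have := hx (Num.max x x'); have := hx' (Num.max x x').
rewrite !le_max !lexx orbT => /(_ isT) k1 /(_ isT) k2.
set S := \sum_(g <- _) _ in k1 k2.
have -> : l - l' = (S - l') - (S - l) by ring.
by apply: (le_trans (ncB _ _)); lra.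
Qed.

Lemma dlimD a b l l' : dlim a l -> dlim b l' -> dlim (fun g => a g + b g) (l + l').
Proof.
move=> h h' e e0; have e2 : 0 < e / 2 by rewrite divr_gt0.
have [x hx] := h _ e2; have [x' hx'] := h' _ e2.
exists (Num.max x x') => y; rewrite ge_max => /andP[/hx k1 /hx' k2].
rewrite big_split/= opprD addrACA (le_trans (ncD _ _))//; lra.
Qed.

Lemma dlimZ (c : R[i]) a l : dlim a l -> dlim (fun g => c * a g) (c * l).
Proof.
move=> h e e0; have c0 : 0 < nc c + 1 by rewrite ltr_wpDl ?nc_ge0.
have [|x hx] := h (e / (nc c + 1)); first by rewrite divr_gt0.
exists x => y /hx k; rewrite -mulr_sumr -mulrBr ncM.
apply: (@le_trans _ _ ((nc c + 1) * (e / (nc c + 1)))).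
  by rewrite ler_pM ?nc_ge0// lerDl.
by rewrite mulrC divfK// gt_eqF.
Qed.

Lemma dlim0 : dlim (fun=> 0) 0.
Proof. by move=> e e0; exists 0 => x _; rewrite big1// subrr nc0 ltW. Qed.

Lemma dlim_sum n (a : nat -> T -> R[i]) (l : nat -> R[i]) :
  (forall k, dlim (a k) (l k)) ->
  dlim (fun g => \sum_(k < n) a k g) (\sum_(k < n) l k).
Proof.
move=> h; elim: n => [|n IH].
  by rewrite big_ord0; apply: dlim_ext dlim0 => g; rewrite big_ord0.
rewrite big_ord_recr/=; apply: dlim_ext (dlimD IH (h n)) => g.
by rewrite big_ord_recr.
Qed.

Lemma dlim_le a l (B x0 : R) : dlim a l ->
  (forall x, x0 <= x -> nc (\sum_(g <- gs G x) a g) <= B) -> nc l <= B.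
Proof.
move=> h hB; apply/ler_addgt0Pr => e e0; have [x hx] := h _ e0.
have := hx (Num.max x x0); have := hB (Num.max x x0).
rewrite !le_max !lexx orbT => /(_ isT) k1 /(_ isT).
set S := \sum_(g <- _) _ in k1 * => k2.
have -> : l = S - (S - l) by ring.
by apply: (le_trans (ncB _ _)); lra.
Qed.

Lemma dlim_Re_ge0 a l : dlim a l -> (forall g, 0 <= complex.Re (a g)) ->
  0 <= complex.Re l.
Proof.
move=> h a0; apply/ler_addgt0Pr => e e0; have [x hx] := h _ e0.
have := le_trans (nc_Re _) (hx x (lexx _)).
rewrite cReD cReN cRe_sum ler_norml => /andP[_].
have : 0 <= \sum_(g <- gs G x) complex.Re (a g) by rewrite sumr_ge0.
lra.
Qed.

Variables (theta : R) (F : R[i] -> R[i]).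
Hypothesis zF : is_zeta G theta F.

Lemma cpow_cE g (s : R[i]) : cpow (bnorm G g) (- s) = cE s (lg g).
Proof.
rewrite /cpow /cE /powR gt_eqF ?bnorm_gt0// -/(lg g).
case: s => x y /=; congr Complex; first by rewrite !mulNr cosN.
by rewrite !mulNr sinN mulrN.
Qed.

Lemma zeta_sum (s : R[i]) : 1 < complex.Re s -> forall e : R, 0 < e ->
  exists J0 : {fset T}, forall J : {fset T}, (J0 `<=` J)%fset ->
  nc (\sum_(g <- J) cE s (lg g) - F s) <= e.
Proof.
move=> s1 e e0; have [h _ _] := zF.
have /cvgrPdist_lt hl := h s s1.
have e0' : 0 < e%:C%C by rewrite ltcR.
have [|J0 _ hJ] := hl _ _ e0'; first exact: (@filter_filter _ _ summability.totally_filter).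
exists J0 => J J0J.
have := hJ J J0J; rewrite /summability.partial_sum /=.
rewrite -(big_seq_fsetE _ J predT (fun g => cpow (bnorm G g) (- s)))/=.
under eq_bigr do rewrite cpow_cE.
move=> hh; rewrite ncBC; apply: ltW.
by move: hh; rewrite -ltcR.
Qed.

Lemma zeta_dlim (s : R[i]) : 1 < complex.Re s ->
  dlim (fun g => cE s (lg g)) (F s).
Proof.
move=> s1 e e0; have [J0 hJ] := zeta_sum s1 e0.
exists (\sum_(g <- J0) bnorm G g) => x hx; apply: hJ.
apply/fsubsetP => g gJ; rewrite mem_gs (le_trans _ hx)//.
rewrite (big_rem _ gJ)/= lerDl sumr_ge0// => h _.
by rewrite ltW// bnorm_gt0.
Qed.

Definition zr (sg : R) : R := complex.Re (F sg%:C%C).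

Lemma cE_real (sg u : R) : cE sg%:C%C u = (expR (- sg * u))%:C%C.
Proof. by rewrite /cE /= mul0r cos0 sin0 mulr1 mulr0 oppr0. Qed.

Lemma sum_npow_le sg (J : {fset T}) : 1 < sg -> \sum_(g <- J) npow sg g <= zr sg.
Proof.
move=> s1; apply/ler_addgt0Pr => e e0.
have [J0 /(_ (J `|` J0)%fset)] := @zeta_sum sg%:C%C s1 e e0.
rewrite fsubsetUr => /(_ isT) /(le_trans (nc_Re _)).
rewrite cReD cReN cRe_sum -/(zr sg) ler_norml.
under eq_bigr do rewrite cE_real /=.
move=> /andP[_ h].
have : \sum_(g <- J) npow sg g <= \sum_(g <- (J `|` J0)%fset) npow sg g.
  rewrite [leRHS](big_fsetID _ (mem J))/=.
  rewrite (_ : [fset x | x in (J `|` J0)%fset & mem J x]%fset = J).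
    by rewrite lerDl sumr_ge0// => g _; exact: npow_ge0.
  by apply/fsetP => g; rewrite !inE; case: (g \in J); rewrite ?andbT ?andbF.
by move: h; rewrite /npow; lra.
Qed.

Lemma tail_npow sg e : 1 < sg -> 0 < e -> exists x0 : R, forall x y, x0 <= x ->
  x <= y -> \sum_(g <- gs G y | x < bnorm G g) npow sg g <= e.
Proof.
move=> s1 e0; have [||l hl] := @rdlim_exists (npow sg) (zr sg).
- by move=> g; exact: npow_ge0.
- by move=> x; exact: sum_npow_le.
have [|x0 hx0] := hl (e / 2); first by rewrite divr_gt0.
exists x0 => x y xx0 xy; have := hx0 x xx0; have := hx0 y (le_trans xx0 xy).
by rewrite (sum_gs_split _ xy) !ler_norml; lra.
Qed.

Definition dominated (K sg : R) a := forall g, nc (a g) <= K * npow sg g.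

(** Real and imaginary parts become nonnegative after the majorant is added, so that suprema of
    partial sums provide the limits. *)
Lemma dominated_exists K sg a : 1 < sg -> dominated K sg a -> exists l, dlim a l.
Proof.
move=> s1 aK.
have [||lK hK] := @rdlim_exists (fun g => K * npow sg g) (K * zr sg).
- by move=> g; apply: le_trans (nc_ge0 _) (aK g).
- have [K0|K0] := leP 0 K.
    by move=> x; rewrite -mulr_sumr ler_wpM2l// sum_npow_le.
  have := aK mone; rewrite leNgt (lt_le_trans _ (nc_ge0 _))//.
  by rewrite pmulr_llt0// expR_gt0.
have part (c : T -> R) : (forall g, `|c g| <= nc (a g)) -> exists l, rdlim c l.
  move=> ca.
  have [||l hl] := @rdlim_exists (fun g => c g + K * npow sg g) (2 * (K * zr sg)).
  - move=> g; have := ca g; have := aK g; rewrite ler_norml; lra.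
  - move=> x; apply: (@le_trans _ _ (\sum_(g <- gs G x) (2 * (K * npow sg g)))).
      apply: ler_sum => g _; have := ca g; have := aK g; rewrite ler_norml; lra.
    rewrite -!mulr_sumr !ler_wpM2l ?sum_npow_le//.
    have := le_trans (nc_ge0 _) (aK mone); rewrite pmulr_lge0// expR_gt0//.
  exists (l - lK) => e e0; have e2 : 0 < e / 2 by rewrite divr_gt0.
  have [x1 h1] := hl _ e2; have [x2 h2] := hK _ e2.
  exists (Num.max x1 x2) => x; rewrite ge_max => /andP[/h1 k1 /h2 k2].
  by move: k1 k2; rewrite big_split/= !ler_norml; lra.
have [l1 h1] := part _ (fun g => nc_Re (a g)).
have [l2 h2] := part _ (fun g => nc_Im (a g)).
exists (Complex l1 l2) => e e0; have e2 : 0 < e / 2 by rewrite divr_gt0.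
have [x1 k1] := h1 _ e2; have [x2 k2] := h2 _ e2.
exists (Num.max x1 x2) => x; rewrite ge_max => /andP[/k1 m1 /k2 m2].
apply: le_trans (nc_ReIm _) _.
rewrite !(cReD, cImD, cReN, cImN, cRe_sum, cIm_sum) /=; lra.
Qed.

(** The cut-off depends only on the majorant. This uniformity allows the limit in the order of a
    Taylor polynomial to be interchanged with the sum over [g]. *)
Lemma dlim_uniform K sg e : 1 < sg -> 0 < e -> exists x0 : R, forall a l,
  dominated K sg a -> dlim a l -> forall x, x0 <= x ->
  nc (\sum_(g <- gs G x) a g - l) <= e.
Proof.
move=> s1 e0; have K0 : 0 < `|K| + 1 by rewrite ltr_wpDl.
have [|x0 hx0] := @tail_npow sg (e / (`|K| + 1)) s1; first by rewrite divr_gt0.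
exists x0 => a l aK al x xx0; apply/ler_addgt0Pr => e' e'0.
have [x1 hx1] := al _ e'0; pose y := Num.max x x1.
have xy : x <= y by rewrite le_max lexx.
have := hx1 y; rewrite le_max lexx orbT => /(_ isT).
rewrite (sum_gs_split _ xy); set S := \sum_(g <- gs G x) a g.
set D := \sum_(g <- gs G y | _) _ => h.
have hD : nc D <= e.
  rewrite (le_trans (nc_sum _ _ _))//.
  apply: (@le_trans _ _ (\sum_(g <- gs G y | x < bnorm G g) (`|K| + 1) * npow sg g)).
    apply: ler_sum => g _; apply: (le_trans (aK g)).
    rewrite ler_wpM2r ?npow_ge0// (le_trans (ler_norm _))// lerDl//.
  rewrite -mulr_sumr; apply: (le_trans (ler_wpM2l (ltW K0) (hx0 x y xx0 xy))).
  by rewrite mulrC divfK// gt_eqF.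
have -> : S - l = (S + D - l) - D by ring.
by apply: (le_trans (ncB _ _)); lra.
Qed.

Lemma ph_dominated k (s : R[i]) eta : 0 < eta ->
  dominated (eta ^- k) (complex.Re s - eta) (fun g => ph k s (lg g)).
Proof.
move=> eta0 g; rewrite nc_phE ?lg_ge0//.
rewrite (_ : phR _ _ _ = phR k eta (lg g) * npow (complex.Re s - eta) g).
  by rewrite ler_wpM2r ?npow_ge0// phR_le// lg_ge0.
by rewrite /phR /npow -[in RHS]mulrA -expRD; congr (_ * expR _); ring.
Qed.

Lemma lg_ph k s g : (lg g)%:C%C * ph k s (lg g) = ph k.+1 s (lg g) *+ k.+1.
Proof.
rewrite /ph mulrA -mulrnAl; congr (_ * _).
rewrite -(rmorphM (real_complex R)) -(rmorphMn (real_complex R)); congr (_ %:C%C).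
rewrite factS natrM exprS -mulr_natr.
by field; rewrite ?nat1r !pnatr_eq0 -!lt0n ?fact_gt0.
Qed.

Lemma Lph_dominated k (s : R[i]) eta : 0 < eta ->
  dominated (k.+1%:R * eta ^- k.+1) (complex.Re s - eta)
    (fun g => (bLambda g)%:C%C * ph k s (lg g)).
Proof.
move=> eta0 g; apply: (@le_trans _ _ (nc ((lg g)%:C%C * ph k s (lg g)))).
  rewrite !(ncM _ (ph k s (lg g))) !ncR ler_wpM2r ?nc_ge0// !ger0_norm ?lg_ge0 ?bLambda_ge0//.
  exact: bLambda_le.
rewrite lg_ph -[X in nc X]mulr_natl ncM nc_nat -mulrA ler_wpM2l//.
exact: ph_dominated.
Qed.

(* As functions of z, F (s - z) and its logarithmic derivative have the Taylor
   coefficients Cz k s and Bz k s at 0. *)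
Definition Cz k s : R[i] := xget 0 [set l | dlim (fun g => ph k s (lg g)) l].
Definition Bz k s : R[i] :=
  xget 0 [set l | dlim (fun g => (bLambda g)%:C%C * ph k s (lg g)) l].

Section halfplane.
Variable s : R[i].
Hypothesis s1 : 1 < complex.Re s.

Let eta := (complex.Re s - 1) / 2.
Let eta0 : 0 < eta. Proof. by rewrite divr_gt0// subr_gt0. Qed.
Let se : 1 < complex.Re s - eta. Proof. by have := s1; rewrite /eta; lra. Qed.

Lemma CzP k : dlim (fun g => ph k s (lg g)) (Cz k s).
Proof.
have [l hl] := dominated_exists se (ph_dominated k s eta0).
exact: (@xgetPex _ 0 [set l | dlim (fun g => ph k s (lg g)) l] (ex_intro _ l hl)).
Qed.

Lemma BzP k : dlim (fun g => (bLambda g)%:C%C * ph k s (lg g)) (Bz k s).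
Proof.
have [l hl] := dominated_exists se (Lph_dominated k s eta0).
exact: (@xgetPex _ 0 [set l | dlim _ l] (ex_intro _ l hl)).
Qed.

Lemma Cz0 : Cz 0 s = F s.
Proof.
apply: (dlim_unique (CzP 0)); apply: dlim_ext (zeta_dlim s1) => g.
by rewrite /ph expr0 fact0 divr1 mul1r.
Qed.

End halfplane.

End DirichletSums.

(** * Taylor expansion of zeta and its logarithmic derivative *)

Section ExponentialSeries.
Variable R : realType.
Implicit Types (w z : R[i]) (u x : R).

Lemma cderD (f g : R -> R[i]) u D D' : cder f u D -> cder g u D' ->
  cder (fun t => f t + g t) u (D + D').
Proof.
move=> hf hg; have := cderB hf (cderMl (-1) hg).
rewrite (_ : (fun t => _) = (fun t => f t + g t)); last first.
  by apply/funext => t; rewrite mulN1r opprK.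
by rewrite mulN1r opprK.
Qed.

Lemma cder_exp_partial z K u :
  cder (fun t => \sum_(k < K.+1) z ^+ k * ph k z t) u (- z ^+ K.+1 * ph K z u).
Proof.
elim: K => [|K IH].
  rewrite (_ : (fun t => _) = ph 0 z).
    by apply: (cder_eq (cder_ph 0 z u)); rewrite /ph' sub0r expr1 mulNr.
  by apply/funext => t; rewrite big_ord1 expr0 mul1r.
rewrite (_ : (fun t => _) = (fun t => \sum_(k < K.+1) z ^+ k * ph k z t +
    z ^+ K.+1 * ph K.+1 z t)); last first.
  by apply/funext => t; rewrite big_ord_recr.
apply: (cder_eq (cderD IH (cderMl _ (cder_ph K.+1 z u)))).
by rewrite /ph' [z ^+ K.+2]exprSr; ring.
Qed.

Lemma exp_coeff_half x K : 0 <= x -> x ^+ K / K`!%:R <= expR (2 * x) * 2^-1 ^+ K.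
Proof.
move=> x0; rewrite exprVn ler_pdivlMr ?exprn_gt0//.
have -> : x ^+ K / K`!%:R * 2 ^+ K = (2 * x) ^+ K / K`!%:R by rewrite exprMn; ring.
by apply: expR_ge_coeff; rewrite mulr_ge0.
Qed.

Lemma cder_norm_le (f : R -> R[i]) (D : R -> R[i]) (a b M : R) : a <= b ->
  (forall t, a <= t <= b -> cder f t (D t)) ->
  (forall t, a <= t <= b -> nc (D t) <= M) -> nc (f b - f a) <= 2 * (M * (b - a)).
Proof.
move=> ab fD DM; apply: le_trans (nc_ReIm _) _.
rewrite !(cReD, cImD, cReN, cImN) mulr_natl mulr2n lerD//.
  apply: (@MVT_norm_le R (fun t => complex.Re (f t)) (fun t => complex.Re (D t))) => //.
    by move=> t /fD[].
  by move=> t /DM; apply: le_trans; exact: nc_Re.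
apply: (@MVT_norm_le R (fun t => complex.Im (f t)) (fun t => complex.Im (D t))) => //.
  by move=> t /fD[].
by move=> t /DM; apply: le_trans; exact: nc_Im.
Qed.

(** The partial sum at [t] times [e^(-z t)] has the telescoping derivative
    [- z^(K+1) t^K / K! e^(-z t)], and [x^K / K! <= e^(2 x) 2^-K]. *)
Lemma exp_partial_le z u K : 0 <= u ->
  nc (\sum_(k < K.+1) z ^+ k * (u ^+ k / k`!%:R)%:C%C - cE (- z) u) <=
  2 * (nc z * u) * expR (4 * (nc z * u)) * 2^-1 ^+ K.
Proof.
move=> u0; pose x := nc z * u; have x0 : 0 <= x by rewrite mulr_ge0 ?nc_ge0.
pose f t := \sum_(k < K.+1) z ^+ k * ph k z t.
have fu : \sum_(k < K.+1) z ^+ k * (u ^+ k / k`!%:R)%:C%C - cE (- z) u =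
    (f u - f 0) * cE (- z) u.
  have zz : cE z u * cE (- z) u = 1.
    by rewrite -cE_D subrr /cE /= oppr0 !mul0r expR0 cos0 sin0 mulr1 mulr0 oppr0.
  have f0 : f 0 = 1.
    rewrite /f big_ord_recl big1 => [|i _]; rewrite /ph cE0 !mulr1.
      by rewrite !expr0 fact0 divr1 mul1r addr0.
    by rewrite expr0n/= mul0r mulr0.
  rewrite f0 mulrBl mul1r; congr (_ - _); rewrite /f mulr_suml.
  by apply: eq_bigr => k _; rewrite /ph -!mulrA zz mulr1.
rewrite fu ncM nc_cE cReN opprK.
have e1 : expR (complex.Re z * u) <= expR x.
  by rewrite ler_expR ler_wpM2r// Re_le_nc.
have h : nc (f u - f 0) <= 2 * ((nc z ^+ K.+1 * (u ^+ K / K`!%:R) * expR x) * (u - 0)).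
  apply: (@cder_norm_le f (fun t => - z ^+ K.+1 * ph K z t)) => //.
    by move=> t _; exact: cder_exp_partial.
  move=> t /andP[t0 tu]; rewrite ncM ncN ncX nc_ph// -[leRHS]mulrA.
  rewrite ler_wpM2l ?exprn_ge0 ?nc_ge0// ler_pM ?expR_ge0//.
  - by rewrite divr_ge0 ?exprn_ge0.
  - by rewrite ler_wpM2r ?invr_ge0// lerXn2r.
  rewrite ler_expR (@le_trans _ _ (nc z * t))//; last by rewrite ler_wpM2l ?nc_ge0.
  by rewrite ler_wpM2r// (le_trans (ler_norm _))// normrN nc_Re.
apply: (le_trans (ler_pM (nc_ge0 _) (expR_ge0 _) h e1)).
have -> : 2 * ((nc z ^+ K.+1 * (u ^+ K / K`!%:R) * expR x) * (u - 0)) * expR x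
    = 2 * x * (expR x * expR x) * (x ^+ K / K`!%:R).
  by rewrite /x exprMn exprS subr0; ring.
have -> : 2 * (nc z * u) * expR (4 * (nc z * u)) * 2^-1 ^+ K =
    2 * x * (expR x * expR x) * (expR (2 * x) * 2^-1 ^+ K).
  rewrite -/x (_ : 4 * x = x + x + 2 * x); last by ring.
  by rewrite !expRD; ring.
have q0 : 0 <= expR x * expR x by rewrite mulr_ge0 ?expR_ge0.
have q1 : 0 <= 2 * x by rewrite mulr_ge0.
by apply: ler_wpM2l (exp_coeff_half K x0); exact: mulr_ge0.
Qed.

Lemma half_pow_lim (A e : R) : 0 < e -> exists K0, forall K, (K0 <= K)%N ->
  A * 2^-1 ^+ K <= e.
Proof.
move=> e0; have A0 : 0 < `|A| + 1 by rewrite ltr_wpDl.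
have /cvgrPdist_lt/(_ (e / (`|A| + 1)))[] : (2^-1 : R) ^+ n @[n --> \oo] --> 0.
  by apply: cvg_expr; rewrite ger0_norm; lra.
  by rewrite divr_gt0.
move=> K0 _ h; exists K0 => K /h; rewrite /= sub0r normrN ger0_norm ?exprn_ge0//.
rewrite ltr_pdivlMr// => hh.
apply: le_trans (ltW hh); rewrite mulrC ler_wpM2l ?exprn_ge0//.
by rewrite (le_trans (ler_norm _))// lerDl.
Qed.

Lemma exp_sum_le x K : 0 <= x -> \sum_(k < K) x ^+ k / k`!%:R <= expR x.
Proof.
move=> x0; have : series (exp_coeff x) K <= expR x.
  apply: nondecreasing_cvgn_le; last exact: is_cvg_series_exp_coeff.
  by apply/nondecreasing_seqP => k; rewrite seriesSr lerDl exp_coeff_ge0.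
by rewrite /series/= big_mkord.
Qed.

End ExponentialSeries.

Section ZetaTaylor.
Variables (R : realType) (G : beurling R).
Local Notation T := (cmonom (bprime G)).
Variables (theta : R) (F : R[i] -> R[i]).
Hypothesis zF : is_zeta G theta F.

(** Each [|g|^z] is expanded in its exponential series. All partial sums are dominated by [|g|^|z|],
    so the sum over [g] can be cut off uniformly in [K], and finitely many exponential series
    remain. *)
Theorem zeta_Taylor (s z : R[i]) : 1 < complex.Re s - nc z ->
  forall e : R, 0 < e -> exists K0, forall K, (K0 <= K)%N ->
  nc (F (s - z) - \sum_(k < K) Cz G k s * z ^+ k) <= e.
Proof.
move=> sz e e0.
have s1 : 1 < complex.Re s by have := nc_ge0 z; lra.
have sz1 : 1 < complex.Re (s - z) by rewrite cReD cReN; have := Re_le_nc z; lra.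
have e3 : 0 < e / 3 by rewrite divr_gt0.
have [x0 hx0] := dlim_uniform zF 1 sz e3.
pose A K (g : T) := \sum_(k < K) z ^+ k * ph k s (lg g).
have Adom K : dominated 1 (complex.Re s - nc z) (A K).
  move=> g; rewrite mul1r (le_trans (nc_sum _ _ _))//.
  apply: (@le_trans _ _ (\sum_(k < K) (nc z * lg g) ^+ k / k`!%:R * expR (- complex.Re s * lg g))).
    apply: ler_sum => k _; rewrite ncM ncX nc_ph ?lg_ge0//.
    by rewrite exprMn -!mulrA.
  rewrite -mulr_suml /npow opprB mulrBl expRD -mulNr ler_wpM2r ?expR_ge0//.
  by rewrite exp_sum_le// mulr_ge0 ?nc_ge0 ?lg_ge0.
have Alim K : dlim (A K) (\sum_(k < K) Cz G k s * z ^+ k).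
  rewrite (eq_bigr (fun k : 'I_K => z ^+ k * Cz G k s)); last by move=> k _; rewrite mulrC.
  apply: (@dlim_sum _ _ K (fun k g => z ^+ k * ph k s (lg g)) (fun k => z ^+ k * Cz G k s)).
  by move=> k; apply: dlimZ; exact: (CzP zF s1).
have Fdom : dominated 1 (complex.Re s - nc z) (fun g : T => cE (s - z) (lg g)).
  move=> g; rewrite mul1r nc_cE /npow ler_expR ler_wpM2r ?lg_ge0//.
  by rewrite cReD cReN; have := Re_le_nc z; lra.
have h1 := hx0 _ _ Fdom (zeta_dlim zF sz1) x0 (lexx _).
suff [K0 hK] : exists K0, forall K, (K0 <= K)%N ->
    nc (\sum_(g <- gs G x0) A K g - \sum_(g <- gs G x0) cE (s - z) (lg g)) <= e / 3.
  exists K0 => K /hK k1; have k2 := hx0 _ _ (Adom K) (Alim K) x0 (lexx _).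
  move: h1 k1 k2; set S1 := \sum_(g <- _) _; set S2 := \sum_(g <- _) _ => h1 k1 k2.
  rewrite (_ : F (s - z) - _ = (S1 - \sum_(k < K) Cz G k s * z ^+ k)
    - (S2 - F (s - z)) - (S1 - S2)); last by ring.
  apply: (le_trans (ncB _ _)); apply: (le_trans (lerD (ncB _ _) (lexx _))); lra.
elim: (gs G x0 : seq T) (e / 3) e3 => [|g r IH] d d0.
  by exists 0%N => K _; rewrite !big_nil subrr nc0 ltW.
have d2 : 0 < d / 2 by rewrite divr_gt0.
have [K1 h2] := IH _ d2.
have [K2 h3] := @half_pow_lim R (2 * (nc z * lg g) * expR (4 * (nc z * lg g)) *
  nc (cE s (lg g))) (d / 2) d2.
exists (maxn K1 K2.+1) => K; rewrite geq_max => /andP[/h2 k1].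
case: K => [//|K] in k1 *; rewrite ltnS => /h3 k2.
rewrite !big_cons opprD addrACA (le_trans (ncD _ _))//.
suff : nc (A K.+1 g - cE (s - z) (lg g)) <= d / 2 by lra.
apply: le_trans k2; rewrite /A cE_D.
have -> : \sum_(k < K.+1) z ^+ k * ph k s (lg g) - cE s (lg g) * cE (- z) (lg g) =
   (\sum_(k < K.+1) z ^+ k * (lg g ^+ k / k`!%:R)%:C%C - cE (- z) (lg g)) * cE s (lg g).
  rewrite mulrBl mulr_suml; congr (_ - _); last exact: mulrC.
  by apply: eq_bigr => k _; rewrite -mulrA.
rewrite ncM mulrAC ler_wpM2r ?nc_ge0//.
by apply: exp_partial_le; exact: lg_ge0.
Qed.

Definition slim (u : R -> R[i]) (l : R[i]) := forall e : R, 0 < e ->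
  exists x0, forall x, x0 <= x -> nc (u x - l) <= e.

Lemma slimM u v l l' : slim u l -> slim v l' -> slim (fun x => u x * v x) (l * l').
Proof.
move=> hu hv e e0.
pose K := nc l + nc l' + 1.
have K0 : 0 < K by rewrite /K ltr_wpDl ?addr_ge0 ?nc_ge0.
pose e' := Num.min 1 (e / (2 * K)).
have e'0 : 0 < e' by rewrite lt_min ltr01 divr_gt0 ?mulr_gt0.
have [x1 h1] := hu _ e'0; have [x2 h2] := hv _ e'0.
exists (Num.max x1 x2) => x; rewrite ge_max => /andP[/h1 k1 /h2 k2].
have -> : u x * v x - l * l' =
  (u x - l) * (v x - l') + ((u x - l) * l' + l * (v x - l')) by ring.
have le1 : e' <= 1 by rewrite ge_min lexx.
have leK : e' * (2 * K) <= e by rewrite -ler_pdivlMr ?mulr_gt0// ge_min lexx orbT.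
have a1 := nc_ge0 (u x - l); have a2 := nc_ge0 (v x - l').
rewrite (le_trans (ncD _ _))// (le_trans (lerD (lexx _) (ncD _ _)))// !ncM.
have p1 : nc (u x - l) * nc (v x - l') <= e' * 1 by rewrite ler_pM// (le_trans k2).
have p2 : nc (u x - l) * nc l' <= e' * nc l' by rewrite ler_wpM2r ?nc_ge0.
have p3 : nc l * nc (v x - l') <= nc l * e' by rewrite ler_wpM2l ?nc_ge0.
by move: leK; rewrite /K; lra.
Qed.

Lemma slimD u v l l' : slim u l -> slim v l' -> slim (fun x => u x + v x) (l + l').
Proof.
move=> h h' e e0; have e2 : 0 < e / 2 by rewrite divr_gt0.
have [x hx] := h _ e2; have [x' hx'] := h' _ e2.
exists (Num.max x x') => y; rewrite ge_max => /andP[/hx k1 /hx' k2].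
rewrite opprD addrACA (le_trans (ncD _ _))//; lra.
Qed.

Lemma slim_sum n (u : nat -> R -> R[i]) (l : nat -> R[i]) :
  (forall k, slim (u k) (l k)) ->
  slim (fun x => \sum_(k < n) u k x) (\sum_(k < n) l k).
Proof.
move=> h; elim: n => [|n IH].
  by move=> e e0; exists 0 => x _; rewrite !big_ord0 subrr nc0 ltW.
rewrite (_ : (fun x => _) = (fun x => \sum_(k < n) u k x + u n x)); last first.
  by apply/funext => x; rewrite big_ord_recr.
by rewrite big_ord_recr; exact: slimD.
Qed.

Lemma slim_unique u l l' : slim u l -> slim u l' -> l = l'.
Proof.
move=> h h'; apply/eqP; rewrite -subr_eq0 -nc_eq0 eq_le nc_ge0 andbT.
apply/ler_addgt0Pr => e e0; rewrite add0r.
have e2 : 0 < e / 2 by rewrite divr_gt0.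
have [x hx] := h _ e2; have [x' hx'] := h' _ e2.
have := hx (Num.max x x'); have := hx' (Num.max x x').
rewrite !le_max !lexx orbT => /(_ isT) k1 /(_ isT) k2.
have -> : l - l' = (u (Num.max x x') - l') - (u (Num.max x x') - l) by ring.
by apply: (le_trans (ncB _ _)); lra.
Qed.

Lemma ph_add k (s : R[i]) (u v : R) :
  ph k s (u + v) = \sum_(i < k.+1) ph i s v * ph (k - i) s u.
Proof.
rewrite /ph cE_Dr; transitivity ((\sum_(i < k.+1)
  (v ^+ i / i`!%:R)%:C%C * (u ^+ (k - i) / (k - i)`!%:R)%:C%C) * (cE s u * cE s v)); last first.
  by rewrite mulr_suml; apply: eq_bigr => i _; ring.
congr (_ * _); under eq_bigr do rewrite -(rmorphM (real_complex R)).
rewrite -(rmorph_sum (real_complex R)); congr (_ %:C%C).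
rewrite exprDn mulr_suml; apply: eq_bigr => i _.
rewrite -mulr_natr; have ik : (i <= k)%N by rewrite -ltnS.
have := bin_fact ik => /(congr1 (fun n : nat => n%:R : R)); rewrite !natrM => <-.
by field; rewrite !pnatr_eq0 -!lt0n !fact_gt0 bin_gt0 ik.
Qed.

(** The coefficient form of [f' = f * (f' / f)] for [f z = F (s - z)]. It comes from writing
    [log |g|] as the sum of [Lambda h] over [g = h m] and from the binomial theorem for
    [log |h| + log |m|]; truncated products differ from truncated sums only by pairs with
    [|h m| > x]. *)
Theorem Cz_recurrence (s : R[i]) k : 1 < complex.Re s ->
  Cz G k.+1 s *+ k.+1 = \sum_(i < k.+1) Cz G i s * Bz G (k - i) s.
Proof.
move=> s1; pose a (g : T) := (lg g)%:C%C * ph k s (lg g).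
have alim : slim (fun x => \sum_(g <- gs G x) a g) (Cz G k.+1 s *+ k.+1).
  rewrite -mulr_natl; apply: dlim_ext (dlimZ k.+1%:R (CzP zF s1 k.+1)) => g.
  by rewrite /a lg_ph mulr_natl.
have Plim := @slim_sum k.+1 (fun i x => (\sum_(m <- gs G x) ph i s (lg m)) *
  (\sum_(h <- gs G x) (bLambda h)%:C%C * ph (k - i) s (lg h)))
  (fun i => Cz G i s * Bz G (k - i) s)
  (fun i => slimM (CzP zF s1 i) (BzP zF s1 (k - i))).
apply: (slim_unique alim) => e e0.
pose eta := (complex.Re s - 1) / 2.
have eta0 : 0 < eta by rewrite divr_gt0// subr_gt0.
have se : 1 < complex.Re s - eta by rewrite /eta; lra.
pose Kc := k.+1%:R * eta ^- k.+1.
have Kc0 : 0 < Kc by rewrite mulr_gt0 ?invr_gt0 ?exprn_gt0.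
have [|x1 tail] := @tail_npow _ _ _ _ zF _ (e / 2 / Kc) se; first by rewrite divr_gt0// divr_gt0.
have e2 : 0 < e / 2 by rewrite divr_gt0.
have [x2 hP] := Plim _ e2.
exists (Num.max 1 (Num.max x1 x2)) => x; rewrite !ge_max => /andP[x_1 /andP[xx1 xx2]].
have {hP} := hP x xx2; set P := \sum_(i < k.+1) _ => hP.
suff D : nc (\sum_(g <- gs G x) a g - P) <= e / 2.
  rewrite -(subrK P (\sum_(g <- _) _)) -addrA (le_trans (ncD _ _))//; lra.
have PE : P = \sum_(h <- gs G x) \sum_(m <- gs G x)
    (bLambda h)%:C%C * ph k s (lg (mmul h m)).
  rewrite /P; under eq_bigr do rewrite mulrC mulr_suml.
  rewrite exchange_big/=; apply: eq_bigr => h _.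
  under eq_bigr do rewrite mulr_sumr.
  rewrite exchange_big/=; apply: eq_bigr => m _.
  by rewrite lgM ph_add mulr_sumr; apply: eq_bigr => i _; ring.
have SE : \sum_(g <- gs G x) a g = \sum_(h <- gs G x)
    \sum_(m <- gs G x | bnorm G (mmul h m) <= x)
    (bLambda h)%:C%C * ph k s (lg (mmul h m)).
  rewrite -(@sum_divisors _ _ _ x (fun g => bnorm G g <= x)
    (fun h g => (bLambda h)%:C%C * ph k s (lg g)))//.
  rewrite [RHS]big_seq_cond [LHS]big_seq; apply: eq_big.
    by move=> g; rewrite mem_gs andbb.
  move=> g; rewrite mem_gs => gx; rewrite -mulr_suml -(rmorph_sum (real_complex R)).
  by rewrite sum_Lambda.
rewrite SE PE -sumrB.
have -> : \sum_(h <- gs G x) (\sum_(m <- gs G x | bnorm G (mmul h m) <= x)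
      (bLambda h)%:C%C * ph k s (lg (mmul h m))
    - \sum_(m <- gs G x) (bLambda h)%:C%C * ph k s (lg (mmul h m))) =
  - \sum_(h <- gs G x) \sum_(m <- gs G x | x < bnorm G (mmul h m))
      (bLambda h)%:C%C * ph k s (lg (mmul h m)).
  rewrite -sumrN; apply: eq_bigr => h _.
  rewrite [X in _ - X](bigID (fun m => bnorm G (mmul h m) <= x))/= opprD addrA subrr add0r.
  by congr (- _); apply: eq_bigl => m; rewrite ltNge.
rewrite ncN (le_trans (nc_sum _ _ _))//.
pose b (h g : T) := bLambda h * nc (ph k s (lg g)).
have b0 h g : 0 <= b h g by rewrite mulr_ge0 ?nc_ge0 ?bLambda_ge0.
have xxx : x <= x * x by rewrite ler_peMr// (le_trans ler01).
(* The excess pairs satisfy [x < |h m| <= x^2]. Once both ranges extend to [x^2], the pairs run over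
   all divisors again and collapse to a tail of an absolutely convergent series. *)
apply: (@le_trans _ _ (\sum_(h <- gs G (x * x))
    \sum_(m <- gs G (x * x) | x < bnorm G (mmul h m) <= x * x) b h (mmul h m))).
  rewrite (sum_gs_split _ xxx) -[leLHS]addr0 lerD//; last first.
    by rewrite sumr_ge0// => h _; rewrite sumr_ge0.
  rewrite big_seq [leRHS]big_seq ler_sum// => h; rewrite mem_gs => hx.
  rewrite (le_trans (nc_sum _ _ _))// [leRHS]big_mkcond (sum_gs_split _ xxx).
  rewrite -[leLHS]addr0 lerD//; last first.
    by rewrite sumr_ge0// => m _; case: ifP.
  rewrite big_mkcond big_seq [leRHS]big_seq ler_sum// => m; rewrite mem_gs => mx.
  case: ifPn => // xhm.
  rewrite bnormM ler_pM ?(ltW (bnorm_gt0 _))//.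
  by rewrite ncM ncR ger0_norm ?bLambda_ge0.
rewrite -(@sum_divisors _ _ _ (x * x) (fun g => x < bnorm G g <= x * x) b); last first.
  by move=> g /andP[].
apply: (@le_trans _ _ (\sum_(g <- gs G (x * x) | x < bnorm G g)
    Kc * npow (complex.Re s - eta) g)).
  rewrite big_seq_cond [leRHS]big_seq_cond.
  rewrite (eq_bigl (fun g => (g \in gs G (x * x)) && (x < bnorm G g))); last first.
    by move=> g; rewrite mem_gs; case: (_ <= x * x); rewrite ?andbT ?andbF.
  apply: ler_sum => g /andP[gx _]; rewrite mem_gs in gx.
  rewrite -mulr_suml sum_Lambda//.
  have -> : lg g * nc (ph k s (lg g)) = nc ((lg g)%:C%C * ph k s (lg g)).
    by rewrite (ncM _ (ph k s (lg g))) ncR ger0_norm// lg_ge0.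
  rewrite lg_ph -[X in nc X]mulr_natl ncM nc_nat /Kc -mulrA ler_wpM2l//.
  exact: ph_dominated.
rewrite -mulr_sumr; apply: (le_trans (ler_wpM2l (ltW Kc0) (tail x _ xx1 xxx))).
by rewrite mulrC divfK// gt_eqF.
Qed.

End ZetaTaylor.

(** * The zero-free half-plane *)

Section ComplexCalculus.
Variable R : realType.

Lemma derivable_cdiff (f : (R[i])^o -> (R[i])^o) s : derivable f s 1 -> cdiff f s.
Proof.
move=> /cvg_ex[D hD]; exists D => e e0.
have e0' : (0 : R[i]) < e%:C%C by rewrite ltcR.
move/cvgrPdist_le: hD => /(_ _ e0')[r /= r0 hr].
exists (complex.Re r); first by move: r0; rewrite ltcE => /andP[].
move=> h hh; have [->|h0] := eqVneq h 0; first by rewrite addr0 subrr mulr0 subr0 nc0 mulr0.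
have rE : r = (complex.Re r)%:C%C.
  by move: r0; rewrite ltcE => /andP[/eqP]; case: (r) => a b /= -> _.
have /hr/(_ h0) : ball_ [eta Num.norm] (0 : R[i]) r h.
  rewrite /ball_ /= sub0r normrN rE.
  by rewrite (_ : `|h| = (nc h)%:C%C)// ltcR.
rewrite (_ : `|_| = (nc (D - h^-1 * (f (h * 1 + s) - f s)))%:C%C)// lecR mulr1 => hh'.
have -> : f (s + h) - f s - D * h = - (D - h^-1 * (f (h + s) - f s)) * h.
  by rewrite [h + s]addrC; field.
by rewrite ncM ncN ler_wpM2r ?nc_ge0.
Qed.

Lemma cvg_punctured (f : (R[i])^o -> (R[i])^o) s c : f w @[w --> s^'] --> c ->
  forall e : R, 0 < e -> exists2 r : R, 0 < r &
  forall w, w != s -> nc (w - s) < r -> nc (f w - c) <= e.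
Proof.
move=> hD e e0; have e0' : (0 : R[i]) < e%:C%C by rewrite ltcR.
move/cvgrPdist_le: hD => /(_ _ e0')[r /= r0 hr].
exists (complex.Re r); first by move: r0; rewrite ltcE => /andP[].
move=> w ws hh.
have rE : r = (complex.Re r)%:C%C.
  by move: r0; rewrite ltcE => /andP[/eqP]; case: (r) => a b /= -> _.
have /hr/(_ ws) : ball_ [eta Num.norm] s r w.
  rewrite /ball_ /= rE.
  by rewrite (_ : `|s - w| = (nc (s - w))%:C%C)// ltcR ncBC.
by rewrite (_ : `|_| = (nc (c - f w))%:C%C)// lecR ncBC.
Qed.

Lemma is_derive_quad (f : R -> R) (x D K r : R) : 0 < r ->
  (forall h, `|h| <= r -> `|f (x + h) - f x - h * D| <= K * h ^+ 2) ->
  is_derive x (1 : R) f D.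
Proof.
move=> r0 hf.
have K1 : 0 < `|K| + 1 by rewrite ltr_wpDl.
have hc : (fun h => h^-1 *: (f (h *: (1 : R) + x) - f x)) @ 0^' --> D.
  apply/cvgrPdist_le => e e0; exists (Num.min r (e / (`|K| + 1))).
    by rewrite /= lt_min r0 divr_gt0.
  move=> h /=; rewrite sub0r normrN lt_min => /andP[hr he] h0.
  have := hf h (ltW hr); rewrite scaler1 [h + x]addrC.
  have -> : D - h^-1 *: (f (x + h) - f x) = - h^-1 * (f (x + h) - f x - h * D).
    by rewrite /GRing.scale /=; field.
  move=> h1; rewrite normrM normrN normfV mulrC ler_pdivrMr ?normr_gt0//.
  apply: (le_trans h1); rewrite -[h ^+ 2]ger0_norm ?sqr_ge0// normrX expr2 mulrA.
  rewrite ler_wpM2r// (le_trans (ler_wpM2r (normr_ge0 h) (_ : K <= `|K| + 1)))//.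
    by rewrite (le_trans (ler_norm _))// lerDl.
  by rewrite mulrC -ler_pdivlMr// ltW.
by split; [apply/cvg_ex; exists D|apply: cvg_lim].
Qed.

Lemma cder_quad (f : R -> R[i]) (x K r : R) (D : R[i]) : 0 < r ->
  (forall h, `|h| <= r -> nc (f (x + h) - f x - h%:C%C * D) <= K * h ^+ 2) ->
  cder f x D.
Proof.
move=> r0 hf; split; apply: (is_derive_quad r0) => h /hf; apply: le_trans.
  by rewrite (le_trans _ (nc_Re _))// !(cReD, cReN, cReM) /= mul0r subr0.
by rewrite (le_trans _ (nc_Im _))// !(cImD, cImN, cImM) /= mul0r addr0.
Qed.

(** A logarithmic derivative without division, so that zeros of [f] do no harm and products still
    add up. *)
Definition logder (f : R -> R) (x c : R) := is_derive x (1 : R) f (c * f x).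

Lemma logderM f g x c d : logder f x c -> logder g x d ->
  logder (fun t => f t * g t) x (c + d).
Proof. by move=> hf hg; apply: (is_derive_eq (is_deriveM1 hf hg)); ring. Qed.

Lemma logderX f x c n : logder f x c -> logder (fun t => f t ^+ n) x (n%:R * c).
Proof.
move=> hf; elim: n => [|n IH].
  rewrite /logder !mul0r; exact: is_derive_cst.
rewrite (_ : (fun t => _) = (fun t => f t * f t ^+ n)); last first.
  by apply/funext => t; rewrite exprS.
by rewrite -nat1r mulrDl mul1r; exact: logderM.
Qed.

Lemma logder_nc_sqr (f : R -> R[i]) x (b : R[i]) : cder f x (f x * b) ->
  logder (fun t => nc (f t) ^+ 2) x (2 * complex.Re b).
Proof.
move=> [h1 h2].
rewrite (_ : (fun t => _) = (fun t => complex.Re (f t) * complex.Re (f t) +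
    complex.Im (f t) * complex.Im (f t))); last first.
  by apply/funext => t; rewrite nc_sqr -!expr2.
apply: (is_derive_eq (is_deriveD (is_deriveM1 h1 h1) (is_deriveM1 h2 h2))).
by rewrite cReM cImM; ring.
Qed.

Lemma geom_half n : \sum_(k < n) (2^-1 : R) ^+ k <= 2.
Proof.
have -> : \sum_(k < n) (2^-1 : R) ^+ k = 2 - 2 * 2^-1 ^+ n.
  elim: n => [|n IH]; first by rewrite big_ord0 expr0 mulr1 subrr.
  by rewrite big_ord_recr/= IH exprS; field.
by rewrite gerBl mulr_ge0 ?exprn_ge0.
Qed.

End ComplexCalculus.

Section ZetaLowerBound.
Variables (R : realType) (G : beurling R).
Local Notation T := (cmonom (bprime G)).
Variables (theta : R) (F : R[i] -> R[i]).
Hypothesis zF : is_zeta G theta F.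

Lemma Cz_bound k (s : R[i]) eta : 0 < eta -> 1 < complex.Re s - eta ->
  nc (Cz G k s) <= eta ^- k * zr F (complex.Re s - eta).
Proof.
move=> e0 s1; have s1' : 1 < complex.Re s by lra.
apply: (@dlim_le _ _ _ _ _ 0 (CzP zF s1' k)) => x _.
apply: (le_trans (nc_sum _ _ _)).
apply: (@le_trans _ _ (\sum_(g <- gs G x) eta ^- k * npow (complex.Re s - eta) g)).
  by apply: ler_sum => g _; exact: ph_dominated.
by rewrite -mulr_sumr ler_wpM2l ?invr_ge0 ?exprn_ge0 ?(ltW e0)//; exact: (sum_npow_le zF).
Qed.

Lemma nc_zeta_le (s : R[i]) : 1 < complex.Re s -> nc (F s) <= zr F (complex.Re s).
Proof.
move=> s1; apply: (@dlim_le _ _ _ _ _ 0 (zeta_dlim zF s1)) => x _.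
apply: (le_trans (nc_sum _ _ _)); under eq_bigr do rewrite nc_cE.
exact: (sum_npow_le zF).
Qed.

(** The first two Taylor coefficients are [F s] and [F s * Bz G 0 s]; the others are summed
    geometrically. *)
Lemma zeta_quad (s z : R[i]) eta : 0 < eta -> 1 < complex.Re s - eta ->
  nc z <= eta / 2 -> nc (F (s - z) - F s - F s * Bz G 0 s * z) <=
  2 * zr F (complex.Re s - eta) * (nc z / eta) ^+ 2.
Proof.
move=> e0 s1 ze; have s1' : 1 < complex.Re s by lra.
set M := zr F _; have M0 : 0 <= M.
  by apply: le_trans (sum_npow_le zF fset0 s1); rewrite big_nil.
have sz : 1 < complex.Re s - nc z by lra.
pose q := nc z / eta; have q0 : 0 <= q by rewrite divr_ge0 ?nc_ge0// ltW.
have q2 : q <= 2^-1 by rewrite ler_pdivrMr// mulrC.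
have C1 : Cz G 1 s = F s * Bz G 0 s.
  by have := Cz_recurrence zF 0 s1'; rewrite big_ord1 (Cz0 zF s1') subn0.
apply/ler_addgt0Pr => e e'0; have [K0 hK] := zeta_Taylor zF sz e'0.
have {hK} := hK K0.+2 (leq_trans (leqnSn _) (leqnSn _)).
rewrite big_ord_recl big_ord_recl /= expr0 mulr1 (Cz0 zF s1') expr1 C1.
set S := \sum_(i < K0) _.
have hS : nc S <= 2 * M * q ^+ 2.
  apply: (le_trans (nc_sum _ _ _)).
  apply: (@le_trans _ _ (\sum_(i < K0) (M * q ^+ 2) * 2^-1 ^+ i)).
    apply: ler_sum => i _; rewrite ncM ncX /bump/= !add1n.
    apply: (le_trans (ler_wpM2r (exprn_ge0 _ (nc_ge0 z)) (Cz_bound _ e0 s1))).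
    rewrite -/M; have -> : eta ^- i.+2 * M * nc z ^+ i.+2 = M * q ^+ 2 * q ^+ i.
      rewrite -[RHS]mulrA -exprD add2n /q expr_div_n [_ * M]mulrC -mulrA.
      by rewrite [X in M * X]mulrC.
    apply: ler_wpM2l; last by rewrite lerXn2r ?nnegrE.
    by apply: mulr_ge0 => //; exact: exprn_ge0.
  rewrite -mulr_sumr (_ : 2 * M * q ^+ 2 = M * q ^+ 2 * 2); last by ring.
  apply: ler_wpM2l; last exact: geom_half.
  by apply: mulr_ge0 => //; exact: exprn_ge0.
move=> h.
have -> : F (s - z) - F s - F s * Bz G 0 s * z =
  (F (s - z) - (F s + (F s * Bz G 0 s * z + S))) + S by ring.
by rewrite (le_trans (ncD _ _))// addrC lerD.
Qed.

Lemma cder_zeta (sg t : R) : 1 < sg ->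
  cder (fun u => F (Complex u t)) sg (F (Complex sg t) * - Bz G 0 (Complex sg t)).
Proof.
move=> s1; pose s := Complex sg t; pose eta := (sg - 1) / 2.
have e0 : 0 < eta by rewrite divr_gt0// subr_gt0.
have se : 1 < complex.Re s - eta by rewrite /s /eta /=; lra.
apply: (@cder_quad _ _ _ (2 * zr F (complex.Re s - eta) * eta ^- 2) (eta / 2)).
  by rewrite divr_gt0.
move=> h hh; have := @zeta_quad s (- h%:C%C) eta e0 se; rewrite ncN ncR => /(_ hh).
have -> : s - - h%:C%C = Complex (sg + h) t by rewrite /s opprK; simpc.
congr (nc _ <= _); first by rewrite -/s; ring.
by rewrite expr_div_n -normrX ger0_norm ?sqr_ge0//; ring.
Qed.

(** Termwise this is [3 + 4 c + (2 c^2 - 1) = 2 (1 + c)^2 >= 0] with [c = cos (t log |g|)]. *)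
Lemma Bz0_pos (sg t : R) : 1 < sg ->
  0 <= complex.Re (3 * Bz G 0 (Complex sg 0) + 4 * Bz G 0 (Complex sg t)
    + Bz G 0 (Complex sg (2 * t))).
Proof.
move=> s1.
have h u := @BzP _ G _ _ zF (Complex sg u) s1 0.
apply: (dlim_Re_ge0 (dlimD (dlimD (dlimZ 3 (h 0)) (dlimZ 4 (h t))) (h (2 * t)))) => g.
have E u : (bLambda g)%:C%C * ph 0 (Complex sg u) (lg g) =
    (bLambda g * expR (- sg * lg g))%:C%C * Complex (cos (u * lg g)) (- sin (u * lg g)).
  rewrite /ph expr0 fact0 divr1 mul1r /cE /= rmorphM -mulrA; congr (_ * _).
  by apply/eqP; rewrite eq_complex cReM cImM /= !mul0r subr0 addr0 mulrN !eqxx.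
have E3 n : (n%:R : R[i]) = (n%:R)%:C%C by rewrite rmorph_nat.
rewrite !E (E3 3) (E3 4); simpc => /=; rewrite ?mul0r cos0.
rewrite (_ : 2 * t * lg g = (t * lg g) *+ 2); last by rewrite -mulr_natl; ring.
rewrite cos_mulr2n.
set w := bLambda g * _; have w0 : 0 <= w by rewrite mulr_ge0 ?bLambda_ge0 ?expR_ge0.
set c := cos _.
suff -> : 3 * (w * 1) + 4 * (w * c) + w * (c ^+ 2 *+ 2 - 1) = 2 * w * (c + 1) ^+ 2.
  by rewrite mulr_ge0 ?sqr_ge0// mulr_ge0.
by rewrite -mulr_natl; ring.
Qed.

Lemma lg_min (x : R) : exists2 l : R, 0 < l & forall g : T, g \in gs G x -> g != mone ->
  l <= lg g.
Proof.
suff gen (r : seq T) : exists2 l : R, 0 < l & forall g, g \in r -> g != mone -> l <= lg g.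
  exact: (gen (enum_fset (gs G x))).
elim: r => [|g r [l l0 IH]]; first by exists 1.
have [->|g1] := eqVneq g mone.
  by exists l => // h; rewrite inE => /orP[/eqP ->|/IH//]; rewrite eqxx.
exists (Num.min l (lg g)); first by rewrite lt_min l0 /lg ln_gt0// bnorm_gt1.
move=> h; rewrite inE ge_min => /orP[/eqP ->|/IH h1 /h1 ->//]; by rewrite lexx orbT.
Qed.

(** Only finitely many elements have norm at most 2, and all of them except 1 have norm above 1. *)
Lemma lg_gap : exists2 l : R, 0 < l & forall g : T, g != mone -> l <= lg g.
Proof.
have [l l0 hl] := lg_min 2; exists (Num.min l (ln 2)).
  by rewrite lt_min l0 ln_gt0// ltr1n.
move=> g g1; rewrite ge_min; have [g2|g2] := leP (bnorm G g) 2.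
  by rewrite hl// mem_gs.
by rewrite /lg ler_ln ?posrE ?bnorm_gt0// (ltW g2) orbT.
Qed.

Lemma zeta_to1 e : 0 < e -> exists sg0, forall s, sg0 <= complex.Re s -> nc (F s - 1) <= e.
Proof.
move=> e0; have [l l0 hl] := lg_gap.
have Z0 : 0 <= zr F 2.
  by apply: le_trans (@sum_npow_le _ _ _ _ zF 2 fset0 _); rewrite ?big_nil// ltr1n.
exists (2 + (zr F 2 / e) / l) => s hs.
have y0 : zr F 2 / e <= (complex.Re s - 2) * l by rewrite -ler_pdivrMr//; lra.
have q0 : 0 <= (zr F 2 / e) / l by rewrite !divr_ge0// ltW.
have s1 : 1 < complex.Re s by lra.
pose a (g : T) : R[i] := if g == mone then 0 else cE s (lg g).
have ha : dlim a (F s - 1).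
  move=> d d0; have [x0 hx0] := zeta_dlim zF s1 d0.
  exists (Num.max 1 x0) => x; rewrite ge_max => /andP[x1 /hx0].
  rewrite (_ : \sum_(g <- gs G x) cE s (lg g) = \sum_(g <- gs G x) a g + 1).
    by congr (nc _ <= _); ring.
  rewrite [LHS](bigD1_seq mone) ?fset_uniq ?mem_gs ?bnorm1//= [RHS]addrC.
  rewrite lg1 cE0; congr (_ + _).
  rewrite [LHS]big_mkcond; apply: eq_bigr => g _; rewrite /a; by case: eqP.
apply: (@dlim_le _ _ _ _ _ 0 ha) => x _; apply: (le_trans (nc_sum _ _ _)).
apply: (@le_trans _ _ (\sum_(g <- gs G x) expR (- ((complex.Re s - 2) * l)) * npow 2 g)).
  apply: ler_sum => g _; rewrite /a; case: eqP => [_|/eqP g1].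
    by rewrite nc0 mulr_ge0 ?expR_ge0.
  rewrite nc_cE /npow -expRD ler_expR.
  have : (complex.Re s - 2) * l <= (complex.Re s - 2) * lg g.
    by rewrite ler_wpM2l ?hl//; lra.
  by lra.
rewrite -mulr_sumr; have h2 : \sum_(g <- gs G x) npow 2 g <= zr F 2.
  by apply: (sum_npow_le zF); rewrite ltr1n.
apply: (le_trans (ler_wpM2l (expR_ge0 _) h2)).
rewrite expRN mulrC ler_pdivrMr ?expR_gt0// mulrC -ler_pdivrMr//.
by apply: (le_trans y0); apply: le_trans (expR_ge1Dx _); rewrite lerDr.
Qed.

(* The product decreases in sg and tends to 1. *)
Theorem zeta_341 (sg t : R) : 1 < sg ->
  1 <= nc (F (Complex sg 0)) ^+ 6 * nc (F (Complex sg t)) ^+ 8 *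
    nc (F (Complex sg (2 * t))) ^+ 2.
Proof.
(* The square of the modulus is polynomial in real and imaginary part, hence differentiable; this
   doubles the classical exponents 3, 4, 1. *)
move=> s1; pose q u x := nc (F (Complex x u)) ^+ 2.
pose Q x := q 0 x ^+ 3 * q t x ^+ 4 * q (2 * t) x.
have -> : nc (F (Complex sg 0)) ^+ 6 * nc (F (Complex sg t)) ^+ 8 *
    nc (F (Complex sg (2 * t))) ^+ 2 = Q sg by rewrite /Q /q -!exprM.
have q0 u x : 0 <= q u x by rewrite exprn_ge0 ?nc_ge0.
have Q0 x : 0 <= Q x by rewrite /Q; apply: mulr_ge0 => //; apply: mulr_ge0; exact: exprn_ge0.
have dq u x : 1 < x -> logder (q u) x (2 * complex.Re (- Bz G 0 (Complex x u))).
  by move=> x1; apply: logder_nc_sqr; exact: cder_zeta.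
have dQ x : 1 < x -> logder Q x (- 2 * complex.Re (3 * Bz G 0 (Complex x 0) +
    4 * Bz G 0 (Complex x t) + Bz G 0 (Complex x (2 * t)))).
  move=> x1; have := logderM (logderM (logderX 3 (dq 0 x x1)) (logderX 4 (dq t x x1)))
    (dq (2 * t) x x1).
  congr logder; rewrite -!(rmorph_nat (real_complex R)) !cReD !cReN !cReM /=.
  by ring.
have Qdec x : sg <= x -> Q x <= Q sg.
  move=> sx.
  have dQ' y (h : sg <= y <= x) := dQ y (lt_le_trans s1 (andP h).1).
  have [c /andP[c1 _] E] := MVT_le sx dQ'.
  rewrite -subr_le0 E mulr_le0_ge0 ?subr_ge0// mulr_le0_ge0//.
  by rewrite mulNr oppr_le0 mulr_ge0// Bz0_pos//; lra.
apply/ler_addgt0Pr => e e0.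
pose e' := Num.min 1 (e / 16).
have e'0 : 0 < e' by rewrite lt_min ltr01 divr_gt0.
have e'1 : e' <= 1 by rewrite ge_min lexx.
have e'e : 16 * e' <= e by rewrite mulrC -ler_pdivlMr// ge_min lexx orbT.
have [sg0 h] := zeta_to1 e'0.
pose x := Num.max sg sg0.
have qge u : (1 - e') ^+ 2 <= q u x.
  have := h (Complex x u); rewrite /= le_max lexx orbT => /(_ isT) h1.
  rewrite lerXn2r ?nnegrE ?nc_ge0 ?subr_ge0//.
  by have := ncD_ge 1 (F (Complex x u) - 1); rewrite nc1 (_ : 1 + (_ - 1) = F (Complex x u)); [lra|ring].
have hQ : Q x <= Q sg by apply: Qdec; rewrite le_max lexx.
suff h2 : 1 - 16 * e' <= Q x by lra.
have b16 n : 1 - n%:R * e' <= (1 - e') ^+ n.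
  elim: n => [|n IH]; first by rewrite mul0r subr0 expr0.
  rewrite exprS; have : (1 - e') * (1 - n%:R * e') <= (1 - e') * (1 - e') ^+ n.
    by rewrite ler_wpM2l// subr_ge0.
  have : 0 <= n%:R * e' ^+ 2 by rewrite mulr_ge0 ?exprn_ge0// ltW.
  by rewrite -nat1r; lra.
apply: (le_trans (b16 16%N)).
rewrite (_ : (1 - e') ^+ 16 = ((1 - e') ^+ 2) ^+ 3 * ((1 - e') ^+ 2) ^+ 4 * (1 - e') ^+ 2).
  have s0 : 0 <= (1 - e') ^+ 2 by rewrite sqr_ge0.
  have p0 u n : ((1 - e') ^+ 2) ^+ n <= q u x ^+ n by rewrite lerXn2r ?nnegrE.
  apply: ler_pM (qge _) => //; last first.
    by apply: ler_pM; [exact: exprn_ge0|exact: exprn_ge0|exact: p0|exact: p0].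
  by apply: mulr_ge0; exact: exprn_ge0.
by rewrite -!exprM -!exprD.
Qed.

(** Bounding the other two factors in [zeta_341] by [zr F] makes the product at most the eighth
    power of the right-hand side. *)
Corollary nc_zeta_ge (s : R[i]) : 1 < complex.Re s -> 1 <= zr F (complex.Re s) * nc (F s).
Proof.
case: s => sg t /= s1; have := zeta_341 t s1.
have h u := @nc_zeta_le (Complex sg u) s1.
have Z0 : 0 <= zr F sg by apply: le_trans (nc_ge0 _) (h 0).
move=> h1; rewrite leNgt; apply/negP => lt1.
move: h1; rewrite leNgt => /negP; apply.
apply: (@le_lt_trans _ _ (zr F sg ^+ 6 * nc (F (Complex sg t)) ^+ 8 * zr F sg ^+ 2)).
  by rewrite !ler_pM ?mulr_ge0 ?exprn_ge0 ?nc_ge0// lerXn2r ?nnegrE ?nc_ge0//; exact: h.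
rewrite mulrAC -exprD -exprMn exprn_ilt1// mulr_ge0//; exact: nc_ge0.
Qed.

End ZetaLowerBound.

Section ZeroFree.
Variables (R : realType) (G : beurling R).
Variables (theta : R) (F : R[i] -> R[i]).
Hypothesis zF : is_zeta G theta F.
Hypothesis theta1 : theta < 1.

Lemma zeta_cdiff (s : R[i]) : theta < complex.Re s -> s != 1 -> cdiff F s.
Proof. by move=> st s1; have [_ h _] := zF; apply: derivable_cdiff; exact: h. Qed.

Lemma zeta_pole : exists2 c : R[i], c != 0 & forall e : R, 0 < e ->
  exists2 r : R, 0 < r &
  forall w, w != 1 -> nc (w - 1) < r -> nc ((w - 1) * F w - c) <= e.
Proof.
have [_ _ [c c0 hc]] := zF; exists c => // e e0.
exact: (cvg_punctured hc e0).
Qed.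

Lemma line1_neq1 (t : R) : t != 0 -> Complex 1 t != 1 :> R[i].
Proof. by move=> t0; apply: contra t0 => /eqP[->]. Qed.

(** In [zeta_341] at [sg = 1 + h], the simple pole contributes at most a multiple of [h^-6], while a
    zero would contribute at most a multiple of [h^8]; the product would tend to 0. *)
Lemma zeta_line1_neq0 (t : R) : t != 0 -> F (Complex 1 t) != 0.
Proof.
move=> t0; apply/eqP => Ft.
have t20 : 2 * t != 0 by rewrite mulf_neq0// pnatr_eq0.
have [L [r1 r10 [L0 h1]]] := cdiff_lipschitz (@zeta_cdiff (Complex 1 t) theta1 (line1_neq1 t0)).
have [L2 [r2 r20 [L20 h2]]] := cdiff_lipschitz (@zeta_cdiff (Complex 1 (2 * t)) theta1 (line1_neq1 t20)).
have [c _ /(_ _ ltr01)[r3 r30 h3]] := zeta_pole.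
pose M2 := nc (F (Complex 1 (2 * t))) + L2 * r2.
pose M := nc c + 1.
have M20 : 0 <= M2 by rewrite addr_ge0 ?nc_ge0 ?mulr_ge0 ?(ltW r20).
have M0 : 0 <= M by rewrite addr_ge0 ?nc_ge0.
pose K := M ^+ 6 * L ^+ 8 * M2 ^+ 2.
have K0 : 0 <= K by rewrite mulr_ge0 ?exprn_ge0// mulr_ge0 ?exprn_ge0.
pose h := Num.min (Num.min (r1 / 2) (r2 / 2)) (Num.min (r3 / 2) (K + 2)^-1).
have h0 : 0 < h by rewrite !lt_min invr_gt0 !divr_gt0//; lra.
have hr1 : h < r1.
  by apply: (@le_lt_trans _ _ (r1 / 2)); [rewrite !ge_min lexx|lra].
have hr2 : h < r2.
  by apply: (@le_lt_trans _ _ (r2 / 2)); [rewrite !ge_min lexx orbT|lra].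
have hr3 : h < r3.
  by apply: (@le_lt_trans _ _ (r3 / 2)); [rewrite !ge_min lexx !orbT|lra].
have hK : h <= (K + 2)^-1 by rewrite !ge_min lexx !orbT.
have hK1 : (K + 2) * h <= 1 by rewrite mulrC -ler_pdivlMr ?div1r//; lra.
have h_1 : h <= 1 by have : 0 <= K * h by [apply: mulr_ge0 => //; exact: ltW]; lra.
have nh : nc h%:C%C = h by rewrite ncR ger0_norm ?(ltW h0).
have E u : Complex (1 + h) u = Complex 1 u + h%:C%C by simpc.
have k1 : nc (F (Complex (1 + h) t)) <= L * h.
  by have := h1 h%:C%C; rewrite nh => /(_ hr1); rewrite Ft subr0 E.
have k2 : nc (F (Complex (1 + h) (2 * t))) <= M2.
  have := h2 h%:C%C; rewrite nh => /(_ hr2) k2.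
  rewrite E -(subrK (F (Complex 1 (2 * t))) (F (_ + _))) (le_trans (ncD _ _))//.
  by rewrite addrC lerD2l (le_trans k2)// ler_wpM2l// ltW.
have k3 : nc (F (Complex (1 + h) 0)) <= M / h.
  have E0 : Complex (1 + h) 0 - 1 = h%:C%C by rewrite E addrAC subrr add0r.
  have n1 : Complex (1 + h) 0 != 1 by rewrite -subr_eq0 E0 -nc_eq0 nh gt_eqF.
  have := h3 _ n1; rewrite E0 nh => /(_ hr3) k3.
  rewrite ler_pdivlMr// mulrC -[X in X * _]nh -ncM.
  by rewrite -(subrK c (_ * _)) (le_trans (ncD _ _))// addrC lerD2l.
have h1' : 1 < 1 + h by lra.
have := zeta_341 zF t h1'; apply/negP; rewrite -ltNge.
apply: (@le_lt_trans _ _ ((M / h) ^+ 6 * (L * h) ^+ 8 * M2 ^+ 2)).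
  have Mh0 : 0 <= M / h by rewrite divr_ge0// ltW.
  have Lh0 : 0 <= L * h by rewrite mulr_ge0// ltW.
  have p0 (a b : R) n : 0 <= a -> a <= b -> a ^+ n <= b ^+ n.
    by move=> a0 ab; rewrite lerXn2r ?nnegrE// (le_trans a0).
  apply: ler_pM; rewrite ?mulr_ge0 ?exprn_ge0 ?nc_ge0//; last by apply: p0; rewrite ?nc_ge0.
  by apply: ler_pM; rewrite ?exprn_ge0 ?nc_ge0//; apply: p0; rewrite ?nc_ge0.
have -> : (M / h) ^+ 6 * (L * h) ^+ 8 * M2 ^+ 2 = K * (h * h).
  by rewrite /K; field; rewrite gt_eqF.
have : K * (h * h) <= K * h.
  by rewrite ler_wpM2l// ler_piMl// ltW.
by lra.
Qed.

Lemma zeta_locally_neq0 (t : R) : exists2 r : R, 0 < r &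
  forall s : R[i], s != 1 -> nc (s - Complex 1 t) < r -> F s != 0.
Proof.
have [->|t0] := eqVneq t 0.
  have [c c0 hc] := zeta_pole.
  have c2 : 0 < nc c / 2 by rewrite divr_gt0// nc_gt0.
  have [r r0 hr] := hc _ c2; exists r => // s s1 /(hr s s1) h.
  apply/eqP => Fs; move: h; rewrite Fs mulr0 sub0r ncN; lra.
have [L [r r0 [L0 h]]] := cdiff_lipschitz (@zeta_cdiff (Complex 1 t) theta1 (line1_neq1 t0)).
have f0 : 0 < nc (F (Complex 1 t)) by rewrite nc_gt0 zeta_line1_neq0.
pose r' := Num.min r (nc (F (Complex 1 t)) / (L + 1)).
have L1 : 0 < L + 1 by lra.
exists r'; first by rewrite lt_min r0 divr_gt0.
move=> s _; rewrite lt_min => /andP[sr sL]; apply/eqP => Fs.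
have := h _ sr; rewrite [_ + (s - _)]addrC subrK Fs sub0r ncN => h1.
move: sL; rewrite ltr_pdivlMr// => sL.
have := nc_ge0 (s - Complex 1 t); have : nc (s - Complex 1 t) * (L + 1) =
  L * nc (s - Complex 1 t) + nc (s - Complex 1 t) by ring.
lra.
Qed.

(** [zeta_locally_neq0] excludes zeros around each point of the line [Re s = 1], including the pole;
    compactness of the segment [|t| <= T0] gives a common width, and [nc_zeta_ge] covers the points
    with [Re s > 1]. *)
Theorem zeta_zero_free (T0 : R) : exists2 eta : R, 0 < eta & forall s : R[i],
  s != 1 -> nc s <= T0 -> F s = 0 -> complex.Re s <= 1 - eta.
Proof.
pose P (eta t : R) := forall sg, 1 - eta < sg -> Complex sg t != 1 ->
  F (Complex sg t) != 0.
have loc t : `[- T0, T0]%classic t ->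
    \forall t' \near t & eta \near (0 : R)^'+, P eta t'.
  move=> _; have [r r0 hr] := zeta_locally_neq0 t.
  have r2 : 0 < r / 2 by rewrite divr_gt0.
  near=> t' eta => sg hsg s1 ; rewrite /= in hsg s1 *.
  have [sg1|sg1] := leP sg 1; last first.
    have := nc_zeta_ge zF (sg1 : 1 < complex.Re (Complex sg t')).
    by rewrite leNgt; apply: contra => /eqP ->; rewrite nc0 mulr0.
  apply: hr => //; apply: (le_lt_trans (nc_ReIm _)).
  rewrite cReD cImD cReN cImN /=.
  have h1 : `|t' - t| < r / 2 by rewrite distrC; near: t'; exact: cvgr_dist_lt.
  have h2 : eta < r / 2 by near: eta; exact: nbhs_right_lt.
  have h3 : `|sg - 1| <= eta by rewrite ler_norml; lra.
  lra.
have /compact_near_coveringP/(_ _ _ P _ loc) := @segment_compact R (- T0) T0.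
move=> hP.
have : \forall eta \near (0 : R)^'+, 0 < eta /\ forall t, `[- T0, T0]%classic t -> P eta t.
  near=> eta; split; first by near: eta; exact: nbhs_right_gt.
  by have : (`[- T0, T0] `<=` P eta)%classic by near: eta.
move=> /filter_ex[eta [eta0 h]].
exists eta => // -[sg t] s1 sT Fs; rewrite leNgt; apply/negP => /= h1.
have := h t; rewrite /= in_itv /= -ler_norml => /(_ (le_trans (nc_Im _) sT) sg h1 s1).
by rewrite Fs eqxx.
Unshelve. all: by end_near. Qed.

Corollary zeta_zero_lt1 (s : R[i]) : s != 1 -> F s = 0 -> complex.Re s < 1.
Proof.
by move=> s1 Fs; have [eta eta0 /(_ s s1 (lexx _) Fs)] := zeta_zero_free (nc s); lra.
Qed.

End ZeroFree.

(** * Estimates of the Taylor coefficients *)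

Section AbelExp.

Lemma cRe_scale (R : realType) (x : R) (z : R[i]) :
  complex.Re (x%:C%C * z) = x * complex.Re z.
Proof. by rewrite cReM /= mul0r subr0. Qed.

Lemma cIm_scale (R : realType) (x : R) (z : R[i]) :
  complex.Im (x%:C%C * z) = x * complex.Im z.
Proof. by rewrite cImM /= mul0r addr0. Qed.

Variables (R : realType) (I : eqType) (r : seq I) (lam al : I -> R).
Let S u := \sum_(i <- r | lam i <= u) al i.

Lemma phR_shift k (sg a u : R) : expR (a * u) * phR k sg u = phR k (sg - a) u.
Proof. by rewrite /phR mulrCA -expRD; congr (_ * expR _); ring. Qed.

Lemma ph_shift k (s : R[i]) (u : R) : (expR u)%:C%C * ph k s u = ph k (s - 1) u.
Proof.
rewrite /ph cE_D [cE (- 1) u](_ : _ = (expR u)%:C%C); first by ring.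
by rewrite /cE /= oppr0 mul0r cos0 sin0 mulr0 oppr0 mulr1 opprK mul1r.
Qed.

Definition phRpred k (a u : R) := if k is j.+1 then phR j a u else 0.
Definition iphRpred k (a u : R) := if k is j.+1 then iphR j a u else 0.

Lemma nc_ph'_le k (s : R[i]) u : 0 <= u ->
  nc (ph' k s u) <= phRpred k (complex.Re s) u + nc s * phR k (complex.Re s) u.
Proof.
move=> u0; rewrite /ph' (le_trans (ncB _ _))// ncM nc_phE// lerD2r.
have h j : nc (ph j s u) <= phR j (complex.Re s) u by rewrite nc_phE.
by case: k => [|j]; [rewrite nc0|exact: h].
Qed.

Variables (k : nat) (s : R[i]) (m c E0 a A B : R).
Hypotheses (s1 : s != 1) (as_ : a < complex.Re s) (E00 : 0 <= E0).
Hypotheses (A0 : 0 <= A) (AB : A <= B).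
Hypothesis SM : forall u, A <= u <= B -> `|S u - (m * expR u + c)| <= E0 * expR (a * u).

Let d := complex.Re s - a.
Let d0 : 0 < d. Proof. by rewrite subr_gt0. Qed.
Let V u := E0 * (iphRpred k d u + nc s * iphR k d u).
Let V' u := E0 * (phRpred k d u + nc s * phR k d u).
Let w0 : s - 1 != 0. Proof. by rewrite subr_eq0. Qed.

Let MD u : is_derive u (1 : R) (fun t => m * expR t + c) (m * expR u).
Proof.
apply: (is_derive_eq (is_deriveD (is_deriveM1 (is_derive_cst (m : R) u (1 : R))
   (is_derive_expR u)) (is_derive_cst (c : R) u (1 : R)))).
by rewrite mul0r add0r addr0.
Qed.

Let VD u : is_derive u (1 : R) V (V' u).
Proof.
have dn0 : d != 0 by rewrite gt_eqF.
have h1 : is_derive u (1 : R) (iphRpred k d) (phRpred k d u).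
  by case: (k) => [|j] /=; [exact: is_derive_cst|exact: is_derive_iphR].
apply: (is_derive_eq (is_deriveM1 (is_derive_cst (E0 : R) u (1 : R))
  (is_deriveD h1 (is_deriveM1 (is_derive_cst (nc s : R) u (1 : R))
   (is_derive_iphR k u dn0))))).
by rewrite !mul0r !add0r.
Qed.

Let V_le : V B - V A <= E0 * (d ^- k + nc s * d ^- k.+1).
Proof.
rewrite -mulrBr ler_wpM2l// opprD addrACA -mulrBr lerD//.
  case: (k) => [|j] /=; first by rewrite subrr expr0 invr1 ler01.
  exact: iphR_sub_le.
by rewrite ler_wpM2l ?nc_ge0// iphR_sub_le.
Qed.

Let SMV u : A <= u <= B -> `|S u - (m * expR u + c)| * nc (ph' k s u) <= V' u.
Proof.
move=> AuB; have u0 : 0 <= u by case/andP: AuB => Au _; exact: le_trans Au.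
apply: (le_trans (ler_pM (normr_ge0 _) (nc_ge0 _) (SM AuB) (nc_ph'_le k s u0))).
rewrite -mulrA ler_wpM2l// mulrDr mulrCA phR_shift lerD2r.
by case: (k) => [|j] /=; rewrite ?mulr0// phR_shift.
Qed.

Let edge u : A <= u <= B -> `|S u - (m * expR u + c)| * nc (ph k s u) <= E0 * d ^- k.
Proof.
move=> AuB; have u0 : 0 <= u by case/andP: AuB => Au _; exact: le_trans Au.
apply: (le_trans (ler_pM (normr_ge0 _) (nc_ge0 _) (SM AuB) (lexx _))).
by rewrite -mulrA ler_wpM2l// nc_phE// phR_shift phR_le.
Qed.

Let ErrB := E0 * d ^- k + E0 * d ^- k + E0 * (d ^- k + nc s * d ^- k.+1).

Let UD u : cder (fun t => m%:C%C * iph k (s - 1) t) u ((m * expR u)%:C%C * ph k s u).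
Proof.
apply: cder_eq (cderMl _ (cder_iph k u w0)) _.
by rewrite -ph_shift mulrA rmorphM.
Qed.

(** [Abel_summation] for real and imaginary part, whence the factor 2. Multiplying a weight by [e^u]
    or [e^(a u)] shifts its parameter by 1 or [a]: the main term becomes a difference of values of
    [iph k (s - 1)], and the error is governed by Gamma integrals with decay rate [Re s - a]. *)
Theorem Abel_ph :
  nc (\sum_(i <- r | A < lam i <= B) (al i)%:C%C * ph k s (lam i) -
      m%:C%C * (iph k (s - 1) B - iph k (s - 1) A)) <=
  2 * E0 * (3 * d ^- k + nc s * d ^- k.+1).
Proof.
have BB : A <= B <= B by rewrite AB lexx.
have AA : A <= A <= B by rewrite AB lexx.
have fin (x : R) (f : R -> R) : (forall u, 0 <= f u) -> 
   (f B <= nc (ph k s B)) -> (f A <= nc (ph k s A)) ->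
  x <= `|S B - (m * expR B + c)| * f B + `|S A - (m * expR A + c)| * f A + (V B - V A) ->
  x <= ErrB.
  move=> f0 fB fA xle; apply: (le_trans xle); apply: lerD (V_le).
  by apply: lerD; [apply: le_trans (edge BB)|apply: le_trans (edge AA)];
    rewrite ler_wpM2l.
apply: le_trans (nc_ReIm _) _.
have -> : 2 * E0 * (3 * d ^- k + nc s * d ^- k.+1) = ErrB + ErrB by rewrite /ErrB; ring.
apply: lerD.
  rewrite cReD cReN cRe_sum.
  apply: (fin _ (fun u => `|complex.Re (ph k s u)|)); rewrite ?nc_Re//.
  under eq_bigr do rewrite cRe_scale.
  rewrite mulrBr cReD cReN.
  apply: (@Abel_summation _ _ r lam al (fun u => complex.Re (ph k s u))
    (fun u => complex.Re (ph' k s u)) (fun u => m * expR u + c) (fun u => m * expR u)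
    (fun u => complex.Re (m%:C%C * iph k (s - 1) u)) V V' A B) => //.
  - by move=> u _; have [] := cder_ph k s u.
  - move=> u _; have [h _] := UD u; apply: (is_derive_eq h).
    by rewrite cRe_scale.
  - move=> u AuB; apply: le_trans (SMV AuB).
    by rewrite ler_wpM2l// nc_Re.
rewrite cImD cImN cIm_sum.
apply: (fin _ (fun u => `|complex.Im (ph k s u)|)); rewrite ?nc_Im//.
under eq_bigr do rewrite cIm_scale.
rewrite mulrBr cImD cImN.
apply: (@Abel_summation _ _ r lam al (fun u => complex.Im (ph k s u))
  (fun u => complex.Im (ph' k s u)) (fun u => m * expR u + c) (fun u => m * expR u)
  (fun u => complex.Im (m%:C%C * iph k (s - 1) u)) V V' A B) => //.
- by move=> u _; have [] := cder_ph k s u.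
- move=> u _; have [_ h] := UD u; apply: (is_derive_eq h).
  by rewrite cIm_scale.
- move=> u AuB; apply: le_trans (SMV AuB).
  by rewrite ler_wpM2l// nc_Im.
Qed.

End AbelExp.

Section AxiomA.
Variables (R : realType) (G : beurling R).
Local Notation T := (cmonom (bprime G)).
Variables (kappa A theta : R).
Hypothesis hA : axiomA G kappa A theta.
Variable F : R[i] -> R[i].
Hypothesis zF : is_zeta G theta F.

Lemma sum_gs_lg (V : nmodType) (f : T -> V) (X u : R) : expR u <= X ->
  \sum_(g <- gs G X | lg g <= u) f g = \sum_(g <- gs G (expR u)) f g.
Proof.
move=> uX; have P g : (lg g <= u) = (bnorm G g <= expR u) by rewrite -ler_expR expR_lg.
rewrite (eq_bigl _ _ P).
have := sum_gs_split (fun g => if bnorm G g <= expR u then f g else 0) uX.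
rewrite -big_mkcond => ->; rewrite [X in _ + X]big1 ?addr0; last first.
  by move=> g; rewrite ltNge => /negbTE ->.
by rewrite big_seq [RHS]big_seq; apply: eq_bigr => g; rewrite mem_gs => ->.
Qed.

Lemma sum1_gs (u : R) : \sum_(g <- gs G (expR u)) (1 : R) = bcount G (expR u).
Proof. by rewrite big_const_seq count_predT iter_addr_0. Qed.

Lemma phR_lim k (a e : R) : 0 < a -> 0 < e -> exists2 b0, 0 < b0 & forall b, b0 <= b ->
  phR k a b <= e.
Proof.
move=> a0 e0; have a2 : 0 < a / 2 by rewrite divr_gt0.
pose K := (a / 2) ^- k / e.
have K0 : 0 < K by rewrite divr_gt0// invr_gt0 exprn_gt0.
exists (K / (a / 2)); first by rewrite divr_gt0.
move=> b hb; have b0 : 0 <= b by apply: le_trans hb; rewrite ltW// divr_gt0.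
have -> : phR k a b = phR k (a / 2) b * expR (- ((a / 2) * b)).
  by rewrite /phR -[RHS]mulrA -expRD; congr (_ * expR _); field.
apply: (le_trans (ler_wpM2r (expR_ge0 _) (phR_le k a2 b0))).
rewrite expRN ler_pdivrMr ?expR_gt0// [e * _]mulrC -ler_pdivrMr// -/K.
have Kb : K <= a / 2 * b by move: hb; rewrite ler_pdivrMr// [b * _]mulrC.
by apply: (le_trans Kb); apply: le_trans (expR_ge1Dx _); rewrite lerDr.
Qed.

(** After removal of the main term, the counting function grows like [e^(theta u)], so the
    coefficients decay like those of a function holomorphic in a disc of radius [1 - theta]. The
    condition on [s - 1] keeps the main term, the expansion of the pole, bounded. *)
Theorem Cz_axiomA k (s : R[i]) : 1 < complex.Re s -> 1 <= nc (s - 1) ->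
  nc (Cz G k s) * (1 - theta) ^+ k <=
  1 + 3 * kappa + 2 * A * (3 + nc s / (1 - theta)).
Proof.
move=> s1 w1; have [kappa0 A0 /andP[th0 th1] hcount] := hA.
set R1 := 1 - theta; have R10 : 0 < R1 by rewrite subr_gt0.
have R1_1 : R1 <= 1 by rewrite gerBl ltW.
have Rk0 : 0 < R1 ^+ k by rewrite exprn_gt0.
have Rk1 : R1 ^+ k <= 1 by rewrite exprn_ile1// ltW.
have sn1 : s != 1 by rewrite -subr_eq0 -nc_eq0 gt_eqF// (lt_le_trans _ w1).
have w0 : s - 1 != 0 by rewrite subr_eq0.
have ths : theta < complex.Re s by exact: lt_trans s1.
set d := complex.Re s - theta.
have Rd : R1 <= d by rewrite /R1 /d; lra.
have d0 : 0 < d by exact: lt_le_trans Rd.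
have Rew : 0 < complex.Re (s - 1) by rewrite cReD cReN /=; lra.
have [b0 b00 hb0] := phR_lim k Rew ltr01.
(* Beyond [b1], [nc_iph_le] applies and bounds the main term at the upper end point by 2. *)
pose b1 := Num.max b0 (2 * k%:R / nc (s - 1)).
have n0 : 0 < nc (s - 1) by exact: lt_le_trans w1.
rewrite -ler_pdivlMr//.
apply: (@dlim_le _ _ _ _ _ (expR b1) (CzP zF s1 k)) => x hx.
have x0 : 0 < x by apply: lt_le_trans hx; exact: expR_gt0.
pose b := ln x; have xb : expR b = x by rewrite lnK.
have bb1 : b1 <= b by rewrite -ler_expR xb.
have [bb0 bk] : b0 <= b /\ 2 * k%:R <= nc (s - 1) * b.
  move: bb1; rewrite /b1 ge_max => /andP[-> h]; split=> //.
  by move: h; rewrite ler_pdivrMr// [b * _]mulrC.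
have b_0 : 0 < b by exact: lt_le_trans bb0.
have gb : \sum_(g <- gs G x) ph k s (lg g) =
   ph k s 0 + \sum_(g <- gs G x | 0 < lg g <= b) (1 : R)%:C%C * ph k s (lg g).
  have x1 : mone \in gs G x.
    by rewrite mem_gs bnorm1 -xb -expR0 ler_expR ltW.
  rewrite (bigD1_seq mone)/= ?fset_uniq// lg1; congr (_ + _).
  rewrite big_seq_cond [RHS]big_seq_cond; apply: eq_big => g; last by rewrite mul1r.
  rewrite mem_gs; case: (leP (bnorm G g) x) => //= gx.
  rewrite -ler_expR expR_lg xb gx andbT.
  have [->|g1] := eqVneq g mone; first by rewrite lg1 ltxx.
  by rewrite /lg ln_gt0// bnorm_gt1.
have SM u : 0 <= u <= b -> `|\sum_(g <- gs G x | lg g <= u) (1 : R) -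
     (kappa * expR u + - kappa)| <= A * expR (theta * u).
  move=> /andP[u0 ub]; rewrite sum_gs_lg ?sum1_gs; last by rewrite -xb ler_expR.
  have := hcount (expR u); rewrite -expR0 ler_expR => /(_ u0).
  rewrite mulrBr expR0 mulr1; congr (_ <= _ * _).
  by rewrite /powR gt_eqF ?expR_gt0// expRK.
have := @Abel_ph R T (gs G x) (@lg R G) (fun=> 1) k s kappa (- kappa) A theta 0 b
  sn1 ths (ltW A0) (lexx 0) (ltW b_0) SM.
rewrite gb; set Sm := \sum_(g <- gs G x | _) _ => hS.
have i0 : nc (iph k (s - 1) 0) <= 1.
  rewrite iph_0// ncN ncV ncX invf_le1 ?exprn_gt0// exprn_ege1//.
have ib : nc (iph k (s - 1) b) <= 2.
  apply: (le_trans (nc_iph_le w0 b_0 bk)); rewrite nc_phE ?(ltW b_0)//.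
  have : 2 / nc (s - 1) <= 2 by rewrite ler_pdivrMr// ler_peMr.
  have h2 := hb0 b bb0.
  have h3 : 0 <= phR k (complex.Re (s - 1)) b by rewrite phR_ge0// ltW.
  move=> h4; have : 2 / nc (s - 1) * phR k (complex.Re (s - 1)) b <= 2 * 1 by rewrite ler_pM// divr_ge0// nc_ge0.
  lra.
have p0 : nc (ph k s 0) <= 1.
  rewrite nc_phE// /phR mulr0 expR0 mulr1 expr0n.
  by case: (k) => [|j] /=; rewrite ?fact0 ?divr1 ?mul0r.
set e := 2 * A * _ in hS; set D := kappa%:C%C * _ in hS.
have hD : nc D <= 3 * kappa.
  rewrite ncM ncR gtr0_norm// mulrC ler_wpM2r ?(ltW kappa0)//.
  by apply: (le_trans (ncB _ _)); lra.
apply: (@le_trans _ _ (1 + (3 * kappa + e))).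
  apply: (le_trans (ncD _ _)); apply: lerD => //.
  by rewrite -(subrK D Sm) (le_trans (ncD _ _))// addrC lerD.
rewrite ler_pdivlMr// addrA mulrDl lerD//.
  by rewrite ler_piMr// addr_ge0// mulr_ge0// ltW.
rewrite /e -[leLHS]mulrA; apply: ler_wpM2l; first by rewrite mulr_ge0// ltW.
rewrite -/d mulrDl.
have dk : d ^- k * R1 ^+ k <= 1.
  by rewrite mulrC ler_pdivrMr ?exprn_gt0// mul1r lerXn2r ?nnegrE ?(ltW R10) ?(ltW d0).
have dk0 : 0 <= d ^- k * R1 ^+ k by rewrite mulr_ge0 ?invr_ge0 ?exprn_ge0 ?(ltW d0)// ltW.
apply: lerD; first by rewrite -mulrA ler_piMr.
rewrite -mulrA ler_wpM2l ?nc_ge0// exprS invfM -mulrA.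
apply: (le_trans (ler_wpM2l _ dk)); first by rewrite invr_ge0 ltW.
by rewrite mulr1 lef_pV2.
Qed.

End AxiomA.

Section Window.
Variables (R : realType) (G : beurling R).
Local Notation T := (cmonom (bprime G)).
Variables (theta : R) (F : R[i] -> R[i]).
Hypothesis zF : is_zeta G theta F.

(** An upper bound for the sum of [Lambda(g) |g|^(-1-e)], through [log |g| <= (2 / e) |g|^(e/2)]. *)
Definition Lsum (e : R) := 2 / e * zr F (1 + e / 2).

Lemma sum_Lambda_npow_le (e x : R) : 0 < e ->
  \sum_(g <- gs G x) bLambda g * npow (1 + e) g <= Lsum e.
Proof.
move=> e0; have e2 : 0 < e / 2 by rewrite divr_gt0.
apply: (@le_trans _ _ (\sum_(g <- gs G x) 2 / e * npow (1 + e / 2) g)).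
  apply: ler_sum => g _.
  apply: (@le_trans _ _ (phR 1 (e / 2) (lg g) * npow (1 + e / 2) g)); last first.
    rewrite ler_wpM2r ?npow_ge0// (le_trans (phR_le 1 e2 (lg_ge0 g)))//.
    by rewrite expr1 invf_div.
  rewrite /phR /npow expr1 divr1 -mulrA -expRD.
  rewrite (_ : - (e / 2) * lg g + - (1 + e / 2) * lg g = - (1 + e) * lg g); last by field.
  by rewrite ler_wpM2r ?expR_ge0// bLambda_le.
by rewrite -mulr_sumr ler_wpM2l ?divr_ge0 ?(ltW e0)//; apply: (sum_npow_le zF); lra.
Qed.

Lemma sum_Lambda_bpsi (u : R) : \sum_(g <- gs G (expR u)) bLambda g = bpsi G (expR u).
Proof. by rewrite /bpsi fsbig_finite//; exact: bnorm_finite. Qed.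

Variables (k : nat) (s : R[i]) (de de1 lp lm beta E0 a b : R).
Hypotheses (Res : complex.Re s = 1 + de) (d1 : 0 < de1) (d1d : de1 < de).
Hypotheses (lm0 : 0 < lm) (lmd : lm <= de1) (dlp : de1 <= lp).
Hypotheses (beta1 : beta < 1 + de) (E00 : 0 <= E0) (a0 : 0 < a) (ab : a <= b).
Hypotheses (w1 : 1 <= nc (s - 1)) (ka : 2 * k%:R <= nc (s - 1) * a).
Hypothesis psiE : forall u, a <= u <= b ->
  `|bpsi G (expR u) - expR u| <= E0 * expR (beta * u).

Let Ep := lp ^- k * expR ((lp - de1) * a).
Let Em := lm ^- k * expR (- (de1 - lm) * b).
Let lp0 : 0 < lp. Proof. exact: lt_le_trans dlp. Qed.
Let b0 : 0 < b. Proof. exact: lt_le_trans ab. Qed.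

(* Rankin's trick, with exponents on either side of [de1] *)
Let low u : 0 <= u <= a -> phR k (1 + de) u <= Ep * expR (- (1 + (de - de1)) * u).
Proof.
move=> /andP[u0 ua].
have -> : phR k (1 + de) u = phR k lp u * expR ((lp - de1) * u) *
    expR (- (1 + (de - de1)) * u).
  by rewrite /phR -!mulrA -!expRD; congr (_ * (_ * expR _)); ring.
rewrite ler_wpM2r ?expR_ge0// ler_pM ?phR_ge0 ?expR_ge0 ?phR_le//.
by rewrite ler_expR ler_wpM2l// subr_ge0.
Qed.

Let high u : b <= u -> phR k (1 + de) u <= Em * expR (- (1 + (de - de1)) * u).
Proof.
move=> bu; have u0 : 0 <= u by rewrite (le_trans _ bu)// ltW.
have -> : phR k (1 + de) u = phR k lm u * expR (- (de1 - lm) * u) *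
    expR (- (1 + (de - de1)) * u).
  by rewrite /phR -!mulrA -!expRD; congr (_ * (_ * expR _)); ring.
rewrite ler_wpM2r ?expR_ge0// ler_pM ?phR_ge0 ?expR_ge0 ?phR_le//.
by rewrite ler_expR !mulNr lerN2 ler_wpM2l// subr_ge0.
Qed.

Let w0 : s - 1 != 0.
Proof. by rewrite -nc_eq0 gt_eqF// (lt_le_trans _ w1). Qed.

Let Rew : complex.Re (s - 1) = de.
Proof. by rewrite cReD cReN Res /=; ring. Qed.

Let iph_small u e : 0 < u -> 2 * k%:R <= nc (s - 1) * u ->
  phR k (1 + de) u <= e * expR (- (1 + (de - de1)) * u) -> 
  nc (iph k (s - 1) u) <= 2 * e.
Proof.
move=> u0 ku h; apply: (le_trans (nc_iph_le w0 u0 ku)).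
rewrite nc_phE ?(ltW u0)// Rew.
have p0 := phR_ge0 k de (ltW u0).
have h1 : 2 / nc (s - 1) <= 2.
  by rewrite ler_pdivrMr ?ler_peMr// (lt_le_trans _ w1).
apply: (@le_trans _ _ (2 * phR k de u)); first by rewrite ler_wpM2r.
rewrite ler_wpM2l//.
have -> : phR k de u = phR k (1 + de) u * expR u.
  by rewrite /phR -[RHS]mulrA -expRD; congr (_ * expR _); ring.
apply: (le_trans (ler_wpM2r (expR_ge0 _) h)).
have e0 : 0 <= e.
  by rewrite -(pmulr_lge0 _ (expR_gt0 (- (1 + (de - de1)) * u))) (le_trans _ h)// phR_ge0// ltW.
rewrite -mulrA -expRD ler_piMr// expR_le1.
rewrite (_ : _ + u = - (de - de1) * u); last by ring.
by rewrite mulNr oppr_le0 mulr_ge0 ?subr_ge0 ?(ltW u0)// ltW.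
Qed.

Let tail_sum (P : pred T) e x : 0 <= e ->
  (forall g, P g -> phR k (1 + de) (lg g) <= e * expR (- (1 + (de - de1)) * lg g)) ->
  nc (\sum_(g <- gs G x | P g) (bLambda g)%:C%C * ph k s (lg g)) <= Lsum (de - de1) * e.
Proof.
move=> e0 hP; apply: (le_trans (nc_sum _ _ _)).
have dd : 0 < de - de1 by rewrite subr_gt0.
apply: (@le_trans _ _ (\sum_(g <- gs G x) bLambda g * npow (1 + (de - de1)) g * e)); last first.
  by rewrite -mulr_suml ler_wpM2r// sum_Lambda_npow_le.
rewrite big_mkcond; apply: ler_sum => g _; case: ifPn => Pg; last first.
  by rewrite !mulr_ge0 ?bLambda_ge0 ?npow_ge0.
rewrite (ncM _ (ph k s (lg g))) ncR ger0_norm ?bLambda_ge0// nc_phE ?lg_ge0// Res -mulrA.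
by rewrite ler_wpM2l ?bLambda_ge0// mulrC; exact: hP.
Qed.

(** On [a < log |g| <= b] partial summation against [psi] gives the first term. [Ep] and [Em] bound
    the weight below [a] and above [b], relative to [|g|^-(1 + de - de1)], by Rankin's trick; the
    end-point values of the main term are of the same size, which accounts for the [+ 2]. *)
Theorem Bz_window : nc (Bz G k s) <=
  2 * E0 * (3 * (1 + de - beta) ^- k + nc s * (1 + de - beta) ^- k.+1) +
  (Lsum (de - de1) + 2) * (Ep + Em).
Proof.
have s1 : 1 < complex.Re s by rewrite Res; have := d1; have := d1d; lra.
have Ep0 : 0 <= Ep by rewrite mulr_ge0 ?expR_ge0// invr_ge0 exprn_ge0// ltW.
have Em0 : 0 <= Em by rewrite mulr_ge0 ?expR_ge0// invr_ge0 exprn_ge0// ltW.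
apply: (@dlim_le _ _ _ _ _ (expR b) (BzP zF s1 k)) => x bx.
pose f (g : T) := (bLambda g)%:C%C * ph k s (lg g).
have -> : \sum_(g <- gs G x) (bLambda g)%:C%C * ph k s (lg g) =
  \sum_(g <- gs G x | lg g <= a) f g + (\sum_(g <- gs G x | a < lg g <= b) f g +
    \sum_(g <- gs G x | b < lg g) f g).
  rewrite (bigID (fun g => lg g <= a))/=; congr (_ + _).
  rewrite (bigID (fun g => lg g <= b))/=; congr (_ + _); apply: eq_bigl => g.
    by rewrite ltNge.
  rewrite -!ltNge andb_idl// => /(le_lt_trans ab)//.
have h1 : nc (\sum_(g <- gs G x | lg g <= a) f g) <= Lsum (de - de1) * Ep.
  by apply: tail_sum => // g ga; apply: low; rewrite lg_ge0.
have h3 : nc (\sum_(g <- gs G x | b < lg g) f g) <= Lsum (de - de1) * Em.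
  by apply: tail_sum => // g /ltW; exact: high.
have SM u : a <= u <= b ->
   `|\sum_(g <- gs G x | lg g <= u) bLambda g - (1 * expR u + 0)| <= E0 * expR (beta * u).
  move=> /[dup] /andP[_ ub] aub; rewrite sum_gs_lg; last first.
    by rewrite (le_trans _ bx)// ler_expR.
  by rewrite sum_Lambda_bpsi mul1r addr0 psiE.
have sn1 : s != 1 by rewrite -subr_eq0.
have bs : beta < complex.Re s by rewrite Res.
have := @Abel_ph R T (gs G x) (@lg R G) (@bLambda R G) k s 1 0 E0 beta a b
  sn1 bs E00 (ltW a0) ab SM.
rewrite mul1r Res -/(f _) => h2.
have ia : nc (iph k (s - 1) a) <= 2 * Ep.
  by apply: iph_small => //; apply: low; rewrite lexx ltW.
have ib : nc (iph k (s - 1) b) <= 2 * Em.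
  apply: iph_small => //; last by apply: high.
  by rewrite (le_trans ka)// ler_wpM2l ?nc_ge0.
set S1 := \sum_(g <- gs G x | lg g <= a) _ in h1 *.
set S3 := \sum_(g <- gs G x | b < lg g) _ in h3 *.
set S2 := \sum_(g <- gs G x | a < lg g <= b) _ in h2 *.
have h2' : nc S2 <= 2 * E0 * (3 * (1 + de - beta) ^- k + nc s * (1 + de - beta) ^- k.+1)
   + (2 * Em + 2 * Ep).
  rewrite -(subrK (iph k (s - 1) b - iph k (s - 1) a) S2) (le_trans (ncD _ _))//.
  by rewrite lerD// (le_trans (ncB _ _))// lerD.
apply: (le_trans (ncD _ _)); apply: (le_trans (lerD (lexx _) (ncD _ _))).
lra.
Qed.

End Window.

(** * The Taylor series at [s0] vanishes at the zero *)

Section PowerSeries.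
Variable R : realType.

Lemma real_series_exists (u : nat -> R) (M : R) :
  (forall k, `|u k| <= M * 2^-1 ^+ k) -> exists l, forall K,
  `|l - \sum_(k < K) u k| <= 2 * M * 2^-1 ^+ K.
Proof.
move=> uM; pose v k := u k + M * 2^-1 ^+ k.
have geo n : \sum_(k < n) M * 2^-1 ^+ k = 2 * M - 2 * M * 2^-1 ^+ n.
  elim: n => [|n IH]; first by rewrite big_ord0 expr0 mulr1 subrr.
  by rewrite big_ord_recr/= IH exprS; field.
have TE n : \sum_(k < n) v k = \sum_(k < n) u k + (2 * M - 2 * M * 2^-1 ^+ n).
  by rewrite big_split/= geo.
have v0 k : 0 <= v k <= 2 * (M * 2^-1 ^+ k).
  by have := uM k; rewrite /v ler_norml; lra.
have up n m : \sum_(k < n) v k <= \sum_(k < n + m) v k <=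
    \sum_(k < n) v k + 4 * M * 2^-1 ^+ n - 4 * M * 2^-1 ^+ (n + m).
  elim: m => [|m IH]; first by rewrite addn0 lexx/=; lra.
  rewrite addnS big_ord_recr/= exprS; have := v0 (n + m)%N; have := IH; lra.
have M0 : 0 <= M by have := le_trans (normr_ge0 _) (uM 0%N); rewrite expr0 mulr1.
have p0 n : 0 <= 4 * M * 2^-1 ^+ n by rewrite mulr_ge0 ?exprn_ge0// mulr_ge0.
pose A := range (fun n => \sum_(k < n) v k).
have ubA n : ubound A (\sum_(k < n) v k + 4 * M * 2^-1 ^+ n).
  move=> _ [m _ <-]; have [nm|mn] := leqP n m.
    have := up n (m - n)%N; rewrite subnKC// => /andP[_ h].
    by have := p0 m; lra.
  have := up m (n - m)%N; rewrite subnKC ?(ltnW mn)// => /andP[h _].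
  by have := p0 n; lra.
have hA : has_sup A.
  by split; [exists (\sum_(k < 0) v k); exists 0%N|eexists; exact: (ubA 0%N)].
exists (sup A - 2 * M) => K.
have h1 : \sum_(k < K) v k <= sup A by apply: ub_le_sup; [case: hA|exists K].
have h2 : sup A <= \sum_(k < K) v k + 4 * M * 2^-1 ^+ K.
  by apply: ge_sup; [case: hA|exact: ubA].
by move: h1 h2; rewrite TE ler_norml; lra.
Qed.

Lemma series_exists (c : nat -> R[i]) (M : R) :
  (forall k, nc (c k) <= M * 2^-1 ^+ k) -> exists l, forall K,
  nc (l - \sum_(k < K) c k) <= 4 * M * 2^-1 ^+ K.
Proof.
move=> cM.
have [l1 h1] := real_series_exists (fun k => le_trans (nc_Re (c k)) (cM k)).
have [l2 h2] := real_series_exists (fun k => le_trans (nc_Im (c k)) (cM k)).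
exists (Complex l1 l2) => K; apply: (le_trans (nc_ReIm _)).
rewrite cReD cImD cReN cImN cRe_sum cIm_sum /=.
by have := h1 K; have := h2 K; lra.
Qed.

End PowerSeries.

Section Identification.
Variables (R : realType) (G : beurling R).
Variables (theta : R) (F : R[i] -> R[i]).
Hypothesis zF : is_zeta G theta F.

Variables (s0 : R[i]) (de d M : R).
Hypotheses (Res : complex.Re s0 = 1 + de) (de0 : 0 < de) (ded : de <= d).
Hypotheses (dde : 100 * d <= 104 * de) (d4 : 4 * d <= 1 - theta).
Hypotheses (Ims : de <= `|complex.Im s0|) (Fs0 : F (s0 - d%:C%C) = 0).
Hypothesis CM : forall k, nc (Cz G k s0) * (1 - theta) ^+ k <= M.

(** The right edge of the rectangle passes through [d]; the ratio 3 is the one of [edge_uniqueness].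
    As [d <= 1.04 de], the half-height [h] is at most [0.42 de], and [0.9^2 + 0.42^2 < 1] puts the
    whole left edge inside the disc [|z| < de]. Since [h < de <= |Im s0|], the pole is avoided
    too. *)
Let a := 9 / 10 * de.
Let h := 3 * (d - a).
Let R10 : 0 < 1 - theta. Proof. by have := de0; have := ded; have := d4; lra. Qed.

Let rect z := in_rect a d (- h) h z.

Let term_le z k : rect z -> nc (Cz G k s0 * z ^+ k) <= M * 2^-1 ^+ k.
Proof.
move=> [/andP[z1 z2] /andP[z3 z4]].
have hz : nc z <= (1 - theta) / 2.
  apply: (le_trans (nc_ReIm _)).
  have h1 : `|complex.Re z| <= d.
    by rewrite ger0_norm//; move: z1; rewrite /a; have := de0; lra.
  have h2 : `|complex.Im z| <= h by rewrite ler_norml z3.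
  by move: h2; rewrite /h /a; have := dde; have := d4; have := ded; lra.
rewrite ncM ncX; apply: (le_trans (ler_wpM2l (nc_ge0 _) (_ : _ <= ((1 - theta) / 2) ^+ k))).
  by rewrite lerXn2r ?nnegrE ?nc_ge0// (le_trans (nc_ge0 z)).
by rewrite exprMn mulrA ler_wpM2r ?exprn_ge0.
Qed.

Let f (z : R[i]) : R[i] := xget 0 [set l | forall K,
  nc (l - \sum_(k < K) Cz G k s0 * z ^+ k) <= 4 * M * 2^-1 ^+ K].

Let fP z : rect z -> forall K,
  nc (f z - \sum_(k < K) Cz G k s0 * z ^+ k) <= 4 * M * 2^-1 ^+ K.
Proof.
move=> zr; have [l hl] := series_exists (fun k => term_le k zr).
exact: (@xgetPex _ 0 [set l | forall K,
  nc (l - \sum_(k < K) Cz G k s0 * z ^+ k) <= 4 * M * 2^-1 ^+ K] (ex_intro _ l hl)).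
Qed.

Let ad : a < d. Proof. by rewrite /a; have := de0; have := ded; lra. Qed.

Let cdiff_refl z : rect z -> cdiff (fun z => F (s0 - z)) z.
Proof.
move=> [/andP[z1 z2] /andP[z3 z4]].
have [||D hD] := @zeta_cdiff _ _ _ _ zF (s0 - z).
- by rewrite cReD cReN Res; have := d4; have := de0; have := ded; lra.
- apply/eqP => /(congr1 (@complex.Im R)); rewrite cImD cImN /= => Iz.
  have E : complex.Im s0 = complex.Im z by lra.
  have : `|complex.Im s0| <= h by rewrite E ler_norml z3.
  by have := Ims; have := dde; have := de0; rewrite /h /a; lra.
exists (- D) => e e0; have [r r0 hr] := hD e e0; exists r => // w wr.
have := hr (- w); rewrite ncN => /(_ wr); congr (nc _ <= _).
by rewrite mulrN mulNr opprD addrA.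
Qed.

(* The power series represents F (s0 - z) only for |z| < de; the identity is
   carried to the zero z = d by [edge_uniqueness]. *)
Lemma zeta_power_series_zero : forall e : R, 0 < e -> exists N0 : nat, forall N : nat,
  (N0 <= N)%N -> nc (\sum_(k < N) Cz G k s0 * d%:C%C ^+ k) < e.
Proof.
have M0 : 0 <= M by have := CM 0; rewrite expr0 mulr1; apply: le_trans; exact: nc_ge0.
pose H z := F (s0 - z) - f z.
have Happ : cdiff_approx H a d (- h) h.
  move=> e e0; have [K hK] := half_pow_lim (4 * M) e0.
  exists (fun z => F (s0 - z) + (-1) * \sum_(k < K) Cz G k s0 * z ^+ k).
    move=> z zr; apply: cdiffD; first exact: cdiff_refl.
    apply: cdiffM; first exact: cdiff_cst.
    apply: (@cdiff_sum R K (fun k z => Cz G k s0 * z ^+ k)) => k.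
    by apply: cdiffM; [exact: cdiff_cst|apply: cdiffX; exact: cdiff_id].
  move=> z zr; apply: le_trans (hK K (leqnn _)).
  rewrite ncBC; apply: le_trans (fP zr K).
  by rewrite le_eqVlt; apply/orP; left; apply/eqP; congr nc; rewrite /H; ring.
have Hedge y : - h <= y <= h -> H (Complex a y) = 0.
  move=> yh; pose z := Complex a y; have zr : rect z by split; rewrite /= ?lexx ?(ltW ad).
  have zde : nc z < de.
    rewrite -(@ltr_pXn2r _ 2%N) ?nnegrE ?nc_ge0 ?(ltW de0)// nc_sqr /=.
    have y2 : y ^+ 2 <= h ^+ 2.
      by rewrite -real_normK ?num_real// lerXn2r ?nnegrE ?ler_norml//; move: yh; lra.
    have h2 : h ^+ 2 <= (42 / 100 * de) ^+ 2.
      rewrite lerXn2r ?nnegrE// /h /a; have := ded; have := dde; have := de0; lra.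
    have q0 : 0 < de ^+ 2 by rewrite exprn_gt0.
    have e1 : (42 / 100 * de) ^+ 2 = 1764 / 10000 * de ^+ 2 by rewrite exprMn; field.
    have e2 : a ^+ 2 = 81 / 100 * de ^+ 2 by rewrite /a exprMn; field.
    by rewrite e2; lra.
  have sz : 1 < complex.Re s0 - nc z by rewrite Res; lra.
  apply/eqP; rewrite -nc_eq0 eq_le nc_ge0 andbT; apply/ler_addgt0Pr => e e0.
  have e2 : 0 < e / 2 by rewrite divr_gt0.
  have [K1 h1] := zeta_Taylor zF sz e2.
  have [K2 h2] := half_pow_lim (4 * M) e2.
  have := h1 _ (leq_maxl K1 K2); have := h2 _ (leq_maxr K1 K2); have := fP zr (maxn K1 K2).
  set Sm := \sum_(k < _) _ => k1 k2 k3.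
  rewrite /H -/z (_ : _ - f z = (F (s0 - z) - Sm) - (f z - Sm)); last by ring.
  by apply: (le_trans (ncB _ _)); lra.
have := edge_uniqueness ad Happ Hedge; rewrite /H (_ : Complex d 0 = d%:C%C)// Fs0 sub0r.
move=> /eqP; rewrite oppr_eq0 => /eqP f0 e e0.
have e2 : 0 < e / 2 by rewrite divr_gt0.
have [K hK] := half_pow_lim (4 * M) e2.
exists K => N /hK h1.
have dr : rect d%:C%C.
  split; rewrite /= ?lexx ?(ltW ad)//; rewrite /h; have := ad; lra.
by have := fP dr N; rewrite f0 sub0r ncN; lra.
Qed.

End Identification.

(** * Choice of the parameters *)

Section RankinBase.
Variable R : realType.

Lemma expR_inv_bound (y : R) : expR y * (1 - y) <= 1.
Proof.
have := expR_ge1Dx (- y); rewrite expRN => h.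
by rewrite mulrC -ler_pdivlMr ?expR_gt0// div1r.
Qed.

(** With [y = s/2 (1 - s)] and [e^y <= 1 / (1 - y)], the terms of first order in [s] cancel:
    [(1 + s/2) (1 - y) = 1 + s^2/4 + s^3/4]. This gain exceeds the loss [1 + s^2/16] from [d / de1]
    and leaves [s^2/64]. On the high side the product is [1 + s^2/4 - s^3/4]. *)
Lemma rankin_low (s d de1 : R) : 0 < s -> s <= 1 / 6 -> 0 < d -> 0 < de1 ->
  d <= (1 + s ^+ 2 / 16) * de1 ->
  d / (de1 * (1 + s / 2)) * expR (s / 2 * (1 - s)) <= expR (- (s ^+ 2 / 64)).
Proof.
move=> s0 s6 d0 de0 dde; set y := s / 2 * (1 - s).
have s2 : 0 < s ^+ 2 by rewrite exprn_gt0.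
have ss : s ^+ 2 <= 1 / 36.
  have -> : (1 / 36 : R) = (1 / 6) ^+ 2 by rewrite exprMn; field.
  by rewrite lerXn2r ?nnegrE// ?divr_ge0// ltW.
apply: (@le_trans _ _ (1 - s ^+ 2 / 64)); last first.
  by apply: le_trans (expR_ge1Dx _); rewrite lexx.
have y1 : 0 < 1 - y by rewrite /y; nra.
have l0 : 0 < de1 * (1 + s / 2) by rewrite mulr_gt0//; lra.
rewrite mulrAC ler_pdivrMr//.
have X : expR y <= (1 - y)^-1 by rewrite -div1r ler_pdivlMr// expR_inv_bound.
apply: (le_trans (ler_wpM2l (ltW d0) X)); rewrite ler_pdivrMr//.
apply: (le_trans dde).
have -> : (1 - s ^+ 2 / 64) * (de1 * (1 + s / 2)) * (1 - y) =
   ((1 - s ^+ 2 / 64) * (1 + s ^+ 2 / 4 + s ^+ 3 / 4)) * de1.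
  by rewrite /y; field.
rewrite ler_wpM2r ?(ltW de0)//.
have s3 : 0 <= s ^+ 3 by rewrite exprn_ge0// ltW.
have h : s ^+ 2 * s ^+ 2 <= s ^+ 2 * (1 / 36) by rewrite ler_wpM2l// ltW.
apply: (@le_trans _ _ ((1 - s ^+ 2 / 64) * (1 + s ^+ 2 / 4))).
  have : (1 - s ^+ 2 / 64) * (1 + s ^+ 2 / 4) =
    1 + s ^+ 2 / 4 - s ^+ 2 / 64 - s ^+ 2 * s ^+ 2 / 256 by field.
  lra.
rewrite ler_wpM2l//; lra.
Qed.

Lemma rankin_high (s d de1 : R) : 0 < s -> s <= 1 / 6 -> 0 < d -> 0 < de1 ->
  d <= (1 + s ^+ 2 / 16) * de1 ->
  d / (de1 * (1 - s / 2)) * expR (- (s / 2 * (1 + s))) <= expR (- (s ^+ 2 / 64)).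
Proof.
move=> s0 s6 d0 de0 dde; set y := s / 2 * (1 + s).
have s2 : 0 < s ^+ 2 by rewrite exprn_gt0.
have ss : s ^+ 2 <= 1 / 36.
  have -> : (1 / 36 : R) = (1 / 6) ^+ 2 by rewrite exprMn; field.
  by rewrite lerXn2r ?nnegrE// ?divr_ge0// ltW.
apply: (@le_trans _ _ (1 - s ^+ 2 / 64)); last first.
  by apply: le_trans (expR_ge1Dx _); rewrite lexx.
have y1 : 0 < 1 + y by rewrite /y; nra.
have l0 : 0 < de1 * (1 - s / 2) by rewrite mulr_gt0//; lra.
rewrite mulrAC ler_pdivrMr//.
have X : expR (- y) <= (1 + y)^-1.
  by have := expR_inv_bound (- y); rewrite opprK -div1r ler_pdivlMr.
apply: (le_trans (ler_wpM2l (ltW d0) X)); rewrite ler_pdivrMr//.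
apply: (le_trans dde).
have -> : (1 - s ^+ 2 / 64) * (de1 * (1 - s / 2)) * (1 + y) =
   ((1 - s ^+ 2 / 64) * (1 + s ^+ 2 / 4 - s ^+ 2 * s / 4)) * de1.
  by rewrite /y; field.
rewrite ler_wpM2r ?(ltW de0)//.
have h : s ^+ 2 * s ^+ 2 <= s ^+ 2 * (1 / 36) by rewrite ler_wpM2l// ltW.
have h3 : s ^+ 2 * s <= s ^+ 2 * (1 / 6) by rewrite ler_wpM2l// ltW.
apply: (@le_trans _ _ ((1 - s ^+ 2 / 64) * (1 + s ^+ 2 / 8))).
  have : (1 - s ^+ 2 / 64) * (1 + s ^+ 2 / 8) =
    1 + s ^+ 2 / 8 - s ^+ 2 / 64 - s ^+ 2 * s ^+ 2 / 512 by field.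
  lra.
rewrite ler_wpM2l//; lra.
Qed.

Lemma rankin_pow (d lam mu c E : R) k : 0 < d -> 0 < lam -> E <= mu * k%:R ->
  d / lam * expR mu <= expR (- c) ->
  d ^+ k * (lam ^- k * expR E) <= expR (- (c * k%:R)).
Proof.
move=> d0 l0 Ek h.
apply: (@le_trans _ _ ((d / lam * expR mu) ^+ k)).
  rewrite exprMn expr_div_n mulrA ler_wpM2l ?divr_ge0 ?exprn_ge0 ?(ltW d0) ?(ltW l0)//.
  by rewrite -expRM_natl ler_expR mulrC.
have -> : - (c * k%:R) = k%:R * - c by ring.
rewrite expRM_natl lerXn2r ?nnegrE ?expR_ge0//.
by rewrite mulr_ge0 ?expR_ge0// divr_ge0// ltW.
Qed.

End RankinBase.

(* For k as in [Bz_small] the weights u^k / k! e^(- de u) are concentrated at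
   k / de, inside [(1 - e) L, L]; replacing de by the slightly smaller rdelta
   leaves room for Rankin's trick outside this window. *)
Definition rdelta (R : realType) (e de : R) : R := (1 - (e / 3) ^+ 2 / 64) * de.

(** In [Bz_window] with Rankin exponents [de1 (1 + e/6)] and [de1 (1 - e/6)], the window contributes
    at most [10 T^-e] in units of [d^(-k-1)], the factor [|s| <= 2 T] being paid by [T^-(1+e)]. The
    rest is exponentially small in [k], hence below [T^-e] as [log T <= eta L]. *)
Theorem Bz_small (R : realType) (G : beurling R) (theta : R) (F : R[i] -> R[i])
    (e de : R) : is_zeta G theta F -> 0 < e -> e <= 1 / 2 -> 0 < de -> de <= 1 / 16 ->
  exists2 eta, 0 < eta & exists L0, forall (L beta gamma : R),
  let T := nc (Complex beta gamma) in
  L0 <= L -> 5 <= T -> ln T <= eta * L -> 0 < beta < 1 -> 1 - beta <= eta ->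
  (forall u, (1 - e) * L <= u <= L ->
    `|bpsi G (expR u) - expR u| <= expR (- (1 + e) * ln T) * expR (beta * u)) ->
  forall k : nat, (1 - 2 * (e / 3)) * (rdelta e de * L) <= k%:R <=
    (1 - e / 3) * (rdelta e de * L) ->
  nc (Bz G k (Complex (1 + de) gamma)) * (1 + de - beta) ^+ k.+1 <=
    11 * expR (- e * ln T).
Proof.
move=> zF e0' e2' de0 de16'; set de1 := rdelta e de; pose s := e / 3.
have s0 : 0 < s by rewrite divr_gt0.
have s6' : s <= 1 / 6 by rewrite /s; lra.
have ss0 : 0 < s ^+ 2 by rewrite exprn_gt0.
have ss' : s ^+ 2 <= 1 / 36.
  have -> : (1 / 36 : R) = (1 / 6) ^+ 2 by rewrite exprMn; field.
  by rewrite lerXn2r ?nnegrE// ?divr_ge0// ltW.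
have d10 : 0 < de1 by rewrite mulr_gt0// -/s; lra.
have d1d : de1 < de by rewrite gtr_pMl// -/s; lra.
rewrite -/s.
pose c := s ^+ 2 / 64; have c0 : 0 < c by rewrite divr_gt0.
pose Ls := Lsum F (de - de1).
have Ls0 : 0 <= Ls.
  rewrite mulr_ge0 ?divr_ge0 ?subr_ge0 ?(ltW d1d)//.
  have h : 1 < 1 + (de - de1) / 2 by have := d1d; lra.
  by apply: le_trans (sum_npow_le zF fset0 h); rewrite big_nil.
have cd0 : 0 < c * de1 / 3 by rewrite divr_gt0// mulr_gt0.
(* The tails decay at least like [e^(-2/3 c de1 L)]. Half of this exponent pays for [T^e], which
   fixes [eta], and the other half for the constant [2 (Ls + 2)], which fixes [L0]. *)
exists (c * de1 / 3) => //; exists ((2 * (Ls + 2)) / (c * de1 / 3) + 1) => L beta gamma T.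
move=> L0 T5 TL /andP[beta0 beta1] beta2 psiE k /andP[k1 k2].
pose t := ln T.
have T0 : 0 < T by lra.
have t0 : 0 <= t by rewrite ln_ge0//; lra.
have Lpos : 1 <= L.
  by apply: le_trans L0; rewrite lerDr divr_ge0 ?(ltW cd0)// mulr_ge0// addr_ge0.
have cL : 2 * (Ls + 2) <= c * de1 / 3 * L.
  by rewrite [leRHS]mulrC -ler_pdivrMr//; clear -L0; lra.
set d := 1 + de - beta.
have d0 : 0 < d by rewrite /d; clear -beta1 de0; lra.
have d_1 : d <= 1.
  have : c * de1 / 3 <= 1 / 16.
    have c1 : c <= 1 by rewrite /c; clear -ss'; lra.
    have : c * de1 <= 1 * de1 by rewrite ler_wpM2r// ltW.
    by clear -d1d de16'; lra.
  by clear -beta2 de16'; rewrite /d; lra.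
have dde : d <= (1 + s ^+ 2 / 16) * de1.
  have h1 : c * de1 / 3 <= s ^+ 2 / 192 * de.
    have : c * de1 <= c * de by rewrite ler_wpM2l// ltW.
    by rewrite /c; clear; lra.
  have h2 : (1 + s ^+ 2 / 16) * de1 = (1 + s ^+ 2 / 16 - s ^+ 2 / 64 - s ^+ 2 * s ^+ 2 / 1024) * de.
    by rewrite /de1 /rdelta -/s; field.
  have h3 : s ^+ 2 * s ^+ 2 <= s ^+ 2 * (1 / 36) by rewrite ler_wpM2l// ltW.
  rewrite h2; apply: (@le_trans _ _ ((1 + s ^+ 2 / 192) * de)).
    by rewrite /d; clear -beta2 h1; lra.
  by rewrite ler_wpM2r ?(ltW de0)//; clear -h3 ss0; lra.
pose sig := Complex (1 + de) gamma.
have gT : T - 1 <= `|gamma|.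
  have := nc_ReIm (Complex beta gamma); rewrite -/T /= (ger0_norm (ltW beta0)); clear -beta1; lra.
have w4 : 4 <= nc (sig - 1).
  apply: le_trans (nc_Im _); rewrite cImD cImN /= subr0; clear -gT T5; lra.
have w1 : 1 <= nc (sig - 1) by clear -w4; lra.
have a0 : 0 < (1 - e) * L by rewrite mulr_gt0//; [clear -e2'|clear -Lpos]; lra.
have ab : (1 - e) * L <= L by rewrite ler_piMl//; [clear -Lpos|clear -e0']; lra.
have d1L0 : 0 < de1 * L by rewrite mulr_gt0//; clear -Lpos; lra.
have d1L : de1 * L <= L by rewrite ler_piMl//; [clear -Lpos|clear -d1d de16']; lra.
have kL : k%:R <= L.
  by apply: (le_trans k2); apply: le_trans d1L; rewrite ler_piMl ?(ltW d1L0)//; clear -s0; lra.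
have ka : 2 * k%:R <= nc (sig - 1) * ((1 - e) * L).
  apply: (@le_trans _ _ (4 * ((1 - e) * L))); last by rewrite ler_wpM2r// ltW.
  have this : 1 / 2 * L <= (1 - e) * L by rewrite ler_wpM2r//; [clear -Lpos|clear -e2']; lra.
  clear -this kL; lra.
have lm0 : 0 < de1 * (1 - s / 2) by rewrite mulr_gt0//; clear -s6'; lra.
have lp0 : 0 < de1 * (1 + s / 2) by rewrite mulr_gt0//; clear -s0; lra.
have lmd : de1 * (1 - s / 2) <= de1 by rewrite ler_piMr ?(ltW d10)//; clear -s0; lra.
have dlp : de1 <= de1 * (1 + s / 2) by rewrite ler_peMr ?(ltW d10)//; clear -s0; lra.
have bd : beta < 1 + de by clear -beta1 de0; lra.
have := @Bz_window _ G _ _ zF k sig de de1 (de1 * (1 + s / 2)) (de1 * (1 - s / 2)) beta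
  (expR (- (1 + e) * t)) ((1 - e) * L) L (erefl _) d10 d1d lm0 lmd dlp bd (expR_ge0 _) a0 ab
  w1 ka psiE.
rewrite -/d -/Ls; set Ep := _ ^- k * _; set Em := _ ^- k * _ => hB.
have Ep_le : d ^+ k * Ep <= expR (- (c * k%:R)).
  apply: rankin_pow => //; last exact: rankin_low.
  have -> : (de1 * (1 + s / 2) - de1) * ((1 - e) * L) = s / 2 * ((1 - e) * (de1 * L)) by ring.
  rewrite -[leRHS]mulrA; apply: ler_wpM2l; first by rewrite divr_ge0// ltW.
  have h : (1 - s) * ((1 - 2 * s) * (de1 * L)) <= (1 - s) * k%:R.
    by rewrite ler_wpM2l//; clear -s6'; lra.
  apply: le_trans h; rewrite mulrA ler_wpM2r ?(ltW d1L0)//.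
  have : (1 - s) * (1 - 2 * s) = 1 - 3 * s + 2 * s ^+ 2 by ring.
  have es : e = 3 * s by rewrite /s; field.
  by clear -ss0 es; lra.
have Em_le : d ^+ k * Em <= expR (- (c * k%:R)).
  apply: rankin_pow => //; last exact: rankin_high.
  have -> : - (de1 - de1 * (1 - s / 2)) * L = - (s / 2 * (de1 * L)) by field.
  rewrite mulNr lerN2 -[leLHS]mulrA; apply: ler_wpM2l; first by rewrite divr_ge0// ltW.
  have h : (1 + s) * k%:R <= (1 + s) * ((1 - s) * (de1 * L)).
    by rewrite ler_wpM2l//; clear -s0; lra.
  apply: (le_trans h); rewrite mulrA ler_piMl ?(ltW d1L0)//.
  have : (1 + s) * (1 - s) = 1 - s ^+ 2 by ring.
  by clear -ss0; lra.
have dk0 : 0 <= d ^+ k.+1 by rewrite exprn_ge0// ltW.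
apply: (le_trans (ler_wpM2r dk0 hB)).
have ET : expR (- (1 + e) * t) * T = expR (- e * t).
  by rewrite -[X in _ * X](@lnK _ T)// -expRD; congr expR; rewrite -/t; ring.
have et0 := expR_ge0 (- (1 + e) * t).
have nT : nc sig <= 2 * T.
  apply: (le_trans (nc_ReIm _)) => /=.
  have := nc_Im (Complex beta gamma); rewrite -/T /= (ger0_norm (_ : 0 <= 1 + de)).
    by clear -de16' T5; lra.
  by clear -de0; lra.
have main : 2 * expR (- (1 + e) * t) * (3 / d ^+ k + nc sig / d ^+ k.+1) * d ^+ k.+1 <=
    10 * expR (- e * t).
  have -> : 2 * expR (- (1 + e) * t) * (3 / d ^+ k + nc sig / d ^+ k.+1) * d ^+ k.+1 =
    expR (- (1 + e) * t) * (2 * (3 * d + nc sig)).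
    by rewrite exprS; field; rewrite expf_neq0 gt_eqF.
  rewrite -ET [leRHS]mulrCA ler_wpM2l//; clear -d_1 nT T5; lra.
have tails : (Ls + 2) * (Ep + Em) * d ^+ k.+1 <= expR (- e * t).
  have Ls2 : 0 <= Ls + 2 by rewrite addr_ge0.
  have -> : (Ls + 2) * (Ep + Em) * d ^+ k.+1 =
    (Ls + 2) * ((d ^+ k * Ep + d ^+ k * Em) * d) by rewrite exprS; ring.
  have ck := expR_ge0 (- (c * k%:R)).
  have Epm : 0 <= d ^+ k * Ep + d ^+ k * Em.
    by rewrite -mulrDr mulr_ge0 ?exprn_ge0 ?(ltW d0)// addr_ge0// mulr_ge0 ?expR_ge0// invr_ge0 exprn_ge0// ltW.
  apply: (@le_trans _ _ ((Ls + 2) * (2 * expR (- (c * k%:R))))).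
    rewrite ler_wpM2l// (le_trans (ler_piMr Epm d_1))//; clear -Ep_le Em_le; lra.
  have h1 : c * k%:R >= c * de1 / 3 * L + e * t.
    have p1 : c * ((1 - 2 * s) * (de1 * L)) <= c * k%:R by rewrite ler_wpM2l// ltW.
    have p2 : c * (2 / 3 * (de1 * L)) <= c * ((1 - 2 * s) * (de1 * L)).
      by rewrite ler_wpM2l ?(ltW c0)// ler_wpM2r ?(ltW d1L0)//; clear -s6'; lra.
    have p3 : e * t <= 1 * t by rewrite ler_wpM2r//; clear -e2'; lra.
    by clear -p1 p2 p3 TL; rewrite -/t in TL; lra.
  apply: (@le_trans _ _ ((Ls + 2) * (2 * expR (- (c * de1 / 3 * L + e * t))))).
    by rewrite !ler_wpM2l// ler_expR lerN2.
  have cL' : 2 * (Ls + 2) <= expR (c * de1 / 3 * L).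
    by apply: (le_trans cL); apply: le_trans (expR_ge1Dx _); rewrite lerDr.
  move: cL'; set y := c * de1 / 3 * L => cL'.
  rewrite opprD expRD mulNr (_ : _ * (2 * _) = 2 * (Ls + 2) / expR y * expR (- (e * t))).
    by rewrite ler_piMl ?expR_ge0// ler_pdivrMr ?expR_gt0// mul1r.
  by rewrite (expRN y); ring.
rewrite mulrDl; apply: (le_trans (lerD main tails)); rewrite -/t; clear; lra.
Qed.

Section Numerics.
Variable R : realType.

(** The window has length [e y / 3]. Taking [q] just below [e y / (9 n)] bounds both [q n] and the
    rounding error [q] by [e y / 9], so [q (m + n)] stays inside, and makes [m = O(n / e)]. *)
Lemma window_params (e y : R) (n : nat) : 0 < e -> e <= 1 / 2 -> (0 < n)%N ->
  9 * n%:R <= e * y -> exists q m : nat, [/\ (0 < q)%N,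
    (1 - 2 * (e / 3)) * y <= q%:R * m%:R,
    q%:R * (m%:R + n%:R) <= (1 - e / 3) * y & m%:R <= 18 / e * n%:R + 1].
Proof.
move=> e0 e2 n0 ny; have n0' : 1 <= n%:R :> R by rewrite ler1n.
have y0 : 0 < y.
  by rewrite -(pmulr_rgt0 _ e0) (lt_le_trans _ ny)// mulr_gt0//; clear -n0'; lra.
pose X := e * y / (9 * n%:R).
have n9 : 0 < 9 * n%:R :> R by clear -n0'; lra.
have X1 : 1 <= X by rewrite ler_pdivlMr// mul1r.
have /andP[qX Xq] := truncn_itv (le_trans ler01 X1).
set q := Num.trunc X in qX Xq; rewrite -nat1r in Xq.
have q0 : (0 < q)%N by rewrite -(ltr_nat R) -(ltrD2l 1) (le_lt_trans _ Xq)// addr0.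
have q1 : 1 <= q%:R :> R by rewrite ler1n.
pose klo := (1 - 2 * (e / 3)) * y.
have klo0 : 0 <= klo by rewrite mulr_ge0 ?(ltW y0)//; clear -e2; lra.
have Y0 : 0 <= klo / q%:R by rewrite divr_ge0.
have /andP[mY Ym] := truncn_itv Y0.
set m := Num.trunc _ in mY Ym.
have qm : q%:R * m%:R <= klo by rewrite mulrC -ler_pdivlMr// (lt_le_trans ltr01).
exists q, m.+1; split => //.
- by rewrite -/klo mulrC -ler_pdivrMr ?ltW// (lt_le_trans ltr01).
- have qn : q%:R * n%:R <= e * y / 9.
    rewrite ler_pdivlMr// (_ : _ * 9 = q%:R * (9 * n%:R)); last by ring.
    by rewrite -ler_pdivlMr.
  have qqn : q%:R <= q%:R * n%:R :> R by rewrite ler_peMr.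
  have : klo + e * y / 9 * 2 <= (1 - e / 3) * y.
    have ey : 0 <= e * y by rewrite mulr_ge0 ?ltW.
    by rewrite /klo; clear -ey; lra.
  have -> : q%:R * (m.+1%:R + n%:R) = q%:R * m%:R + q%:R + q%:R * n%:R :> R.
    by rewrite -nat1r; ring.
  by clear -qm qn qqn; lra.
rewrite -nat1r addrC lerD2r (le_trans mY)// ler_pdivrMr ?(lt_le_trans ltr01)//.
have qX2 : X <= 2 * q%:R by clear -Xq q1; lra.
have e18 : 0 <= 18 / e * n%:R by rewrite mulr_ge0// divr_ge0// ltW.
apply: (@le_trans _ _ (18 / e * n%:R * (X / 2))); last first.
  by rewrite ler_wpM2l//; clear -qX2; lra.
have -> : 18 / e * n%:R * (X / 2) = y.
  by rewrite /X; field; rewrite !gt_eqF// (lt_le_trans ltr01).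
by rewrite /klo ler_piMl ?(ltW y0)//; clear -e0; lra.
Qed.

(** Supplies the bound [nm] on the number of zeros: the first inequality is the condition of
    [power_sum_lower_bound], the second limits [nm] to a multiple of [log T]. *)
Lemma last_power_le (C M Q : R) : 0 < C -> C <= M -> 2 <= Q ->
  exists2 n : nat, M < C * Q ^+ n.+1 & C * Q ^+ n <= M.
Proof.
move=> C0 CM Q2; have Q0 : 0 <= Q by apply: le_trans Q2.
have npow : exists n, M < C * Q ^+ n.+1.
  exists (Num.trunc (M / C)).
  have /andP[_] : (Num.trunc (M / C))%:R <= M / C < (Num.trunc (M / C)).+1%:R.
    by apply: truncn_itv; rewrite divr_ge0 ?(ltW C0)// (le_trans (ltW C0)).
  rewrite ltr_pdivrMr// mulrC => /lt_le_trans; apply.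
  rewrite ler_wpM2l ?(ltW C0)//; apply: (@le_trans _ _ (2 ^+ (Num.trunc (M / C)).+1)).
    by rewrite -natrX ler_nat ltnW// ltn_expl.
  by rewrite lerXn2r ?nnegrE.
have [n Pn nmin] := ex_minnP npow; exists n => //.
case: n Pn nmin => [|n] _ nmin; first by rewrite expr0 mulr1.
by rewrite leNgt; apply/negP => /nmin; rewrite ltnn.
Qed.

Lemma expR_half_pow n : expR (n%:R / 2) <= 2 ^+ n :> R.
Proof.
rewrite expRM_natl lerXn2r ?nnegrE ?expR_ge0//.
rewrite -(@ler_pXn2r _ 2%N) ?nnegrE ?expR_ge0// -expRM_natl mulrV ?unitfE//.
by apply: (le_trans (expR1_le4 R)); rewrite -natrX.
Qed.

Lemma pow_dominates (t M C : R) (K nm : nat) : 0 < C -> M <= expR (2 * t) * C ->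
  4 * t < K%:R -> (nm <= K)%N -> M * K.+1%:R ^+ nm < C * 4 ^+ (K * K).
Proof.
move=> C0 Mt tK nmK; have Kp : K.+1%:R <= 2 ^+ K :> R by rewrite -natrX ler_nat ltn_expl.
have h1 : K.+1%:R ^+ nm <= 2 ^+ (K * K) :> R.
  apply: (@le_trans _ _ (K.+1%:R ^+ K)); first by rewrite ler_weXn2l// ler1n.
  by rewrite exprM lerXn2r ?nnegrE ?exprn_ge0.
have h2 : expR (2 * t) < 2 ^+ (K * K).
  apply: (@lt_le_trans _ _ (expR (K%:R / 2))); first by rewrite ltr_expR; clear -tK; lra.
  apply: (le_trans (expR_half_pow K)); rewrite ler_weXn2l ?ler1n//.
  by case: (K) => // j; rewrite leq_pmulr.
have p0 : 0 < 2 ^+ (K * K) :> R by rewrite exprn_gt0.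
apply: (@le_lt_trans _ _ (expR (2 * t) * C * 2 ^+ (K * K))).
  apply: (le_trans (ler_wpM2r _ Mt)); first by rewrite exprn_ge0.
  by rewrite ler_wpM2l// mulr_ge0 ?expR_ge0// ltW.
have -> : (4 : R) ^+ (K * K) = 2 ^+ (K * K) * 2 ^+ (K * K) by rewrite -exprMn -natrM.
by rewrite mulrA ltr_pM2r// mulrC ltr_pM2l.
Qed.

(** Absorbs the degree [K * K], which bounds the number of far zeros, into their gain [2^-(q i)]. *)
Lemma square_le_expR : exists2 y0 : R, 0 < y0 & forall y, y0 <= y -> y * y <= expR (y / 4).
Proof.
have q4 : (0 : R) < 1 / 4 by rewrite divr_gt0.
have q2 : (0 : R) < 1 / 2 by rewrite divr_gt0.
have [y0 y00 h] := phR_lim 2 q4 q2; exists y0 => // y /h; rewrite /phR.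
rewrite mulNr expRN ler_pdivrMr ?expR_gt0// (_ : 1 / 4 * y = y / 4); last by field.
rewrite (_ : 2`!%:R = 2 :> R)// expr2; set E := expR _; lra.
Qed.

End Numerics.

Theorem no_small_Delta (R : realType) (G : beurling R) (kappa A theta : R)
    (F : R[i] -> R[i]) (e : R) : axiomA G kappa A theta -> is_zeta G theta F ->
  0 < e -> e <= 1 / 2 ->
  exists T0, exists2 eta, 0 < eta & exists L0, forall (L beta gamma : R),
  let T := nc (Complex beta gamma) in
  L0 <= L -> T0 <= T -> ln T <= eta * L -> 0 < beta < 1 -> 1 - beta <= eta ->
  F (Complex beta gamma) = 0 ->
  ~ (forall u, (1 - e) * L <= u <= L ->
    `|bpsi G (expR u) - expR u| <= expR (- (1 + e) * ln T) * expR (beta * u)).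
Proof.
move=> hA zF e0 e2; have [kappa0 A0 /andP[th0 th1] _] := hA.
set R1 := 1 - theta; have R10 : 0 < R1 by rewrite subr_gt0.
have R1_1 : R1 <= 1 by rewrite gerBl ltW.
(* [J] bounds [m / n] up to rounding, so [2^m 128^n <= 2 (2^(J + 7))^n]. [J'] is large enough that
   the power [J'] of [T^e] exceeds [T^2], which is to be compared with the bound [Q^n = O(T)] from
   the count of zeros. *)
pose J := (Num.trunc (18 / e)).+1; pose J' := (Num.trunc (4 / e)).+1.
have trunc_gt (a : R) : 0 < a -> a / e <= (Num.trunc (a / e)).+1%:R.
  by move=> a0; have /andP[_ /ltW] := truncn_itv (ltW (divr_gt0 a0 e0)).
have eJ : 18 / e <= J%:R by apply: trunc_gt.
have eJ' : 4 <= J'%:R * e by rewrite -ler_pdivrMr//; apply: trunc_gt.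
pose Q : R := 2 ^+ ((J + 7) * J').
have Q2 : 2 <= Q by rewrite -[leLHS]expr1 ler_weXn2l ?ler1n.
(* Small de makes the number n of relevant zeros so small that Turan's loss,
   at most 2 (2^(J + 7))^n, is dominated by T^e. *)
pose de := R1 / (8 * Q).
have Qde : 8 * Q * de = R1 by rewrite /de mulrC divfK// gt_eqF//; clear -Q2; lra.
have de0 : 0 < de by rewrite divr_gt0//; clear -Q2; lra.
have de16R : 16 * de <= R1.
  by rewrite -Qde ler_wpM2r ?(ltW de0)//; clear -Q2; lra.
have de16 : de <= 1 / 16 by clear -de16R R1_1; lra.
have [eta1 eta10 [L1 hB]] := Bz_small zF e0 e2 de0 de16.
pose de1 := rdelta e de; have de10 : 0 < de1.
  rewrite mulr_gt0// subr_gt0 ltr_pdivrMr// mul1r.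
  have : (e / 3) ^+ 2 <= 1 ^+ 2 by rewrite lerXn2r ?nnegrE ?divr_ge0 ?(ltW e0)//; clear -e2; lra.
  by rewrite expr1n; clear; lra.
have [y0 y00 hy0] := square_le_expR R.
pose Z := zr F (1 + de).
have Z0 : 0 <= Z.
  have h : 1 < 1 + de by clear -de0; lra.
  by apply: le_trans (sum_npow_le zF fset0 h); rewrite big_nil.
pose CM := 1 + 3 * kappa + 2 * A * (3 + 2 / R1).
have CM0 : 0 <= CM by rewrite !addr_ge0 ?mulr_ge0 ?addr_ge0 ?divr_ge0 ?ltW.
pose C2 := 2 * CM * Z; have C20 : 0 <= C2 by rewrite !mulr_ge0.
have [c cE] : {c : R | c = 192} by exists 192.
have c0 : 0 <= c by rewrite cE ler0n.
pose C4 := c ^+ J' * C2; have C40 : 0 <= C4.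
  by apply: mulr_ge0 => //; apply: exprn_ge0.
(* [C4 < T] is the final contradiction. The bound [de / 25] on [1 - beta] makes [d <= 1.04 de], and
   [e * de1 / 36] makes [36 log T <= e y], which leaves room for the at most [4 log T] zeros in the
   window. *)
exists (5 + C2 + C4); exists (Num.min eta1 (Num.min (de / 25) (e * de1 / 36))).
  by rewrite !lt_min eta10 (divr_gt0 de0)// divr_gt0// mulr_gt0.
exists (Num.max L1 ((y0 + 2) / de1)) => L beta gamma T; rewrite ge_max => /andP[LL1 Ly].
move=> T0 TL /andP[beta0 beta1] beta2 Fz psiE.
pose t := ln T; pose y := de1 * L.
have L0 : 0 < L by apply: lt_le_trans Ly; rewrite divr_gt0// addr_gt0.
have yy : y0 + 2 <= y by rewrite /y mulrC -ler_pdivrMr.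
have y2 : 2 <= y by clear -yy y00; lra.
have hyy : y * y <= expR (y / 4) by apply: hy0; clear -yy; lra.
have T5 : 5 <= T by clear -T0 C20 C40; lra.
have TC2 : C2 <= T by clear -T0 C20 C40; lra.
have TC4 : C4 < T by clear -T0 C20 C40; lra.
have Tp : 0 < T by clear -T5; lra.
have t0 : 0 <= t by rewrite ln_ge0//; clear -T5; lra.
have ET : expR t = T by rewrite lnK.
move: TL beta2; set eta := Num.min _ _ => TL beta2.
have eta_1 : eta <= eta1 by rewrite ge_min lexx.
have eta_2 : eta <= de / 25 by rewrite !ge_min lexx orbT.
have eta_3 : eta <= e * de1 / 36 by rewrite !ge_min lexx !orbT.
have TL1 : ln T <= eta1 * L by apply: (le_trans TL); rewrite ler_wpM2r// ltW.
have beta21 : 1 - beta <= eta1 by apply: le_trans eta_1.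
have ty : 36 * t <= e * y.
  have : eta * L <= e * de1 / 36 * L by rewrite ler_wpM2r// ltW.
  by move: TL; rewrite -/t (_ : e * y = 36 * (e * de1 / 36 * L)); [clear; lra|rewrite /y; field].
have ey : e * y <= 1 / 2 * y by rewrite ler_wpM2r//; clear -y2; lra.
have {hB} hB := hB L beta gamma LL1 T5 TL1 (introT andP (conj beta0 beta1)) beta21 psiE.
set d := 1 + de - beta in hB.
have ded : de <= d by rewrite /d; clear -beta1; lra.
have dde : 100 * d <= 104 * de by rewrite /d; clear -beta2 eta_2; lra.
have d0 : 0 < d by apply: lt_le_trans ded.
have d8 : 8 * d <= R1 by clear -dde de16R de0; lra.
have d4 : 4 * d <= 1 - theta by rewrite -/R1; clear -d8 d0; lra.
have Qd : Q <= R1 / (4 * d).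
  rewrite ler_pdivlMr ?mulr_gt0// -Qde (_ : Q * _ = Q * d * 4); last by ring.
  have : Q * d <= Q * (2 * de) by rewrite ler_wpM2l//; clear -Q2 dde de0; lra.
  by clear; lra.
set Q' := R1 / (4 * d) in Qd; have Q'2 : 2 <= Q' by apply: le_trans Qd.
set sig := Complex (1 + de) gamma in hB *.
have gT : T - 1 <= `|gamma|.
  have := nc_ReIm (Complex beta gamma); rewrite -/T /= (ger0_norm (ltW beta0)).
  by clear -beta1; lra.
have w1 : 1 <= nc (sig - 1).
  by apply: le_trans (nc_Im _); rewrite cImD cImN /= subr0; clear -gT T5; lra.
have Ims : de <= `|complex.Im sig| by rewrite /=; clear -gT T5 de16; lra.
have s1 : 1 < complex.Re sig by rewrite /=; clear -de0; lra.
have nT : nc sig <= 2 * T.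
  apply: (le_trans (nc_ReIm _)) => /=.
  have := nc_Im (Complex beta gamma); rewrite -/T /= (ger0_norm (_ : 0 <= 1 + de)).
    by clear -de16 T5; lra.
  by clear -de0; lra.
pose M := 1 + 3 * kappa + 2 * A * (3 + nc sig / R1).
have Cle k : nc (Cz G k sig) * R1 ^+ k <= M by apply: (Cz_axiomA hA zF).
have M0 : 0 <= M.
  by rewrite !addr_ge0 ?mulr_ge0 ?addr_ge0 ?divr_ge0 ?nc_ge0 ?(ltW kappa0) ?(ltW A0) ?(ltW R10).
have MT : M <= CM * T.
  have T1 : 1 <= T by clear -T5; lra.
  have -> : CM * T = T + 3 * kappa * T + 2 * A * (3 * T + 2 * T / R1) by rewrite /CM; ring.
  apply: lerD; first by apply: lerD => //; rewrite ler_peMr// mulr_ge0// ltW.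
  apply: ler_wpM2l; first by rewrite mulr_ge0// ltW.
  apply: lerD; first by rewrite ler_peMr.
  by rewrite ler_wpM2r ?invr_ge0 ?(ltW R10).
have C0E : Cz G 0 sig = F sig by exact: (Cz0 zF).
have ZC : 1 <= Z * nc (Cz G 0 sig) by rewrite C0E; exact: (nc_zeta_ge zF s1).
have C0p : 0 < nc (Cz G 0 sig).
  rewrite lt_neqAle nc_ge0 andbT eq_sym; apply/eqP => E.
  by move: ZC; rewrite E mulr0; clear; lra.
have C0n : Cz G 0 sig != 0 by rewrite -nc_gt0.
have M2 : 2 * M <= C2 * T * nc (Cz G 0 sig).
  have -> : C2 * T * nc (Cz G 0 sig) = 2 * (CM * T) * (Z * nc (Cz G 0 sig)).
    by rewrite /C2; ring.
  have h : 0 <= 2 * (CM * T) by rewrite !mulr_ge0// ltW.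
  by apply: (le_trans _ (ler_peMr h ZC)); rewrite ler_wpM2l.
have rec k := Cz_recurrence zF k s1.
have Fs0 : F (sig - d%:C%C) = 0.
  by rewrite -Fz; congr F; apply/eqP; rewrite eq_complex /= /d oppr0 addr0 eqxx andbT; apply/eqP; ring.
have Cd := zeta_power_series_zero zF (erefl _ : complex.Re sig = 1 + de) de0 ded dde d4 Ims Fs0 Cle.
have C0M : nc (Cz G 0 sig) <= 2 * M.
  by have := Cle 0%N; rewrite expr0 mulr1; clear -M0; lra.
have [nm nm1 nm2] := last_power_le C0p C0M Q'2.
have QT : Q' ^+ nm <= C2 * T.
  by rewrite -(ler_pM2l C0p) (le_trans nm2)// (le_trans M2)// mulrC.
have TT : C2 * T <= expR (2 * t).
  have -> : expR (2 * t) = T * T by rewrite -ET -expRD; congr expR; ring.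
  by rewrite ler_wpM2r// ltW.
have nm4 : nm%:R <= 4 * t.
  have : nm%:R / 2 <= 2 * t.
    rewrite -ler_expR; apply: (le_trans (expR_half_pow R nm)); apply: le_trans TT.
    by apply: le_trans QT; rewrite lerXn2r ?nnegrE// (le_trans _ Q'2).
  by clear; lra.
pose khi := (1 - e / 3) * y.
have khi1 : 5 / 6 * y <= khi.
  by rewrite ler_wpM2r//; [clear -y2|clear -e2]; lra.
have khiy : khi <= y by rewrite /khi ler_piMl//; [clear -y2|clear -e0]; lra.
have khi0 : 0 <= khi by clear -khi1 y2; lra.
have /andP[Kk kK] := truncn_itv khi0; set K := Num.trunc khi in Kk kK.
have tK : 4 * t < K%:R by move: kK; rewrite -nat1r; clear -ty ey khi1 y2; lra.
have nmK : (nm <= K)%N by rewrite -(ler_nat R) (le_trans nm4)// ltW.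
have K0 : (0 < K)%N by rewrite -(ltr_nat R) (le_lt_trans _ tK)// mulr_ge0.
have MC : 2 * M <= expR (2 * t) * nc (Cz G 0 sig).
  by apply: (le_trans M2); rewrite ler_wpM2r// ltW.
have hN := pow_dominates C0p MC tK nmK.
have [n /andP[n0 nnm] hn] :=
  @power_sum_lower_bound R (fun k => Cz G k sig) (fun k => Bz G k sig) M R1 d
    M0 d0 d8 C0n rec Cle Cd K _ nm K0 nm1 hN.
have nnm' : n%:R <= nm%:R :> R by rewrite ler_nat.
have ny : 9 * n%:R <= e * y by clear -nnm' nm4 ty; lra.
have [q [m [q0 klo_le qmn mJ]]] := window_params e0 e2 n0 ny.
have qmnK : (q * (m + n) <= K)%N.
  by rewrite -ltnS -(ltr_nat R) natrM natrD (le_lt_trans qmn).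
have [|i /andP[mi imn]] := hn q m q0 qmnK.
  by rewrite (leq_trans qmnK)// leq_pmulr.
have qi0 : (0 < q * i)%N by rewrite muln_gt0 q0 (leq_trans _ mi).
(* The power sum of exponent [q i] corresponds to the coefficient of index [q i - 1], which is still
   at least [q m] because [i > m] and [q >= 1]. *)
set k := (q * i).-1; have kE : k.+1 = (q * i)%N by rewrite prednK.
have qi_lo : (1 - 2 * (e / 3)) * y <= k%:R.
  apply: (le_trans klo_le); rewrite -natrM ler_nat -ltnS kE.
  by rewrite (leq_trans (_ : _ < q * m.+1)%N) ?leq_mul// mulnS -add1n leq_add2r.
have qi_hi : k%:R <= (1 - e / 3) * y.
  apply: le_trans qmn; rewrite -natrD -natrM ler_nat -ltnS kE.
  by rewrite (leq_trans (_ : _ <= q * (m + n))%N) ?leq_mul.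
have X1 := hB k (introT andP (conj qi_lo qi_hi)).
have X2 : (K * K)%:R * 2^-1 ^+ (q * i) <= expR (- e * t).
  rewrite natrM; apply: (@le_trans _ _ (expR (y / 4) * expR (- (y / 3)))).
    apply: ler_pM; rewrite ?mulr_ge0 ?exprn_ge0//.
      by apply: le_trans hyy; apply: ler_pM => //; apply: le_trans khiy.
    rewrite expRN exprVn lef_pV2 ?posrE ?expR_gt0 ?exprn_gt0//.
    rewrite -kE; apply: le_trans (expR_half_pow R k.+1); rewrite ler_expR -[k.+1%:R]nat1r.
    have : 2 / 3 * y <= (1 - 2 * (e / 3)) * y.
      by rewrite ler_wpM2r//; [clear -y2|clear -e2]; lra.
    by clear -qi_lo; lra.
  rewrite -expRD ler_expR.
  have : e * t <= 1 / 2 * t by rewrite ler_wpM2r.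
  by clear -ty ey y2; lra.
rewrite -kE in X2 *; move=> H.
set W : R := 2 ^+ m * 128 ^+ n in H; have W0 : 0 <= W by rewrite mulr_ge0 ?exprn_ge0.
pose E := expR (- e * t).
(* Here [96 = 2 * 4 * 12], and [12 = 11 + 1] collects the coefficient and the far zeros. Rounding up
   [m] doubles this to 192. *)
have H2 : 1 <= 96 * (W * E).
  apply: (le_trans H); rewrite (_ : 96 * (W * E) = 2 * W * (4 * (12 * E))); last by ring.
  apply: ler_wpM2l; first by rewrite mulr_ge0.
  apply: ler_wpM2l => //; apply: (le_trans (lerD X1 X2)).
  by rewrite -/T -/t -/E; clear; lra.
pose Y : R := 2 ^+ ((J + 7) * n).
have Y0 : 0 <= Y by rewrite exprn_ge0.
have WY : W <= 2 * Y.
  have mJn : (m <= (J * n).+1)%N.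
    rewrite -(ler_nat R) -nat1r natrM addrC (le_trans mJ)// lerD2r.
    by rewrite ler_wpM2r.
  have -> : 2 * Y = 2 ^+ (J * n).+1 * 128 ^+ n.
    have e7 : 2 ^+ 7 = 128 :> R by rewrite -natrX.
    by rewrite /Y mulnDl exprD (exprM _ 7 n) e7 mulrA -exprS.
  by rewrite ler_wpM2r ?exprn_ge0// ler_weXn2l// ler1n.
have eY : expR (e * t) <= c * Y.
  rewrite cE.
  have : 1 <= 192 * Y * E.
    apply: (le_trans H2); rewrite (_ : 192 * Y * E = 96 * (2 * Y * E)); last by ring.
    by rewrite ler_wpM2l// ler_wpM2r// expR_ge0.
  by rewrite /E mulNr expRN ler_pdivlMr ?expR_gt0// mul1r.
have : expR (2 * t) <= C4 * T.
  apply: (@le_trans _ _ (expR (e * t) ^+ J')).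
    rewrite -expRM_natl ler_expR mulrA ler_wpM2r//.
    by clear -eJ'; lra.
  apply: (@le_trans _ _ ((c * Y) ^+ J')).
    by rewrite lerXn2r ?nnegrE ?expR_ge0// mulr_ge0.
  rewrite exprMn /C4 -mulrA; apply: ler_wpM2l; first by apply: exprn_ge0.
  apply: le_trans QT; rewrite /Y -exprM mulnAC exprM -/Q.
  apply: (@le_trans _ _ (Q' ^+ n)).
    have Q0 : 0 <= Q by apply: le_trans Q2.
    by rewrite lerXn2r ?nnegrE//; apply: le_trans Q'2.
  by rewrite ler_weXn2l//; apply: le_trans Q'2; rewrite ler1n.
have -> : expR (2 * t) = T * T by rewrite -ET -expRD; congr expR; ring.
by rewrite ler_pM2r// leNgt TC4.
Qed.

Lemma powR_expR (R : realType) (x a : R) : 0 < x -> x `^ a = expR (a * ln x).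
Proof. by move=> x0; rewrite /powR gt_eqF. Qed.

(* In this case bzeta vanishes identically, so omega is unbounded below. *)
Lemma not_zeta_omega_inf (R : realType) (G : beurling R) (theta x : R) (rho : R[i]) :
  theta < 1 -> ~ (exists F, is_zeta G theta F) -> expR 2 < x ->
  (omega rho x)%:E != omega_inf G theta x.
Proof.
move=> th1 nF x2; apply/eqP => E.
have z0 : bzeta G theta = fun=> 0.
  by apply: xgetPN => F hF; apply: nF; exists F.
have L2 : 2 < ln x by rewrite -ltr_expR lnK// posrE (lt_trans _ x2)// expR_gt0.
pose b := 2 + `|omega rho x|.
have b2 : 2 <= b by rewrite lerDl.
have bz : zeta_zero G theta (Complex b 0).
  split; rewrite ?z0//=; first by apply: (lt_le_trans th1); apply: le_trans b2; rewrite ler1n.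
  by apply/eqP => -[b1]; move: b2; rewrite b1 -subr_ge0; lra.
have : (omega_inf G theta x <= (omega (Complex b 0) x)%:E)%E.
  by apply: ereal_inf_lbound; exists (Complex b 0).
have -> : omega (Complex b 0) x = (1 - b) * ln x + ln b.
  by rewrite /omega /= expr0n addr0 sqrtr_sqr ger0_norm// (le_trans _ b2).
rewrite -E lee_fin; have lnb : ln b <= b - 1.
  have := expR_ge1Dx (ln b); rewrite lnK ?posrE ?(lt_le_trans _ b2)//; lra.
have : (1 - b) * ln x <= (1 - b) * 2.
  by rewrite ler_wnM2l ?(ltW L2)//; lra.
have := ler_norm (- omega rho x); rewrite normrN; move: b2 lnb; rewrite /b; lra.
Qed.

Theorem theorem10 (R : realType) (G : beurling R) (kappa A theta : R)
    (hA : axiomA G kappa A theta) (htheta0 : theta0 G theta = 1%:E)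
    (eps : R) (heps : 0 < eps) :
  exists x0 : R, forall x : R, x0 < x ->
    forall rho1 : R[i], zeta_zero G theta rho1 ->
      (omega rho1 x)%:E = omega_inf G theta x ->
      exists xi : R, [/\ x `^ (1 - eps) <= xi, xi <= x
        & xi `^ (complex.Re rho1)
            / (ComplexField.Normc.normc rho1) `^ (1 + eps)
          <= `|bDelta G xi| ].
Proof.
have [_ _ /andP[th0 th1] _] := hA.
have [exF|nF] := pselect (exists F, is_zeta G theta F); last first.
  exists (expR 2) => x x2 rho1 _ E.
  by have := not_zeta_omega_inf rho1 th1 nF x2; rewrite E eqxx.
have zF : is_zeta G theta (bzeta G theta) := xgetPex (fun=> 0) exF.
set F := bzeta G theta in zF.
(* Shrinking [eps] strengthens the claim: the interval for [xi] becomes shorter and, as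
   [|rho1| > 1], the lower bound becomes larger. *)
pose e := Num.min eps (1 / 2).
have e0 : 0 < e by rewrite lt_min heps divr_gt0.
have e2 : e <= 1 / 2 by rewrite ge_min lexx orbT.
have eeps : e <= eps by rewrite ge_min lexx.
have [T0 [eta eta0 [L0 hno]]] := no_small_Delta hA zF e0 e2.
(* Zeros of modulus at most [T0] keep the distance [eta2] from the line [Re s = 1]. Since [rho1]
   will be closer, its modulus exceeds [T0], and also 1, which gives [log T >= 0]. *)
have [eta2 eta20 hfree] := zeta_zero_free zF th1 (Num.max T0 1).
pose h := Num.min eta eta2 / 4.
have h0 : 0 < h by rewrite divr_gt0// lt_min eta0.
have h1 : 4 * h <= eta by rewrite /h mulrC divfK// ge_min lexx.
have h2 : 4 * h <= eta2 by rewrite /h mulrC divfK// ge_min lexx orbT.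
(* As [theta < 1], the value 1 of [theta0] is attained by the supremum over the zeros, so some zero
   lies within [h] of the line. *)
have [b [g [b1 b2 bz]]] : exists b g, [/\ theta < b, 1 - h < b < 1 & F (Complex b g) = 0].
  move: htheta0; rewrite /theta0; set S := [set _ | _ in _] => hS.
  have : ((1 - h)%:E < ereal_sup S)%E.
    have -> : ereal_sup S = 1%:E.
      move: hS; rewrite /maxe; case: ifP => // _ /eqP; rewrite eqe => /eqP th.
      by move: th1; rewrite th ltxx.
    by rewrite lte_fin gtrBl.
  move=> /ereal_sup_gt[_ [b [/andP[b1 b2] [g bg]] <-]]; rewrite lte_fin => hb.
  by exists b, g; split=> //; rewrite hb.
(* Beyond [L1], the logarithms of [|b + i g|] and [theta] are together at most [h L] in absolute
   value. Comparison of [rho1] with the fixed zero [b + i g] then bounds [(1 - beta) L + log T] by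
   [2 h L], and [T > theta] keeps [log T] above [- h L]. *)
pose L1 := Num.max 1 (Num.max L0 ((`|ln (nc (Complex b g))| + `|ln theta|) / h)).
exists (expR L1) => x xL1 rho1 [th_rho rho_1 rho_z] om.
have x0 : 0 < x by apply: lt_trans xL1; exact: expR_gt0.
pose L := ln x; have xL : expR L = x by rewrite lnK.
have L1L : L1 <= L by rewrite -ler_expR xL ltW.
move: L1L; rewrite !ge_max => /and3P[L_1 L0L]; rewrite ler_pdivrMr// => Lh.
have Lp : 0 < L by apply: lt_le_trans L_1.
have omle : omega rho1 x <= omega (Complex b g) x.
  rewrite -lee_fin om; apply: ereal_inf_lbound; exists (Complex b g) => //.
  split=> //; apply/eqP => /(congr1 (@complex.Re R)) /= bE.
  by move: b2; rewrite bE ltxx andbF.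
pose beta := complex.Re rho1; pose T := nc rho1.
have thT : theta < T.
  by apply: (lt_le_trans th_rho); exact: Re_le_nc.
have Tp : 0 < T by apply: lt_trans thT.
have lnT : - `|ln theta| <= ln T.
  apply: (@le_trans _ _ (ln theta)).
    by have := ler_norm (- ln theta); rewrite normrN; lra.
  by rewrite ler_ln ?posrE// ltW.
have beta1 : beta < 1 by apply: (zeta_zero_lt1 zF th1 rho_1).
have om2 : (1 - beta) * L + ln T <= (1 - b) * L + ln (nc (Complex b g)) := omle.
have bh : (1 - b) * L <= h * L by rewrite ler_wpM2r ?(ltW Lp)//; case/andP: b2; lra.
have n1 := ler_norm (ln (nc (Complex b g))).
have n2 := normr_ge0 (ln theta).
have bL0 : 0 <= (1 - beta) * L by rewrite mulr_ge0 ?(ltW Lp)// subr_ge0 ltW.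
have hL : 0 <= h * L by rewrite mulr_ge0// ltW.
have beta_h : 1 - beta <= 3 * h.
  by rewrite -(ler_pM2r Lp); move: om2 bh n1 lnT Lh hL; clear; lra.
have TT0 : Num.max T0 1 < T.
  rewrite ltNge; apply/negP => TT; have := hfree _ rho_1 TT rho_z.
  by rewrite -/beta; move: beta_h h2 h0; clear; lra.
move: TT0; rewrite gt_max => /andP[TT0 T1].
have lnT0 : 0 <= ln T by rewrite ln_ge0// ltW.
have lnTh : ln T <= eta * L.
  apply: (@le_trans _ _ (4 * h * L)); last by rewrite ler_wpM2r// ltW.
  by move: om2 bh n1 n2 bL0 hL Lh; clear; lra.
apply: contrapT => nxi.
have rhoE : rho1 = Complex beta (complex.Im rho1) by apply/eqP; rewrite eq_complex !eqxx.
apply: (hno L beta (complex.Im rho1)); rewrite -?rhoE -/T ?(ltW TT0)//.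
- by rewrite (lt_trans th0 th_rho).
- by move: beta_h h1 h0; clear; lra.
move=> u /andP[u1 u2]; apply: contrapT => /negP; rewrite -ltNge => hlt; apply: nxi.
exists (expR u); split.
- rewrite powR_expR// ler_expR (le_trans _ u1)// ler_wpM2r ?(ltW Lp)//.
  by move: eeps; clear; lra.
- by rewrite -xL ler_expR.
rewrite powR_expR ?expR_gt0// expRK powR_expR// -expRN -/T -/beta.
apply: le_trans (ltW hlt); rewrite mulrC ler_wpM2r ?expR_ge0//.
by rewrite ler_expR mulNr lerN2 ler_wpM2r// lerD2l.
Qed.
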